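(* Assume the setting below with $m\ge1$, that $(h_1^* )$ holds, that $g_i,k_j$ satisfy $(h_2)$ and $(h_3)$, and that $\alpha_i>0$ with $$\alpha_i g_0^i<\lambda_0\quad\text{and}\quad \alpha_i g_\infty^i>\lambda_1^i\qquad\text{for all } i=1,\ldots,m.$$ Then there exists $\beta^{*}>0$ such that, if $\beta_j>\beta^{*}$ for all $j=0,\ldots,m+1$, the Dirichlet problem $$-\Delta u=\mathcal{F}(x,u)\ \text{in }\Omega,\qquad u=0\ \text{on }\partial\Omega$$ has at least $2^m-1$ positive radially symmetric classical solutions $u\in\mathcal{C}^2(\overline{\Omega})$.
   Context: Let $N\ge2$, $0<R_1<R_2$, and $\Omega=\{x\in\mathbb{R}^N: R_1<\|x\|<R_2\}$ (Euclidean norm). Let $m\ge1$, $\alpha_i>0$ ($i=1,\ldots,m$), $\beta_j>0$ ($j=0,\ldots,m+1$), let $A_i,B_j\colon[R_1,R_2]\to[0,+\infty)$ be continuous and $\mathcal{A}_i(x)=A_i(\|x\|)$, $\mathcal{B}_j(x)=B_j(\|x\|)$ for $x\in\overline\Omega$. Let $g_i,k_j\colon[0,+\infty)\to[0,+\infty)$ be continuous and $\mathcal{F}(x,s)=\sum_{i=1}^m\alpha_i\mathcal{A}_i(x)g_i(s)-\sum_{j=0}^{m+1}\beta_j\mathcal{B}_j(x)k_j(s)$. A solution is positive if $u>0$ in $\Omega$; radially symmetric means $u(x)=\mathcal{U}(\|x\|)$. $(h_1^* )$: there are points $R_1=\tau_0\le\sigma_1<\tau_1<\sigma_2<\cdots<\sigma_m<\tau_m\le\sigma_{m+1}=R_2$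 such that, for each $i$, $A_i\not\equiv0$ on $[\sigma_i,\tau_i]$ and $A_i\equiv0$ outside $[\sigma_i,\tau_i]$; for each $j=0,\ldots,m+1$, $B_j\equiv0$ outside $[\tau_j,\sigma_{j+1}]$, and whenever $\tau_j<\sigma_{j+1}$, $B_j$ is not identically zero on any right neighbourhood of $\tau_j$ nor on any left neighbourhood of $\sigma_{j+1}$ within $[\tau_j,\sigma_{j+1}]$. $(h_2)$: $g_i(0)=0$, $g_i(s)>0$ for $s>0$; $k_j(0)=0$, $k_j(s)>0$ for $s>0$. Notation: $g_0^i=\limsup_{s\to0^+}g_i(s)/s$, $g_\infty^i=\liminf_{s\to+\infty}g_i(s)/s$, $k_0^j=\limsup_{s\to0^+}k_j(s)/s$. $(h_3)$: $g_0^i<+\infty$, $g_\infty^i>0$, $k_0^j<+\infty$ for all $i,j$. Change of variables: $h(r)=\int_{R_1}^r\xi^{1-N}\,d\xi$, $L=h(R_2)$, $r(t)=h^{-1}(t)$ for $t\in[0,L]$, and $a_i(t)=r(t)^{2(N-1)}A_i(r(t))$. Then $\lambda_0>0$ is the first eigenvalue of $\varphi''+\lambda\bigl[\sum_{i=1}^m a_i(t)\bigr]\varphi=0$, $\varphi(0)=\varphi(L)=0$, and $\lambda_1^i>0$ is the first eigenvalue of $\varphi''+\lambda a_i(t)\varphi=0$ on $[h(\sigma_i),h(\tau_i)]$ with zero Dirichlet conditions at both endpoints.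
   Formalization: The index j of B_j, k_j, β_j runs over 0,…,m instead of 0,…,m+1, because (h_1^* ) defines no points τ_{m+1}, σ_{m+2}, so the interval [τ_{m+1},σ_{m+2}] for j=m+1 does not exist. *)

(* Defs.v *)
From Stdlib Require Import Reals Lra Lia.
Open Scope R_scope.

Definition vec := nat -> R.

Definition in_RN (N : nat) (x : vec) : Prop := forall k, (N <= k)%nat -> x k = 0.

Fixpoint sum_upto (f : nat -> R) (n : nat) : R :=
  match n with
  | O => 0
  | S n' => sum_upto f n' + f n'
  end.

Definition enorm (N : nat) (x : vec) : R := sqrt (sum_upto (fun k => x k ^ 2) N).
Definition edist (N : nat) (x y : vec) : R := enorm N (fun k => x k - y k).

Definition annulus (N : nat) (R1 R2 : R) (x : vec) : Prop :=
  in_RN N x /\ R1 < enorm N x < R2.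
Definition annulus_cl (N : nat) (R1 R2 : R) (x : vec) : Prop :=
  in_RN N x /\ R1 <= enorm N x <= R2.
Definition annulus_bd (N : nat) (R1 R2 : R) (x : vec) : Prop :=
  in_RN N x /\ (enorm N x = R1 \/ enorm N x = R2).

Definition cont_on (N : nat) (S : vec -> Prop) (f : vec -> R) : Prop :=
  forall x, S x -> forall eps, 0 < eps -> exists delta, 0 < delta /\
    forall y, S y -> edist N x y < delta -> Rabs (f y - f x) < eps.

Definition cont_on_R (S : R -> Prop) (f : R -> R) : Prop :=
  forall x, S x -> forall eps, 0 < eps -> exists delta, 0 < delta /\
    forall y, S y -> Rabs (y - x) < delta -> Rabs (f y - f x) < eps.

Definition upd (x : vec) (k : nat) (t : R) : vec :=
  fun j => if Nat.eq_dec j k then t else x j.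
Definition is_partial (f : vec -> R) (k : nat) (x : vec) (l : R) : Prop :=
  derivable_pt_lim (fun t => f (upd x k t)) (x k) l.

Definition Fnl (N m : nat) (alpha beta : nat -> R) (A B g k : nat -> R -> R)
  (x : vec) (s : R) : R :=
  sum_upto (fun i => alpha (S i) * A (S i) (enorm N x) * g (S i) s) m
  - sum_upto (fun j => beta j * B j (enorm N x) * k j s) (S m).

(** u is a positive radially symmetric classical solution in C^2(closure Omega)
    of  -Delta u = F(x,u) in Omega,  u = 0 on the boundary.
    D1 k = d u / d x_k and D2 k l = d/dx_l (d u/dx_k) on Omega; u, D1, D2 are
    required to be continuous on the closed annulus (i.e. u and its derivatives
    up to order 2 extend continuously to the closure). *)
Definition pos_radial_solution (N : nat) (R1 R2 : R) (F : vec -> R -> R)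
  (u : vec -> R) : Prop :=
  exists (D1 : nat -> vec -> R) (D2 : nat -> nat -> vec -> R),
    (forall x, annulus N R1 R2 x -> forall kk, (kk < N)%nat ->
        is_partial u kk x (D1 kk x)) /\
    (forall x, annulus N R1 R2 x -> forall kk l, (kk < N)%nat -> (l < N)%nat ->
        is_partial (D1 kk) l x (D2 kk l x)) /\
    cont_on N (annulus_cl N R1 R2) u /\
    (forall kk, (kk < N)%nat -> cont_on N (annulus_cl N R1 R2) (D1 kk)) /\
    (forall kk l, (kk < N)%nat -> (l < N)%nat ->
        cont_on N (annulus_cl N R1 R2) (D2 kk l)) /\
    (forall x, annulus N R1 R2 x ->
        - sum_upto (fun kk => D2 kk kk x) N = F x (u x)) /\
    (forall x, annulus_bd N R1 R2 x -> u x = 0) /\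
    (forall x, annulus N R1 R2 x -> 0 < u x) /\
    (exists U : R -> R, forall x, annulus_cl N R1 R2 x -> u x = U (enorm N x)).

(** Change of variables h(r) = int_{R1}^r xi^(1-N) d xi (closed form) and its
    inverse r(t) = h^{-1}(t). *)
Definition hfun (N : nat) (R1 r : R) : R :=
  if Nat.eq_dec N 2 then ln (r / R1)
  else (/ R1 ^ (N - 2) - / r ^ (N - 2)) / INR (N - 2).
Definition r_of (N : nat) (R1 t : R) : R :=
  if Nat.eq_dec N 2 then R1 * exp t
  else Rpower (/ R1 ^ (N - 2) - INR (N - 2) * t) (- / INR (N - 2)).

Definition aweight (N : nat) (R1 : R) (Ai : R -> R) (t : R) : R :=
  r_of N R1 t ^ (2 * (N - 1)) * Ai (r_of N R1 t).

Definition dirichlet_eig (a : R -> R) (t0 t1 lam : R) : Prop :=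
  exists phi dphi : R -> R,
    (forall t, t0 < t < t1 ->
       derivable_pt_lim phi t (dphi t) /\
       derivable_pt_lim dphi t (- (lam * a t * phi t))) /\
    cont_on_R (fun t => t0 <= t <= t1) phi /\
    phi t0 = 0 /\ phi t1 = 0 /\
    (exists t, t0 < t < t1 /\ phi t <> 0).

Definition first_eig (a : R -> R) (t0 t1 lam : R) : Prop :=
  0 < lam /\ dirichlet_eig a t0 t1 lam /\
  (forall mu, 0 < mu -> dirichlet_eig a t0 t1 mu -> lam <= mu).

Definition limsup0_lt (f : R -> R) (L : R) : Prop :=
  exists c, c < L /\ exists delta, 0 < delta /\
    forall s, 0 < s < delta -> f s <= c.
Definition liminfinf_gt (f : R -> R) (L : R) : Prop :=
  exists c, L < c /\ exists M, forall s, M < s -> c <= f s.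

Definition h1star (m : nat) (R1 R2 : R) (A B : nat -> R -> R)
  (sigma tau : nat -> R) : Prop :=
  tau 0%nat = R1 /\ sigma (S m) = R2 /\
  tau 0%nat <= sigma 1%nat /\ tau m <= sigma (S m) /\
  (forall i, (1 <= i <= m)%nat -> sigma i < tau i) /\
  (forall i, (1 <= i < m)%nat -> tau i < sigma (S i)) /\
  (forall i, (1 <= i <= m)%nat ->
     (exists r, sigma i <= r <= tau i /\ A i r <> 0) /\
     (forall r, R1 <= r <= R2 -> (r < sigma i \/ tau i < r) -> A i r = 0)) /\
  (forall j, (j <= m)%nat ->
     (forall r, R1 <= r <= R2 -> (r < tau j \/ sigma (S j) < r) -> B j r = 0) /\
     (tau j < sigma (S j) ->
        (forall eps, 0 < eps -> exists r,
           tau j <= r < tau j + eps /\ r <= sigma (S j) /\ B j r <> 0) /\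
        (forall eps, 0 < eps -> exists r,
           sigma (S j) - eps < r <= sigma (S j) /\ tau j <= r /\ B j r <> 0))).

(* Main.v *)
Require Import Defs.
From Stdlib Require Import ZArith Reals Lra Lia Classical ClassicalEpsilon.
From Stdlib Require Cantor.
From Coquelicot Require Import Coquelicot.
From mathcomp Require all_boot all_fingroup zify.
Open Scope R_scope.

(* In the variable [t = h |x|] the problem becomes
   [v'' + sum_i a_i alpha_i g_i(v) - sum_j beta_j b_j k_j(v) = 0] on [[0, L]], [v(0) = v(L) = 0].
   For each nonempty set [I] of indices there is a solution which is large at the midpoint [c_i]
   of [J_i = [h(sigma_i), h(tau_i)]] exactly when [i] is in [I].  The
   unstable directions are removed by two extra scalar unknowns [q_i] and [mu_i] per [i] in [I], with
     [q_i = clamp_[r,R] (q_i + mu_i)],  [mu_i = clamp_[-1,M] (mu_i + q_i - v(c_i))],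
   where [mu_i] perturbs the source on [J_i]: it damps [g_i] when negative and forces the equation
   when positive.  Schauder's theorem solves this extended (truncated) system.  Since [beta] is
   large, [v] is tiny at the ends of every [J_i]; pairing the equation with the first eigenfunction
   of [J_i] then excludes every case except [mu_i = 0] and [q_i = v(c_i)], that is, a genuine
   solution with [r <= v(c_i) <= R].
   Schauder's theorem comes from Sperner-type labellings: on a torus the number of fully labelled
   Freudenthal simplices is even for every labelling, so a labelling with exactly one such simplex
   away from the seam cannot lose it when it is changed away from the seam. *)

(** * Kuhn's lemma *)

(** All [g i] and [k j] vanish at 0, so the zero function always solves the problem, and Schauder's
    theorem alone cannot tell one fixed point from another. The extended system is therefore built
    so that every fixed point of it is a wanted solution. The mechanism is the complementarity
    hidden in [x = clamp lo hi (x + y)]: either [y = 0], or [x] sits at the end towards which [y]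
    pushes. Each bad end is refuted by an estimate of [v(c_i)]. The constants are fixed in the order
    [r], [R], [M], then the bounds of [v] and [v'], and [beta] last. This is possible because the
    [k j] terms only push [v''] upwards: for a nonnegative [v] vanishing at both ends, a lower bound
    of [v''] alone bounds [v] and [v'], and that bound is free of [beta]. Largeness of [beta] acts
    only through the smallness of [v] at the ends of the gaps. On each [J_i] the solution is
    concave, so that the midpoint value controls it: [v(c_i) * bump <= v <= 2 * v(c_i)]. The
    condition with [lambda_0] acts through [lambda_0 <= lambda_1^i], so that small data too are
    compared with the eigenfunction of [J_i]. *)

Module Kuhn.
Import all_boot all_fingroup zify.
Local Open Scope nat_scope.
Set Implicit Arguments. Unset Strict Implicit. Unset Printing Implicit Defensive.

Lemma even_card_involution (T : finType) (f : T -> T) (A : {set T}) :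
  (forall x, x \in A -> f x \in A) -> (forall x, x \in A -> f (f x) = x) ->
  (forall x, x \in A -> f x != x) -> ~~ odd #|A|.
Proof.
elim: {A}_.+1 {-2}A (ltnSn #|A|) => // c IH A ltA fA fK fne.
case: (set_0Vmem A) => [->|[x xA]]; first by rewrite cards0.
have fxA := fA x xA; have fxD : f x \in A :\ x by rewrite !inE fne.
have [in_B inA] : (forall y, y \in A :\ x :\ f x -> [/\ y != f x, y != x & y \in A])
   /\ (forall y, [/\ y != f x, y != x & y \in A] -> y \in A :\ x :\ f x).
  by split=> y; rewrite !inE => /and3P.
rewrite (cardsD1 x A) xA (cardsD1 (f x)) fxD /= negbK.
apply: IH => [|y /in_B[y1 y2 yA]|y /in_B[_ _ yA]|y /in_B[_ _ yA]].
- by move: ltA; rewrite (cardsD1 x A) xA (cardsD1 (f x)) fxD; lia.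
- apply: inA; split; last exact: fA.
  + by apply: contraNneq y2 => E; rewrite -(fK _ yA) E (fK _ xA).
  + by apply: contraNneq y1 => E; rewrite -(fK _ yA) E.
- exact: fK.
- exact: fne.
Qed.

Lemma onto_inj_in (T U : finType) (f : T -> U) (D : {set T}) (E : {set U}) :
  E \subset f @: D -> #|D| <= #|E| -> {in D &, injective f}.
Proof.
move=> sEfD leDE; apply/imset_injP; rewrite eqn_leq leq_imset_card /=.
exact: leq_trans leDE (subset_leq_card sEfD).
Qed.

(** * Doors of a labelled simplex *)

Section Doors.
Variables (n : nat) (L : 'I_n.+1 -> 'I_n.+1).

Definition onto := [forall j, [exists i, L i == j]].
(** A door in the sense of Sperner, namely the facet opposite vertex [k]: its [n] vertices have to
    carry the [n] labels other than [ord_max], each exactly once. *)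
Definition doorat k :=
  [forall j, (j != ord_max) ==> [exists i, (i != k) && (L i == j)]].

(** A fully labelled simplex has one door, opposite the vertex labelled [ord_max]. Any other simplex
    with a door misses only the label [ord_max], so exactly one label is repeated, and its two
    carriers give two doors. *)
Lemma odd_doors : odd #|[set k | doorat k]| = onto.
Proof.
have [/forallP ontoL|/forallPn[j0 /existsPn nj0]] := boolP onto.
  have injL : injective L.
    move=> x y; apply: (@onto_inj_in _ _ L setT setT); rewrite ?inE ?cardsT ?card_ord //.
    by apply/subsetP=> j _; case/existsP: (ontoL j) => i /eqP <-; apply: imset_f.
  have [k0 /eqP Lk0] := existsP (ontoL ord_max).
  suff ->: [set k | doorat k] = [set k0] by rewrite cards1.
  apply/setP=> k; rewrite !inE; apply/forallP/eqP => [dk|-> j].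
    apply: (injL); rewrite Lk0; apply/eqP; apply: contraT => Lk.
    have /existsP[i /andP[ik /eqP/injL eik]] := implyP (dk (L k)) Lk.
    by rewrite eik eqxx in ik.
  apply/implyP=> jm; have [i /eqP Li] := existsP (ontoL j).
  by apply/existsP; exists i; rewrite Li eqxx andbT; apply: contraNneq jm => E; rewrite -Li E Lk0.
have [->|[k0]] := set_0Vmem [set k | doorat k]; first by rewrite cards0.
rewrite inE => /forallP dk0.
have j0m : j0 = ord_max.
  apply/eqP; apply: contraT => /(implyP (dk0 j0))/existsP[i /andP[_ Li]].
  by case/negP: (nj0 i).
have Lm i : L i != ord_max by rewrite -j0m nj0.
have /existsP[k1 /andP[k10 /eqP Lk1]] := implyP (dk0 (L k0)) (Lm k0).
have inj0 : {in [set~ k0] &, injective L}.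
  apply: (@onto_inj_in _ _ L _ [set~ ord_max]); last by rewrite !cardsC1.
  apply/subsetP=> j; rewrite !inE => /(implyP (dk0 j))/existsP[i /andP[ik /eqP <-]].
  by apply: imset_f; rewrite !inE.
suff ->: [set k | doorat k] = [set k0; k1] by rewrite cards2 eq_sym k10.
apply/setP=> k; rewrite !inE; apply/forallP/orP => [dk|[]/eqP-> // j].
  have /existsP[i /andP[ik /eqP Li]] := implyP (dk (L k)) (Lm k).
  have [k0'|kk0] := eqVneq k k0; [by left|right].
  have [i0|ii0] := eqVneq i k0.
    by apply/eqP/inj0; rewrite ?inE // Lk1 -i0 Li.
  by case/eqP: ik; apply: inj0; rewrite ?inE.
apply/implyP=> /(implyP (dk0 j))/existsP[i /andP[ik /eqP Li]].
apply/existsP; have [ei|ni] := eqVneq i k1; last by exists i; rewrite ni Li eqxx.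
by exists k0; rewrite eq_sym k10 -Lk1 -ei Li eqxx.
Qed.
End Doors.

Lemma val_ordS m (i : 'I_m.+1) : ordS i = (if i < m then i.+1 else 0) :> nat.
Proof.
rewrite /=; have H2 := ltn_ord i; case: (ltnP i m) => H1; first by rewrite modn_small.
have -> : i = m :> nat by lia.
by rewrite modnn.
Qed.

Lemma val_ord_pred m (i : 'I_m.+1) : ord_pred i = (if i == 0 :> nat then m else i.-1) :> nat.
Proof.
rewrite /=; have H2 := ltn_ord i; case: ((i : nat) =P 0) => [->|/eqP H1]; first by rewrite add0n modn_small.
have -> : (i + m.+1).-1 = i.-1 + m.+1 by lia.
by rewrite modnDr modn_small //; lia.
Qed.

Lemma ordS_eq0 m (i : 'I_m.+1) : (ordS i == ord0) = (i == ord_max).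
Proof.
have -> : (ordS i == ord0) = (nat_of_ord (ordS i) == 0) by [].
have -> : (i == ord_max) = (nat_of_ord i == m) by [].
by rewrite val_ordS; have := ltn_ord i; case: (ltnP i m); lia.
Qed.

Lemma ord_pred_eq_max m (i : 'I_m.+1) : (ord_pred i == ord_max) = (i == ord0).
Proof. by rewrite -ordS_eq0 ord_predK. Qed.

(** * Freudenthal triangulation of a torus *)

Section Torus.
Variables (n' N : nat).
Let n := n'.+1.
(** Coordinates are integers modulo [N.+1] and advance by the cyclic [ordS], so the triangulation
    has no boundary. *)
Definition pt := {ffun 'I_n -> 'I_N.+1}.
Definition splx := (pt * {perm 'I_n})%type.

(* The Freudenthal simplex with base point [s.1]: passing from vertex [k] to
   vertex [k.+1] increments the coordinate of rank [k] under [s.2]. *)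
Definition vert (s : splx) (k : nat) : pt :=
  [ffun i => if s.2 i < k then ordS (s.1 i) else s.1 i].

Definition cyc : {perm 'I_n} := perm (@ordS_inj n).

(** The neighbour across the facet opposite vertex [k], with the index of its new vertex. Dropping
    the first vertex makes the second one the base and rotates the ranks; dropping the last one is
    the inverse move; dropping an inner one swaps two consecutive increments. *)
Definition pivot (c : splx * 'I_n.+1) : splx * 'I_n.+1 :=
  let: (s, k) := c in
  if k == ord0 then
    (([ffun i => if s.2 i == ord0 then ordS (s.1 i) else s.1 i], (s.2 * cyc^-1)%g), ord_max)
  else if k == ord_max then
    (([ffun i => if s.2 i == ord_max then ord_pred (s.1 i) else s.1 i], (s.2 * cyc)%g), ord0)
  else ((s.1, (s.2 * tperm (inord k.-1) (inord k))%g), k).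

Lemma cycVE (i : 'I_n) : (cyc^-1)%g i = ord_pred i.
Proof. by apply: (@perm_inj _ cyc); rewrite permKV permE ord_predK. Qed.

Lemma pivotK : involutive pivot.
Proof.
move=> [[z r] k]; rewrite /pivot /=.
have [->|k0] := eqVneq k ord0.
  have -> : (ord_max == ord0 :> 'I_n.+1) = false by [].
  rewrite eqxx; congr (_, _, _).
    apply/ffunP=> i; rewrite !ffunE; cbn [fst snd]; rewrite permM cycVE ord_pred_eq_max.
    by case: eqP => // _; rewrite ordSK.
  by rewrite mulgKV.
have [->|km] := eqVneq k ord_max.
  rewrite /=; congr (_, _, _).
    apply/ffunP=> i; rewrite !ffunE; cbn [fst snd]; rewrite permM permE ordS_eq0.
    by case: eqP => // _; rewrite ord_predK.
  by rewrite mulgK.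
by rewrite /= (negbTE k0) (negbTE km) -mulgA tperm2 mulg1.
Qed.

Lemma pivot_neq c : pivot c != c.
Proof.
case: c => [[z r] k]; rewrite /pivot /=.
have [->|k0] := eqVneq k ord0; first by apply/eqP=> /(congr1 (fun c => nat_of_ord c.2)).
have [->|km] := eqVneq k ord_max; first by apply/eqP=> /(congr1 (fun c => nat_of_ord c.2)).
apply/eqP=> /(congr1 (fun c => mulg r^-1%g c.1.2)) /=; rewrite mulKg mulVg => /permP/(_ (inord k)).
rewrite tpermR perm1 => /(congr1 val); rewrite /= !inordK; move: k0 km; rewrite -!val_eqE /=;
  have := ltn_ord k; rewrite /n; lia.
Qed.

(** The vertices of the shared facet stay the same grid points and only their indices may shift by
    one. Hence [pivot] carries doors to doors. *)
Lemma pivot_vert (s : splx) (k : 'I_n.+1) (i : 'I_n.+1) : i != k ->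
  exists2 j, j != (pivot (s, k)).2 & vert (pivot (s, k)).1 j = vert s i.
Proof.
case: s => z r; rewrite /pivot /=.
have [->|k0] := eqVneq k ord0 => ik /=.
  have ilt := ltn_ord i; have i0 : 0 < i by rewrite lt0n.
  exists (inord i.-1); first by rewrite -val_eqE /= inordK; lia.
  apply/ffunP=> x; rewrite !ffunE; cbn [fst snd]; rewrite permM cycVE val_ord_pred inordK; last lia.
  have -> : (r x == ord0) = (nat_of_ord (r x) == 0) by [].
  have H := ltn_ord (r x); case: (nat_of_ord (r x) =P 0) => [->|E].
    by rewrite i0; have -> : (n'.+1.-1 < i.-1) = false by lia.
  by have -> : ((r x).-1 < i.-1) = (r x < i) by lia.
move: ik; have [->|km] := eqVneq k ord_max => ik /=.
  have ilt := ltn_ord i; have im : i < n by move: ik; rewrite -val_eqE /=; lia.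
  exists (inord i.+1); first by rewrite -val_eqE /= inordK; lia.
  apply/ffunP=> x; rewrite !ffunE; cbn [fst snd]; rewrite permM permE val_ordS inordK; last lia.
  have -> : (r x == ord_max) = (nat_of_ord (r x) == n') by [].
  move: (ltn_ord (r x)) im; rewrite /n; move: (nat_of_ord (r x)) => rx H im; case: (ltnP rx n') => E.
    have -> : (rx.+1 < i.+1) = (rx < i) by lia.
    by have -> : (rx == n') = false by lia.
  have -> : rx == n' by lia.
  by rewrite ord_predK ltn0Sn ltnNge (leq_trans _ E).
exists i => //; apply/ffunP=> x; rewrite !ffunE /= permM.
have kn : k < n /\ 0 < k.
  by move: k0 km; rewrite -!val_eqE /=; have := ltn_ord k; lia.
have kv : (inord k : 'I_n) = k :> nat by rewrite inordK; lia.
have k1v : (inord k.-1 : 'I_n) = k.-1 :> nat by rewrite inordK; lia.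
have ik' : (i : nat) <> k by move/eqP: ik => ik E; apply: ik; apply: val_inj.
suff -> : (tperm (inord k.-1) (inord k) (r x) < i) = (r x < i) by [].
by case: tpermP => [->|->|//]; rewrite kv k1v; lia.
Qed.

Variable l : pt -> 'I_n.+1.
Definition full (s : splx) := onto (fun k : 'I_n.+1 => l (vert s k)).

(** Double counting modulo 2 of the pairs (simplex, door). [pivot] is an involution on them without
    fixed points, so their number is even; counted simplex by simplex, [odd_doors] turns it into the
    parity of the number of full simplices. *)
Lemma even_full : ~~ odd #|[set s | full s]|.
Proof.
pose door (c : splx * 'I_n.+1) := doorat (fun k : 'I_n.+1 => l (vert c.1 k)) c.2.
have dP c : door c -> door (pivot c).
  case: c => s k /forallP dc; apply/forallP => j; apply/implyP=> /(implyP (dc j)).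
  case/existsP=> i /andP[ik /eqP <-]; have [i' i'k <-] := pivot_vert s ik.
  by apply/existsP; exists i'; rewrite i'k eqxx.
have : ~~ odd #|[set c | door c]|.
  apply: (@even_card_involution _ pivot) => c; rewrite !inE; first exact: dP.
    by rewrite pivotK.
  by rewrite pivot_neq.
congr (~~ _); rewrite -!sum1dep_card.
rewrite -(pair_big_dep xpredT (fun s k => door (s, k)) (fun _ _ => 1)) /=.
rewrite (big_morph odd oddD (erefl _)) [in RHS]big_mkcond (big_morph odd oddD (erefl _)).
apply: eq_bigr => s _; rewrite sum1dep_card.
by transitivity (full s); [rewrite /full -odd_doors | case: (full s)].
Qed.
End Torus.

(** * Comparison of two labellings *)

Section Kuhn.
Variables (n' N : nat) (s : (nat -> nat) -> nat -> bool).
Let n := n'.+1.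
Hypothesis N3 : 3 <= N.
Hypothesis s_low : forall x i, i < n -> x i = 1 -> s x i = false.
Hypothesis s_high : forall x i, i < n -> x i = N.-1 -> s x i = true.
Notation pt := (pt n' N).
Notation splx := (splx n' N).

Definition coords (x : pt) : nat -> nat := fun j => x (inord j).

(** The label of a sign vector. [find] returns [n] if no sign is true, so the label [ord_max] means
    that all signs are false, and a full simplex shows both signs in every coordinate. *)
Definition first_true (b : nat -> bool) : 'I_n.+1 := inord (find b (iota 0 n)).

Lemma find_iotaP (b : nat -> bool) : let j := find b (iota 0 n) in
  [/\ j <= n, j < n -> b j & forall i, i < j -> b i = false].
Proof.
set j := find _ _; have jn : j <= n by rewrite /j -[X in _ <= X](size_iota 0) find_size.
split=> // [jltn|i ij]; last first.
  by have := before_find 0 ij; rewrite nth_iota // (leq_trans ij).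
have H : has b (iota 0 n) by rewrite has_find size_iota.
by have := nth_find 0 H; rewrite nth_iota.
Qed.

Lemma first_trueP (b : nat -> bool) (j : 'I_n.+1) : first_true b = j ->
  (j < n -> b j) /\ forall i, i < j -> b i = false.
Proof.
have [jn bj bi] := find_iotaP b; move=> /(congr1 (@nat_of_ord _)).
by rewrite /first_true inordK // => <-.
Qed.

(* [s0] is the sign pattern of the constant map to an interior point; [s1]
   agrees with it outside the box on which [s] is meaningful. *)
Definition inner (x : pt) := [forall i, (1 <= x i) && (x i < N)].
Definition s0 (x : pt) j := 2 <= coords x j.
Definition s1 (x : pt) j := if inner x then s (coords x) j else s0 x j.

Lemma full_signs (sg : pt -> nat -> bool) (t : splx) :
  full (fun x => first_true (sg x)) t ->
  (forall i, i < n -> exists k : 'I_n.+1,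
     sg (vert t k) i /\ forall j, j < i -> sg (vert t k) j = false) /\
  (exists k : 'I_n.+1, forall i, i < n -> sg (vert t k) i = false).
Proof.
move=> /forallP ft; split=> [i lin|].
  have /existsP[k /eqP/first_trueP[H1 H2]] := ft (inord i).
  by exists k; move: H1 H2; rewrite inordK; [move=> H1 H2; split; auto | exact: ltnW].
by have /existsP[k /eqP/first_trueP[_ H2]] := ft ord_max; exists k.
Qed.

Lemma val_vert (t : splx) k i : t.1 i != ord_max ->
  vert t k i = t.1 i + (t.2 i < k) :> nat.
Proof.
rewrite -val_eqE ffunE /= => zi; case: ifP => _; last by rewrite addn0.
have zl : t.1 i < N by have := ltn_ord (t.1 i); lia.
by rewrite val_ordS ifT // -[nat_of_bool true]/1 addn1.
Qed.

(** The seam: incrementing a coordinate equal to [N] jumps to 0. Elsewhere vertices arise by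
    ordinary addition. *)
Definition wraps : {set splx} := [set t : splx | [exists i, t.1 i == ord_max]].

Lemma wraps_full t : t \in wraps ->
  full (fun x => first_true (s1 x)) t = full (fun x => first_true (s0 x)) t.
Proof.
rewrite inE => /existsP[i /eqP zi].
have niv k : inner (vert t k) = false.
  apply/negP=> /forallP/(_ i); rewrite ffunE zi.
  by case: ifP => _; rewrite ?val_ordS /= ltnn ?andbF.
by rewrite /full /onto; apply: eq_forallb => j; apply: eq_existsb => k; rewrite /s1 niv.
Qed.

Lemma decr_perm (r : {perm 'I_n}) :
  (forall i j : 'I_n, j < i -> r i < r j) -> r = perm (@rev_ord_inj n).
Proof.
move=> dec; apply/permP=> i; rewrite permE; apply: val_inj => /=.
have up : forall k, k < n -> r (inord k) + k <= n'.
  elim=> [_|k IH kn]; first by rewrite addn0 -ltnS ltn_ord.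
  have := dec (inord k.+1) (inord k); rewrite !inordK ?(ltnW kn) // ltnSn => /(_ isT).
  by have := IH (ltnW kn); lia.
have dn : forall k, k < n -> k <= r (inord (n' - k)).
  elim=> // k IH kn.
  have := dec (inord (n' - k)) (inord (n' - k.+1)); rewrite !inordK ?ltnS ?leq_subr //.
  have -> : n' - k.+1 < n' - k by lia.
  by move/(_ isT); have := IH (ltnW kn); lia.
have := up i (ltn_ord i); have il := ltn_ord i.
have il' : i <= n' by rewrite -ltnS.
have := dn (n' - i); rewrite ltnS leq_subr subKn // inord_val => /(_ isT).
by rewrite subSS; lia.
Qed.

Definition corner : splx := ([ffun=> inord 1], perm (@rev_ord_inj n)).

(** Away from the seam a coordinate varies by at most one over a simplex, and [s0] must change sign
    in each, so the base is [(1, ..., 1)]. The vertex with label [i] has incremented [i] but no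
    [j < i]; so higher coordinates are incremented first, which leaves only the reversed order. *)
Lemma full_s0 : [set t : splx | full (fun x => first_true (s0 x)) t] :\: wraps = [set corner].
Proof.
have v1 : (inord 1 : 'I_N.+1) = 1 :> nat by rewrite inordK; lia.
apply/setP=> t; rewrite !inE; apply/andP/eqP.
  case=> /existsPn nw /full_signs[pos [k0 neg]].
  have coordsE k i : i < n -> coords (vert t k) i = t.1 (inord i) + (t.2 (inord i) < k).
    by move=> lin; rewrite /coords val_vert.
  have z1 i : i < n -> t.1 (inord i) = 1 :> nat.
    move=> lin; have [k [pk _]] := pos i lin; have := neg i lin; move: pk.
    by rewrite /s0 !coordsE //; case: (t.2 _ < k); case: (t.2 _ < k0) => /=; lia.
  have zE : t.1 = [ffun=> inord 1].
    apply/ffunP=> i; rewrite ffunE; apply: val_inj; rewrite /= v1.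
    by have := z1 i (ltn_ord i); rewrite inord_val.
  case: t => z r /= in nw pos k0 neg coordsE z1 zE *; rewrite zE /corner; congr pair.
  apply: decr_perm => i j ji.
  have [k [pk nk]] := pos i (ltn_ord i); have := nk j ji; move: pk.
  rewrite /s0 !coordsE ?ltn_ord // !z1 ?ltn_ord // !inord_val.
  by move: (nat_of_ord (r i)) (nat_of_ord (r j)) (nat_of_ord k) => a b c; lia.
move=> ->; split.
  by apply/existsPn=> i /=; rewrite ffunE -val_eqE /= v1; lia.
apply/forallP=> j; apply/existsP; have jn : j <= n by rewrite -ltnS.
exists (inord (n - j)); apply/eqP; apply: val_inj; rewrite /first_true.
have kv : (inord (n - j) : 'I_n.+1) = n - j :> nat by rewrite inordK // ltnS leq_subr.
have cE i : i < n -> s0 (vert corner (n - j)) i = (j <= i).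
  move=> lin; rewrite /s0 /coords val_vert; last by rewrite /= ffunE -val_eqE /= v1; lia.
  by rewrite /= ffunE v1 permE /= inordK //; move: lin; rewrite /n; lia.
rewrite kv; have [fn fT fF] := find_iotaP (s0 (vert corner (n - j))).
set f := find _ _ in fn fT fF *; rewrite /= inordK //.
apply/eqP; rewrite eqn_leq; apply/andP; split.
  rewrite leqNgt; apply/negP=> jf.
  by have := fF _ jf; rewrite cE ?leqnn // (leq_trans jf).
have [fltn|] := ltnP f n; last by exact: leq_trans.
by have := fT fltn; rewrite cE.
Qed.

Lemma kuhn_pos : exists z : nat -> nat,
  (forall i, i < n -> 1 <= z i /\ z i + 2 <= N) /\
  forall i, i < n -> exists x y : nat -> nat,
    (forall j, j < n -> z j <= x j <= z j + 1 /\ z j <= y j <= z j + 1) /\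
    s x i = true /\ s y i = false.
Proof.
set F1 := [set t : splx | full (fun x => first_true (s1 x)) t].
set F0 := [set t : splx | full (fun x => first_true (s0 x)) t].
have e1 : ~~ odd #|F1| := even_full _.
have e0 : ~~ odd #|F0| := even_full _.
have eW : F1 :&: wraps = F0 :&: wraps.
  apply/setP=> t; rewrite in_setI [RHS]in_setI; have [tw|] := boolP (t \in wraps); last by rewrite !andbF.
  by rewrite !inE wraps_full.
(* Both totals are even and the parts on the seam coincide, so off the seam [F1] and [F0] have the
   same parity; there [F0] is a singleton. *)
have : F1 :\: wraps != set0.
  apply/negP=> /eqP E; move: e1 e0; rewrite -(cardsID wraps F1) -(cardsID wraps F0).
  by rewrite full_s0 E eW cards0 cards1 addn0 addn1 /= => /negbTE ->.
case/set0Pn=> t; rewrite !inE => /andP[/existsPn nw /full_signs[pos [k0 neg]]].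
have coordsE k i : i < n -> coords (vert t k) i = t.1 (inord i) + (t.2 (inord i) < k).
  by move=> lin; rewrite /coords val_vert.
have zN i : t.1 i < N.
  by rewrite ltn_neqAle -[X in _ && X]ltnS ltn_ord andbT; apply: nw.
(* A base coordinate 0 leaves the values 0 and 1 only, and then no vertex has sign true: inside
   [inner] the value is 1 and [s_low] applies, outside it [s0] asks for at least 2. *)
have z0 i : i < n -> 0 < t.1 (inord i).
  move=> lin; rewrite lt0n; apply/eqP=> zi; have [k [pk _]] := pos i lin; move: pk.
  rewrite /s1 /s0 coordsE // zi; case: ifP => [/forallP/(_ (inord i))|_]; last by case: (t.2 _ < k).
  have := coordsE k i lin; rewrite {1}/coords zi => ->.
  by case E: (t.2 _ < k) => // _; rewrite s_low // (coordsE k i lin) zi E.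
(* A base coordinate [N.-1] would make every sign in it true: by [s_high] inside [inner], and
   outside it because [N.-1] is at least 2. *)
have zM i : i < n -> t.1 (inord i) + 2 <= N.
  move=> lin; rewrite leqNgt; apply/negP=> zi.
  have {}zi : t.1 (inord i) = N.-1 :> nat by have := zN (inord i); lia.
  have := neg i lin; rewrite /s1 /s0 coordsE // zi; case: ifP => [/forallP/(_ (inord i))|_]; last by lia.
  have := coordsE k0 i lin; rewrite {1}/coords zi => ->.
  case E: (t.2 _ < k0); first by rewrite /=; lia.
  by move=> _; rewrite s_high // (coordsE k0 i lin) zi E addn0.
have inn k : inner (vert t k).
  apply/forallP=> i; have := coordsE k i (ltn_ord i); have := z0 i (ltn_ord i).
  have := zM i (ltn_ord i); rewrite /coords inord_val => H1 H2 ->.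
  by move: (nat_of_ord (t.1 i)) H1 H2 => v H1 H2; case: (t.2 _ < k) => /=; lia.
exists (fun j => nat_of_ord (t.1 (inord j))); split=> [i lin|i lin]; first by split; [exact: z0|exact: zM].
have [k [pk _]] := pos i lin; have := neg i lin; move: pk; rewrite /s1 !inn => pk nk.
exists (coords (vert t k)), (coords (vert t k0)); split=> // j jn.
by rewrite !coordsE //; case: (t.2 _ < k); case: (t.2 _ < k0) => /=; lia.
Qed.
End Kuhn.

Lemma kuhn (n N : nat) (s : (nat -> nat) -> nat -> bool) : 3 <= N ->
  (forall x i, i < n -> x i = 1 -> s x i = false) ->
  (forall x i, i < n -> x i = N.-1 -> s x i = true) ->
  exists z : nat -> nat,
    (forall i, i < n -> 1 <= z i /\ z i + 2 <= N) /\
    forall i, i < n -> exists x y : nat -> nat,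
      (forall j, j < n -> z j <= x j <= z j + 1 /\ z j <= y j <= z j + 1) /\
      s x i = true /\ s y i = false.
Proof.
case: n => [|n'] N3 lo hi; first by exists (fun=> 0).
exact: kuhn_pos N3 lo hi.
Qed.

End Kuhn.

(** The same result in terms of the standard order on [nat]. It is a discrete Poincare-Miranda
    theorem: one unit cell sees both signs in every coordinate. *)
Lemma kuhn (n N : nat) (s : (nat -> nat) -> nat -> bool) : (3 <= N)%nat ->
  (forall x i, (i < n)%nat -> x i = 1%nat -> s x i = false) ->
  (forall x i, (i < n)%nat -> x i = pred N -> s x i = true) ->
  exists z : nat -> nat,
    (forall i, (i < n)%nat -> (1 <= z i /\ z i + 2 <= N)%nat) /\
    forall i, (i < n)%nat -> exists x y : nat -> nat,
      (forall j, (j < n)%nat -> (z j <= x j <= z j + 1)%nat /\ (z j <= y j <= z j + 1)%nat) /\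
      s x i = true /\ s y i = false.
Proof.
intros N3 lo hi.
destruct (@Kuhn.kuhn n N s) as [z [Hz Hs]].
- now apply (ssrbool.introT ssrnat.leP).
- intros x i Hi; apply lo; now apply (ssrbool.elimT ssrnat.ltP).
- intros x i Hi; apply hi; now apply (ssrbool.elimT ssrnat.ltP).
- exists z; split.
  + intros i Hi; destruct (Hz i) as [H1 H2]; [now apply (ssrbool.introT ssrnat.ltP)|].
    split; [exact (ssrbool.elimT ssrnat.leP H1) | exact (ssrbool.elimT ssrnat.leP H2)].
  + intros i Hi; destruct (Hs i) as [x [y [Hxy Hb]]]; [now apply (ssrbool.introT ssrnat.ltP)|].
    exists x, y; split; [|exact Hb].
    intros j Hj; destruct (Hxy j) as [H1 H2]; [now apply (ssrbool.introT ssrnat.ltP)|].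
    apply (ssrbool.elimT ssrbool.andP) in H1; apply (ssrbool.elimT ssrbool.andP) in H2.
    destruct H1, H2; repeat split; now apply (ssrbool.elimT ssrnat.leP).
Qed.

(** * Fixed points *)

Definition incube (N : nat) (C : R) (x : nat -> R) : Prop :=
  forall i, (i < N)%nat -> Rabs (x i) <= C.

Lemma exists_nat_ge (x : R) : exists n : nat, x <= INR n.
Proof.
destruct (Rle_lt_dec x 0) as [H|H]; [exists 0%nat; simpl; lra|].
exists (Z.to_nat (up x)); destruct (archimed x) as [H1 _].
rewrite INR_IZR_INZ, Z2Nat.id; [lra|].
apply le_IZR; lra.
Qed.

(** The sign in coordinate [i] tells whether [F] moves a grid point down. In the cell given by
    [kuhn] both answers occur for each [i], so [F x i - x i] changes sign within one cell and is
    small by uniform continuity. *)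
Lemma approx_brouwer (N : nat) (C : R) (F : (nat -> R) -> nat -> R) : 0 < C ->
  (forall x, incube N C x -> incube N C (F x)) ->
  (forall eps, 0 < eps -> exists delta, 0 < delta /\
     forall x y, incube N C x -> incube N C y ->
       (forall i, (i < N)%nat -> Rabs (x i - y i) <= delta) ->
       forall i, (i < N)%nat -> Rabs (F x i - F y i) <= eps) ->
  forall eps, 0 < eps -> exists x, incube N C x /\
    forall i, (i < N)%nat -> Rabs (F x i - x i) <= eps.
Proof.
intros HC HF HU eps He.
destruct (HU (eps / 2)) as [delta [Hd HUd]]; [lra|].
(* The mesh [h] will be at most [delta] and at most [eps / 2]: half of the error is the displacement
   of [F], half that of the point. *)
destruct (exists_nat_ge (2 * C / Rmin delta (eps / 2))) as [K0 HK0].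
set (K := S K0).
assert (Hm : 0 < Rmin delta (eps / 2)) by (apply Rmin_glb_lt; lra).
assert (HKp : 1 <= INR K) by (unfold K; rewrite S_INR; pose proof (pos_INR K0); lra).
set (h := 2 * C / INR K).
assert (Hh0 : 0 < h) by (unfold h; apply Rdiv_lt_0_compat; lra).
assert (HhK : h * INR K = 2 * C) by (unfold h; field; lra).
assert (Hh : h <= Rmin delta (eps / 2)).
{ unfold h. apply Rle_div_l; [lra|].
  apply Rle_div_l in HK0; [|exact Hm].
  unfold K; rewrite S_INR. nra. }
assert (Hh1 := Rle_trans _ _ _ Hh (Rmin_l _ _)).
assert (Hh2 := Rle_trans _ _ _ Hh (Rmin_r _ _)).
set (pos := fun (z : nat -> nat) (j : nat) => - C + h * (INR (z j) - 1)).
assert (Hpos : forall z, (forall j, (j < N)%nat -> (1 <= z j <= K + 1)%nat) -> incube N C (pos z)).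
{ intros z Hz j Hj. destruct (Hz j Hj) as [H1 H2]; apply le_INR in H1; apply le_INR in H2.
  rewrite plus_INR in H2; change (INR 1) with 1 in *.
  unfold pos; apply Rabs_le.
  assert (h * (INR (z j) - 1) <= h * INR K) by (apply Rmult_le_compat_l; lra).
  assert (0 <= h * (INR (z j) - 1)) by (apply Rmult_le_pos; lra).
  lra. }
(* Index 1 is the face [- C] and index [K + 1] the face [C]. They are tested first so that the
   boundary hypotheses of [kuhn] hold for every index function; on the cube the imposed signs agree
   with [F] mapping the cube into itself. *)
set (s := fun (z : nat -> nat) (i : nat) =>
  if Nat.eq_dec (z i) 1 then false else
  if Nat.eq_dec (z i) (K + 1) then true else
  if Rlt_dec (F (pos z) i) (pos z i) then true else false).
destruct (kuhn N (K + 2) s) as [z [Hz Hs]].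
- unfold K; lia.
- intros x i _ Hx; unfold s; destruct (Nat.eq_dec (x i) 1); congruence.
- intros x i _ Hx; unfold s.
  destruct (Nat.eq_dec (x i) 1); [unfold K in *; lia|].
  destruct (Nat.eq_dec (x i) (K + 1)); [reflexivity|lia].
- assert (Cz : incube N C (pos z)).
  { apply Hpos; intros j Hj; destruct (Hz j Hj); lia. }
  exists (pos z); split; [exact Cz|].
  intros i Hi; destruct (Hs i Hi) as [x [y [Hxy [sx sy]]]].
  assert (Cx : incube N C (pos x)).
  { apply Hpos; intros j Hj; destruct (Hz j Hj); destruct (Hxy j Hj); lia. }
  assert (Cy : incube N C (pos y)).
  { apply Hpos; intros j Hj; destruct (Hz j Hj); destruct (Hxy j Hj); lia. }
  assert (near : forall w, (forall j, (j < N)%nat -> (z j <= w j <= z j + 1)%nat) ->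
     forall j, (j < N)%nat -> Rabs (pos w j - pos z j) <= h).
  { intros w Hw j Hj; destruct (Hw j Hj) as [H1 H2]; apply le_INR in H1; apply le_INR in H2.
    rewrite plus_INR in H2; change (INR 1) with 1 in *.
    unfold pos; apply Rabs_le; split; nra. }
  assert (nx := near x (fun j Hj => proj1 (Hxy j Hj))).
  assert (ny := near y (fun j Hj => proj2 (Hxy j Hj))).
  assert (Fx : F (pos x) i <= pos x i).
  { unfold s in sx; destruct (Nat.eq_dec (x i) 1); [discriminate|].
    destruct (Nat.eq_dec (x i) (K + 1)) as [e|].
    - assert (pos x i = C) by (unfold pos; rewrite e, plus_INR; change (INR 1) with 1; lra).
      pose proof (Rle_abs (F (pos x) i)); pose proof (HF _ Cx i Hi); lra.
    - destruct (Rlt_dec (F (pos x) i) (pos x i)); [lra|discriminate]. }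
  assert (Fy : pos y i <= F (pos y) i).
  { unfold s in sy; destruct (Nat.eq_dec (y i) 1) as [e|].
    - assert (pos y i = - C) by (unfold pos; rewrite e; simpl INR; lra).
      pose proof (HF _ Cy i Hi) as HH; apply Rabs_le_between in HH; lra.
    - destruct (Nat.eq_dec (y i) (K + 1)); [discriminate|].
      destruct (Rlt_dec (F (pos y) i) (pos y i)); [discriminate|lra]. }
  assert (Ux := HUd _ _ Cx Cz (fun j Hj => Rle_trans _ _ _ (nx j Hj) Hh1) i Hi).
  assert (Uy := HUd _ _ Cy Cz (fun j Hj => Rle_trans _ _ _ (ny j Hj) Hh1) i Hi).
  specialize (nx i Hi); specialize (ny i Hi).
  apply Rabs_le_between in Ux; apply Rabs_le_between in Uy.
  apply Rabs_le_between in nx; apply Rabs_le_between in ny.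
  apply Rabs_le; split; lra.
Qed.

(** * Compactness: cluster points, Lipschitz functions, Schauder's theorem *)

Lemma cube_cluster_step (X : nat -> nat -> R) (C : R) (k : nat) (x : nat -> R) :
  (forall n i, Rabs (X n i) <= C) ->
  (forall eps N, 0 < eps -> exists n, (N <= n)%nat /\
     forall i, (i < k)%nat -> Rabs (X n i - x i) < eps) ->
  exists l, forall eps N, 0 < eps -> exists n, (N <= n)%nat /\
     forall i, (i < S k)%nat -> Rabs (X n i - (if Nat.eq_dec i k then l else x i)) < eps.
Proof.
intros HX HQ.
assert (Hn : forall j : nat, exists n, (j <= n)%nat /\
  forall i, (i < k)%nat -> Rabs (X n i - x i) < / (INR j + 1)).
{ intros j; apply HQ. apply Rinv_0_lt_compat; pose proof (pos_INR j); lra. }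
destruct (choice _ Hn) as [nn Hnn].
destruct (Bolzano_Weierstrass (fun j => X (nn j) k) (fun c => - C <= c <= C)) as [l Hl].
- apply compact_P3.
- intros j; apply Rabs_le_between, HX.
- exists l; intros eps N He.
  destruct (exists_nat_ge (/ eps)) as [J HJ].
  destruct (Hl (disc l (mkposreal eps He)) (Nat.max N J)) as [j [Hj1 Hj2]].
  { exists (mkposreal eps He); intros y Hy; exact Hy. }
  exists (nn j); destruct (Hnn j) as [H1 H2]; split; [lia|].
  intros i Hi; destruct (Nat.eq_dec i k) as [->|ne]; [exact Hj2|].
  apply Rlt_trans with (/ (INR j + 1)); [apply H2; lia|].
  assert (H3 : INR J <= INR j) by (apply le_INR; lia).
  rewrite <- (Rinv_inv eps); apply Rinv_lt_contravar.
  + apply Rmult_lt_0_compat; [now apply Rinv_0_lt_compat|pose proof (pos_INR j); lra].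
  + lra.
Qed.

(** A cluster point in the product topology. Approximation of every finite block of coordinates
    replaces the nested subsequences of the diagonal argument. *)
Lemma cube_cluster (X : nat -> nat -> R) (C : R) :
  (forall n i, Rabs (X n i) <= C) ->
  exists x, forall k eps N, 0 < eps -> exists n, (N <= n)%nat /\
     forall i, (i < k)%nat -> Rabs (X n i - x i) < eps.
Proof.
intros HX.
set (Q := fun k x => forall eps N, 0 < eps -> exists n, (N <= n)%nat /\
     forall i, (i < k)%nat -> Rabs (X n i - x i) < eps).
assert (Q0 : Q 0%nat (fun _ => 0)) by (intros eps N _; exists N; split; [lia|intros; lia]).
assert (step : forall k (s : {x | Q k x}), {x' | Q (S k) x' /\
    forall i, (i < k)%nat -> x' i = proj1_sig s i}).
{ intros k [x Hx]; apply constructive_indefinite_description.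
  destruct (cube_cluster_step X C k x HX Hx) as [l Hl].
  exists (fun i => if Nat.eq_dec i k then l else x i); split; [exact Hl|].
  intros i Hi; simpl; destruct (Nat.eq_dec i k); [lia|reflexivity]. }
set (xs := fix xs k : {x | Q k x} := match k with
   | O => exist _ _ Q0
   | S k' => let r := step k' (xs k') in exist _ (proj1_sig r) (proj1 (proj2_sig r)) end).
assert (coh : forall k i, (i < k)%nat -> proj1_sig (xs k) i = proj1_sig (xs (S i)) i).
{ induction k as [|k IH]; intros i Hi; [lia|].
  destruct (Nat.eq_dec i k) as [->|ne]; [reflexivity|].
  rewrite <- IH by lia. simpl; apply (proj2 (proj2_sig (step k (xs k)))); lia. }
exists (fun i => proj1_sig (xs (S i)) i); intros k eps N He.
destruct (proj2_sig (xs k) eps N He) as [n [H1 H2]]; exists n; split; [exact H1|].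
intros i Hi; rewrite <- (coh k i Hi); now apply H2.
Qed.

Definition clamp (a b x : R) : R := Rmax a (Rmin b x).

Lemma clamp_in a b x : a <= b -> a <= clamp a b x <= b.
Proof. intros H; unfold clamp, Rmax, Rmin; destruct (Rle_dec b x), (Rle_dec a _); lra. Qed.

Lemma clamp_id a b x : a <= x <= b -> clamp a b x = x.
Proof. intros H; unfold clamp, Rmax, Rmin; destruct (Rle_dec b x), (Rle_dec a _); lra. Qed.

Lemma clamp_lip a b x y : Rabs (clamp a b x - clamp a b y) <= Rabs (x - y).
Proof.
unfold clamp, Rmax, Rmin; destruct (Rle_dec b x), (Rle_dec b y);
 repeat destruct (Rle_dec a _); unfold Rabs; repeat destruct (Rcase_abs _); lra.
Qed.

(** One constant bounds both values and slope; this is the convex equicontinuous set on which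
    Schauder's theorem is run. *)
Definition adm (C : R) (v : R -> R) : Prop :=
  (forall t, Rabs (v t) <= C) /\ (forall x y, Rabs (v x - v y) <= C * Rabs (x - y)).

Lemma grid_near (p q t : R) (b : nat) : p < q -> p <= t <= q ->
  exists a, (a <= S b)%nat /\
    Rabs (t - (p + (q - p) * (INR a / INR (S b)))) <= (q - p) / INR (S b).
Proof.
intros Hpq Ht.
assert (HS : 0 < INR (S b)) by (apply lt_0_INR; lia).
set (y := (t - p) / (q - p) * INR (S b)).
assert (Hy0 : 0 <= y).
{ unfold y; apply Rmult_le_pos; [apply Rdiv_le_0_compat|]; lra. }
destruct (nfloor_ex y Hy0) as [a [Ha1 Ha2]].
assert (Hy1 : y <= INR (S b)).
{ unfold y; rewrite <- (Rmult_1_l (INR (S b))) at 2; apply Rmult_le_compat_r; [lra|].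
  apply Rle_div_l; lra. }
exists a; split.
- apply INR_le; lra.
- replace (t - (p + (q - p) * (INR a / INR (S b)))) with ((q - p) / INR (S b) * (y - INR a)).
  2: { unfold y; field; lra. }
  assert (0 < (q - p) / INR (S b)) by (apply Rdiv_lt_0_compat; lra).
  rewrite Rabs_mult, (Rabs_pos_eq ((q - p) / _)) by lra.
  rewrite <- (Rmult_1_r ((q - p) / INR (S b))) at 2; apply Rmult_le_compat_l; [lra|].
  apply Rabs_le; lra.
Qed.

Lemma small_inv_nat (A eps : R) : 0 <= A -> 0 < eps -> exists b : nat, A / INR (S b) <= eps.
Proof.
intros HA He; destruct (exists_nat_ge (A / eps)) as [b Hb]; exists b.
assert (HS : 0 < INR (S b)) by (apply lt_0_INR; lia).
apply Rle_div_l; [exact HS|].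
apply Rle_div_l in Hb; [|exact He].
rewrite S_INR; nra.
Qed.

Lemma nat_fun_bound (f : nat -> nat) (n : nat) : exists K, forall a, (a <= n)%nat -> (f a < K)%nat.
Proof.
induction n as [|n [K HK]].
- exists (S (f 0%nat)); intros a Ha; replace a with 0%nat by lia; lia.
- exists (Nat.max K (S (f (S n)))); intros a Ha.
  destruct (Nat.eq_dec a (S n)) as [->|]; [lia|]. specialize (HK a); lia.
Qed.

Lemma arzela_ascoli (p q C : R) (d : nat) (P : nat -> nat -> R) (v : nat -> R -> R) :
  p < q -> 0 <= C -> (forall n, incube d C (P n)) -> (forall n, adm C (v n)) ->
  (forall n t, v n (clamp p q t) = v n t) ->
  exists par w, incube d C par /\ adm C w /\ (forall t, w (clamp p q t) = w t) /\
    forall eps N, 0 < eps -> exists n, (N <= n)%nat /\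
      (forall i, (i < d)%nat -> Rabs (P n i - par i) <= eps) /\
      (forall t, Rabs (v n t - w t) <= eps).
Proof.
intros Hpq HC HP Hv Hcl.
set (pt := fun a b : nat => p + (q - p) * (INR a / INR (S b))).
(* [dn] enumerates the points of all uniform grids of [[p, q]]; below, [X] joins the [d] parameters
   and the values at these points in a single sequence of vectors. *)
set (dn := fun j => let ab := Cantor.of_nat j in pt (fst ab) (snd ab)).
assert (dnE : forall a b, dn (Cantor.to_nat (a, b)) = pt a b).
{ intros a b; unfold dn; rewrite Cantor.cancel_of_to; reflexivity. }
set (X := fun n i => if lt_dec i d then P n i else v n (dn (i - d)%nat)).
destruct (cube_cluster X C) as [x Hx].
{ intros n i; unfold X; destruct (lt_dec i d); [now apply HP|apply Hv]. }
assert (Hm : forall k : nat, exists n, (k <= n)%nat /\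
   forall i, (i < k)%nat -> Rabs (X n i - x i) < / (INR k + 1)).
{ intros k; apply Hx, Rinv_0_lt_compat; pose proof (pos_INR k); lra. }
destruct (choice _ Hm) as [mm Hmm]; clear Hm.
assert (Hsmall : forall eps, 0 < eps -> exists K : nat, forall k, (K <= k)%nat -> / (INR k + 1) <= eps).
{ intros eps He; destruct (exists_nat_ge (/ eps)) as [K HK]; exists K; intros k Hk.
  apply le_INR in Hk.
  rewrite <- (Rinv_inv eps); apply Rinv_le_contravar; [now apply Rinv_0_lt_compat|lra]. }
assert (Hnear : forall t eps, 0 < eps -> exists i, (d <= i)%nat /\
   forall n, Rabs (v n t - X n i) <= eps).
{ intros t eps He.
  destruct (small_inv_nat (C * (q - p)) eps) as [b Hb]; [apply Rmult_le_pos; lra|exact He|].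
  destruct (grid_near p q (clamp p q t) b Hpq) as [a [_ Ha]]; [apply clamp_in; lra|].
  exists (d + Cantor.to_nat (a, b))%nat; split; [lia|]; intros n.
  unfold X; destruct (lt_dec _ d); [lia|].
  replace (d + Cantor.to_nat (a, b) - d)%nat with (Cantor.to_nat (a, b)) by lia.
  rewrite dnE, <- Hcl.
  eapply Rle_trans; [apply Hv|]. eapply Rle_trans; [|exact Hb].
  unfold Rdiv; rewrite Rmult_assoc; apply Rmult_le_compat_l; [exact HC|exact Ha]. }
assert (Hlim : forall t, ex_finite_lim_seq (fun k => v (mm k) t)).
{ intros t; apply ex_lim_seq_cauchy_corr; intros [eps He]; simpl.
  destruct (Hnear t (eps / 5)) as [i [_ Hi]]; [lra|].
  destruct (Hsmall (eps / 5)) as [K HK]; [lra|].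
  exists (Nat.max K (S i)); intros n m Hn Hmm'.
  assert (B : forall k, (Nat.max K (S i) <= k)%nat -> Rabs (v (mm k) t - x i) <= 2 * (eps / 5)).
  { intros k Hk; destruct (Hmm k) as [_ H1].
    specialize (H1 i ltac:(lia)); specialize (HK k ltac:(lia)); specialize (Hi (mm k)).
    apply Rabs_def2 in H1; apply Rabs_le_between in Hi; apply Rabs_le; lra. }
  pose proof (B n Hn) as B1; pose proof (B m Hmm') as B2.
  apply Rabs_le_between in B1; apply Rabs_le_between in B2.
  apply Rabs_def1; lra. }
set (w := fun t => real (Lim_seq (fun k => v (mm k) t))).
assert (Hw : forall t, is_lim_seq (fun k => v (mm k) t) (w t)).
{ intros t; apply Lim_seq_correct'; apply Hlim. }
assert (Hle : forall (u : nat -> R) (l c : R), is_lim_seq u l -> (forall n, Rabs (u n) <= c) -> Rabs l <= c).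
{ intros u l c Hu Hc. apply is_lim_seq_abs in Hu.
  apply (is_lim_seq_le (fun n => Rabs (u n)) (fun _ => c) (Rabs l) c Hc Hu (is_lim_seq_const c)). }
assert (Hwadm : adm C w).
{ split.
  - intros t; apply (Hle _ _ _ (Hw t)); intros n; apply Hv.
  - intros a b; apply (Hle (fun k => v (mm k) a - v (mm k) b)).
    + apply (is_lim_seq_minus' _ _ _ _ (Hw a) (Hw b)).
    + intros n; apply Hv. }
assert (Hwcl : forall t, w (clamp p q t) = w t).
{ intros t; unfold w; f_equal; apply Lim_seq_ext; intros n; apply Hcl. }
assert (Hwx : forall a b, x (d + Cantor.to_nat (a, b))%nat = w (pt a b)).
{ intros a b. set (i := (d + Cantor.to_nat (a, b))%nat).
  assert (E : is_lim_seq (fun k => v (mm k) (pt a b)) (x i)).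
  { apply is_lim_seq_spec; intros [eps He]; simpl.
    destruct (Hsmall eps He) as [K HK]; exists (Nat.max K (S i)); intros k Hk.
    destruct (Hmm k) as [_ H1]; specialize (H1 i ltac:(lia)); specialize (HK k ltac:(lia)).
    unfold X in H1; destruct (lt_dec i d); [lia|].
    replace (i - d)%nat with (Cantor.to_nat (a, b)) in H1 by lia.
    rewrite dnE in H1; lra. }
  pose proof (is_lim_seq_unique _ _ E) as E1; unfold w; rewrite E1; reflexivity. }
exists x, w; split; [|split; [exact Hwadm|split; [exact Hwcl|]]].
- intros i Hi; apply Rnot_lt_le; intros Hc.
  destruct (Hx (S i) (Rabs (x i) - C) 0%nat) as [n [_ Hn]]; [lra|].
  specialize (Hn i ltac:(lia)); unfold X in Hn; destruct (lt_dec i d); [|lia].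
  pose proof (HP n i Hi) as H1. pose proof (Rabs_triang_inv (x i) (P n i)) as H2.
  rewrite Rabs_minus_sym in H2; lra.
- intros eps N He.
  (* The distance to the grid costs [eps / 4] twice, for [v n] and for [w]; agreement at the
     finitely many grid points costs [eps / 2]. *)
  destruct (small_inv_nat (C * (q - p)) (eps / 4)) as [b Hb]; [apply Rmult_le_pos; lra|lra|].
  destruct (nat_fun_bound (fun a => (d + Cantor.to_nat (a, b))%nat) (S b)) as [K HK].
  destruct (Hx (Nat.max d K) (eps / 2) N) as [n [Hn1 Hn2]]; [lra|].
  exists n; split; [exact Hn1|split].
  + intros i Hi; specialize (Hn2 i ltac:(lia)); unfold X in Hn2.
    destruct (lt_dec i d); [lra|lia].
  + intros t.
    destruct (grid_near p q (clamp p q t) b Hpq) as [a [Ha1 Ha]]; [apply clamp_in; lra|].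
    specialize (HK a Ha1). specialize (Hn2 (d + Cantor.to_nat (a, b))%nat ltac:(lia)).
    rewrite Hwx in Hn2; unfold X in Hn2; destruct (lt_dec _ d); [lia|].
    replace (d + Cantor.to_nat (a, b) - d)%nat with (Cantor.to_nat (a, b)) in Hn2 by lia.
    rewrite dnE in Hn2.
    fold (pt a b) in Ha.
    assert (D : C * Rabs (clamp p q t - pt a b) <= eps / 4).
    { eapply Rle_trans; [|exact Hb].
      unfold Rdiv; rewrite Rmult_assoc; apply Rmult_le_compat_l; [exact HC|exact Ha]. }
    pose proof (proj2 (Hv n) (clamp p q t) (pt a b)) as D1.
    pose proof (proj2 Hwadm (clamp p q t) (pt a b)) as D2.
    rewrite Hcl in D1; rewrite Hwcl in D2.
    apply Rabs_def2 in Hn2.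
    assert (D1' := Rle_trans _ _ _ D1 D); assert (D2' := Rle_trans _ _ _ D2 D).
    apply Rabs_le_between in D1'; apply Rabs_le_between in D2'.
    apply Rabs_le; lra.
Qed.

(* McShane interpolation of the values [x k] at the nodes [node k]. *)
Fixpoint mcshane (C : R) (node x : nat -> R) (n : nat) (s : R) : R :=
  match n with
  | O => C
  | S n' => Rmin (mcshane C node x n' s) (x n' + C * Rabs (s - node n'))
  end.

Lemma Rabs_Rmin_le a b c d e :
  Rabs (a - c) <= e -> Rabs (b - d) <= e -> Rabs (Rmin a b - Rmin c d) <= e.
Proof.
intros H1 H2; apply Rabs_le_between in H1; apply Rabs_le_between in H2.
apply Rabs_le; unfold Rmin; destruct (Rle_dec a b), (Rle_dec c d); lra.
Qed.

Lemma mcshane_adm C node x n : 0 <= C -> (forall k, (k < n)%nat -> Rabs (x k) <= C) ->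
  adm C (mcshane C node x n).
Proof.
intros HC Hx; split.
- induction n as [|n IH]; intros s; simpl; [rewrite Rabs_pos_eq; lra|].
  pose proof (IH (fun k Hk => Hx k (Nat.lt_lt_succ_r _ _ Hk)) s) as H1.
  pose proof (Hx n (Nat.lt_succ_diag_r n)) as H2.
  apply Rabs_le_between in H1; apply Rabs_le_between in H2.
  assert (0 <= C * Rabs (s - node n)) by (apply Rmult_le_pos; [lra|apply Rabs_pos]).
  apply Rabs_le; unfold Rmin; destruct (Rle_dec _ _); lra.
- clear Hx; induction n as [|n IH]; intros s t; simpl.
  + rewrite Rminus_diag, Rabs_R0; apply Rmult_le_pos; [lra|apply Rabs_pos].
  + apply Rabs_Rmin_le; [apply IH|].
    replace (_ - _) with (C * (Rabs (s - node n) - Rabs (t - node n))) by ring.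
    rewrite Rabs_mult, (Rabs_pos_eq C) by lra; apply Rmult_le_compat_l; [lra|].
    eapply Rle_trans; [apply Rabs_triang_inv2|]; apply Req_le; f_equal; ring.
Qed.

Lemma mcshane_nonexp C node x y n s e : 0 <= e -> (forall k, (k < n)%nat -> Rabs (x k - y k) <= e) ->
  Rabs (mcshane C node x n s - mcshane C node y n s) <= e.
Proof.
intros He; induction n as [|n IH]; intros H; simpl; [rewrite Rminus_diag, Rabs_R0; exact He|].
apply Rabs_Rmin_le; [apply IH; intros k Hk; apply H; lia|].
replace (_ - _) with (x n - y n) by ring; apply H; lia.
Qed.

Lemma mcshane_ge C node x n s c : c <= C ->
  (forall k, (k < n)%nat -> c <= x k + C * Rabs (s - node k)) -> c <= mcshane C node x n s.
Proof.
intros Hc; induction n as [|n IH]; intros H; simpl; [exact Hc|].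
apply Rmin_glb; [apply IH; intros k Hk; apply H; lia|apply H; lia].
Qed.

Lemma mcshane_le C node x n s k : (k < n)%nat ->
  mcshane C node x n s <= x k + C * Rabs (s - node k).
Proof.
induction n as [|n IH]; intros H; [lia|simpl].
destruct (Nat.eq_dec k n) as [->|ne]; [apply Rmin_r|].
eapply Rle_trans; [apply Rmin_l|apply IH; lia].
Qed.

(** The finite-dimensional unknowns are the parameters and the values at the nodes of a grid.
    McShane interpolation preserves both bounds of [adm C], so [approx_brouwer] applies on the cube
    with the same [C]; [arzela_ascoli] passes to the limit in the approximate fixed points. *)
Theorem schauder (p q C : R) (d : nat)
  (Th : (nat -> R) -> (R -> R) -> nat -> R) (Ph : (nat -> R) -> (R -> R) -> R -> R) :
  p < q -> 0 < C ->
  (forall par v, incube d C par -> adm C v -> incube d C (Th par v) /\ adm C (Ph par v)) ->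
  (forall par v t, Ph par v (clamp p q t) = Ph par v t) ->
  (forall eps, 0 < eps -> exists delta, 0 < delta /\ forall par par' v v',
     incube d C par -> incube d C par' -> adm C v -> adm C v' ->
     (forall i, (i < d)%nat -> Rabs (par i - par' i) <= delta) ->
     (forall t, Rabs (v t - v' t) <= delta) ->
     (forall t, Rabs (Ph par v t - Ph par' v' t) <= eps) /\
     (forall i, (i < d)%nat -> Rabs (Th par v i - Th par' v' i) <= eps)) ->
  exists par v, incube d C par /\ adm C v /\
    (forall t, Ph par v t = v t) /\ (forall i, (i < d)%nat -> Th par v i = par i).
Proof.
intros Hpq HC Hmap Hcl HU.
assert (approx : forall eps, 0 < eps -> exists par v, incube d C par /\ adm C v /\
   (forall t, v (clamp p q t) = v t) /\
   (forall t, Rabs (Ph par v t - v t) <= eps) /\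
   (forall i, (i < d)%nat -> Rabs (Th par v i - par i) <= eps)).
{ intros eps He.
  (* The factor 2 makes [C] times the mesh at most [eps / 4]; this is lost once by the interpolant
     and once by [Ph], between a point and a nearby node. *)
  destruct (small_inv_nat (2 * C * (q - p)) (eps / 2)) as [b Hb]; [|lra|].
  { repeat apply Rmult_le_pos; lra. }
  set (n := S (S b)).
  set (node := fun a : nat => p + (q - p) * (INR a / INR (S b))).
  set (I := fun (x : nat -> R) t => mcshane C node (fun k => x (d + k)%nat) n (clamp p q t)).
  assert (Iadm : forall x, incube (d + n) C x -> adm C (I x)).
  { intros x Hx; destruct (mcshane_adm C node (fun k => x (d + k)%nat) n) as [A1 A2]; [lra| |].
    - intros k Hk; apply Hx; lia.
    - split; [intros t; apply A1|]; intros s t; eapply Rle_trans; [apply A2|].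
      apply Rmult_le_compat_l; [lra|apply clamp_lip]. }
  assert (Ipar : forall x, incube (d + n) C x -> incube d C x) by (intros x Hx i Hi; apply Hx; lia).
  set (F := fun (x : nat -> R) i => if lt_dec i d then Th x (I x) i else Ph x (I x) (node (i - d)%nat)).
  destruct (approx_brouwer (d + n) C F HC) with (eps := eps / 2) as [x [Hx HF]].
  - intros x Hx i Hi; unfold F.
    destruct (Hmap x (I x) (Ipar x Hx) (Iadm x Hx)) as [M1 [M2 _]].
    destruct (lt_dec i d); [now apply M1|apply M2].
  - intros e He'; destruct (HU e He') as [delta [Hd H]].
    exists delta; split; [exact Hd|]; intros x y Hx Hy Hxy i Hi.
    destruct (H x y (I x) (I y)) as [U1 U2]; auto.
    + intros j Hj; apply Hxy; lia.
    + intros t; apply mcshane_nonexp; [lra|]; intros k Hk; apply Hxy; lia.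
    + unfold F; destruct (lt_dec i d); auto.
  - lra.
  - exists x, (I x).
    destruct (Hmap x (I x) (Ipar x Hx) (Iadm x Hx)) as [M1 [M2 M3]].
    split; [now apply Ipar|split; [now apply Iadm|split; [|split]]].
    + intros t; unfold I; f_equal; apply clamp_id, clamp_in; lra.
    + assert (Hnode : forall k, (k < n)%nat -> Rabs (Ph x (I x) (node k) - x (d + k)%nat) <= eps / 2).
      { intros k Hk; specialize (HF (d + k)%nat ltac:(lia)); unfold F in HF.
        destruct (lt_dec (d + k) d); [lia|].
        now replace (d + k - d)%nat with k in HF by lia. }
      intros t; rewrite <- Hcl; set (s := clamp p q t).
      assert (Hs : p <= s <= q) by (apply clamp_in; lra).
      (* This side costs no mesh error, because [Ph x (I x)] is Lipschitz with the very slope [C] of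
         the McShane cones. *)
      assert (L : Ph x (I x) s - eps / 2 <= I x t).
      { apply mcshane_ge.
        - pose proof (M2 s) as H1; apply Rabs_le_between in H1; lra.
        - intros k Hk; specialize (Hnode k Hk); pose proof (M3 s (node k)) as H1.
          apply Rabs_le_between in Hnode; apply Rabs_le_between in H1; fold s; lra. }
      destruct (grid_near p q s b Hpq Hs) as [a [Ha1 Ha2]]; fold (node a) in Ha2.
      assert (U := mcshane_le C node (fun k => x (d + k)%nat) n s a ltac:(unfold n; lia)).
      specialize (Hnode a ltac:(unfold n; lia)); pose proof (M3 s (node a)) as H1.
      apply Rabs_le_between in Hnode; apply Rabs_le_between in H1.
      fold (I x t) in U.
      assert (D : C * Rabs (s - node a) <= eps / 4).
      { apply Rle_trans with (C * ((q - p) / INR (S b))); [apply Rmult_le_compat_l; lra|].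
        unfold Rdiv in *; nra. }
      assert (U' : I x t <= x (d + a)%nat + C * Rabs (s - node a)) by exact U.
      apply Rabs_le; lra.
    + intros i Hi; specialize (HF i ltac:(lia)); unfold F in HF.
      destruct (lt_dec i d); [lra|lia]. }
assert (seq : forall n : nat, exists pv : (nat -> R) * (R -> R),
   incube d C (fst pv) /\ adm C (snd pv) /\ (forall t, snd pv (clamp p q t) = snd pv t) /\
   (forall t, Rabs (Ph (fst pv) (snd pv) t - snd pv t) <= / (INR n + 1)) /\
   (forall i, (i < d)%nat -> Rabs (Th (fst pv) (snd pv) i - fst pv i) <= / (INR n + 1))).
{ intros n; destruct (approx (/ (INR n + 1))) as [par [v H]].
  - apply Rinv_0_lt_compat; pose proof (pos_INR n); lra.
  - exists (par, v); exact H. }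
destruct (choice _ seq) as [s Hs]; clear seq approx.
destruct (arzela_ascoli p q C d (fun n => fst (s n)) (fun n => snd (s n))) as [par [v [Hp [Hv [_ Hlim]]]]];
  [exact Hpq|lra|apply Hs|apply Hs|apply Hs|].
assert (key : forall e, 0 < e -> (forall t, Rabs (Ph par v t - v t) <= e) /\
   (forall i, (i < d)%nat -> Rabs (Th par v i - par i) <= e)).
{ intros e He; destruct (HU (e / 3)) as [delta [Hd H]]; [lra|].
  destruct (exists_nat_ge (/ (e / 3))) as [N HN].
  destruct (Hlim (Rmin delta (e / 3)) N) as [n [Hn [L1 L2]]]; [apply Rmin_glb_lt; lra|].
  destruct (Hs n) as [S1 [S2 [_ [S4 S5]]]].
  assert (Hi : / (INR n + 1) <= e / 3).
  { rewrite <- (Rinv_inv (e / 3)); apply Rinv_le_contravar.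
    - apply Rinv_0_lt_compat; lra.
    - apply le_INR in Hn; lra. }
  pose proof (Rmin_l delta (e / 3)); pose proof (Rmin_r delta (e / 3)).
  destruct (H (fst (s n)) par (snd (s n)) v) as [U1 U2]; auto.
  { intros i Hi'; specialize (L1 i Hi'); lra. }
  { intros t; specialize (L2 t); lra. }
  split.
  - intros t; specialize (U1 t); specialize (S4 t); specialize (L2 t).
    apply Rabs_le_between in U1; apply Rabs_le_between in S4; apply Rabs_le_between in L2.
    apply Rabs_le; lra.
  - intros i Hi'; specialize (U2 i Hi'); specialize (S5 i Hi'); specialize (L1 i Hi').
    apply Rabs_le_between in U2; apply Rabs_le_between in S5; apply Rabs_le_between in L1.
    apply Rabs_le; lra. }
exists par, v; split; [exact Hp|split; [exact Hv|split]].
- intros t; apply cond_eq; intros e He; destruct (key (e / 2)) as [K _]; [lra|].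
  specialize (K t); lra.
- intros i Hi; apply cond_eq; intros e He; destruct (key (e / 2)) as [_ K]; [lra|].
  specialize (K i Hi); lra.
Qed.

(** * Two-point boundary value problems *)

Lemma mvt (f df : R -> R) (a b : R) : (forall t, is_derive f t (df t)) -> a < b ->
  exists c, a < c < b /\ f b - f a = df c * (b - a).
Proof.
intros Hf Hab; destruct (MVT_cor2 f df a b Hab) as [c [H1 H2]].
- intros c _; apply is_derive_Reals, Hf.
- exists c; split; assumption.
Qed.

Definition C2 (u du ddu : R -> R) : Prop :=
  (forall t, is_derive u t (du t)) /\ (forall t, is_derive du t (ddu t)) /\
  (forall t, continuous ddu t).

Lemma derive_continuous (f df : R -> R) : (forall t, is_derive f t (df t)) -> forall t, continuous f t.
Proof. intros H t; apply (ex_derive_continuous (V := R_NormedModule)); exists (df t); apply H. Qed.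

Lemma C2_bounds (u du ddu : R -> R) (p q K : R) : C2 u du ddu -> p < q -> u p = 0 -> u q = 0 ->
  (forall t, p <= t <= q -> Rabs (ddu t) <= K) ->
  (forall t, p <= t <= q -> Rabs (du t) <= K * (q - p)) /\
  (forall t, p <= t <= q -> Rabs (u t) <= K * (q - p) * (q - p)).
Proof.
intros [H1 [H2 _]] Hpq Hp Hq HK.
assert (HK0 : 0 <= K) by (eapply Rle_trans; [apply Rabs_pos|apply (HK p); lra]).
destruct (mvt u du p q H1 Hpq) as [x [Hx Ex]].
assert (dx : du x = 0) by (rewrite Hp, Hq in Ex; nra).
assert (D : forall t, p <= t <= q -> Rabs (du t) <= K * (q - p)).
{ intros t Ht; destruct (Rtotal_order t x) as [Hl|[->|Hl]].
  - destruct (mvt du ddu t x H2 Hl) as [c [Hc Ec]].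
    replace (du t) with (- (ddu c * (x - t))) by lra.
    rewrite Rabs_Ropp, Rabs_mult, (Rabs_pos_eq (x - t)) by lra.
    apply Rmult_le_compat; [apply Rabs_pos|lra|apply HK; lra|lra].
  - rewrite dx, Rabs_R0; apply Rmult_le_pos; lra.
  - destruct (mvt du ddu x t H2 Hl) as [c [Hc Ec]].
    replace (du t) with (ddu c * (t - x)) by lra.
    rewrite Rabs_mult, (Rabs_pos_eq (t - x)) by lra.
    apply Rmult_le_compat; [apply Rabs_pos|lra|apply HK; lra|lra]. }
split; [exact D|]; intros t Ht.
assert (0 <= K * (q - p)) by (apply Rmult_le_pos; lra).
destruct (Req_dec t p) as [->|ne].
- rewrite Hp, Rabs_R0; apply Rmult_le_pos; lra.
- destruct (mvt u du p t H1) as [c [Hc Ec]]; [lra|].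
  replace (u t) with (du c * (t - p)) by lra.
  rewrite Rabs_mult, (Rabs_pos_eq (t - p)) by lra.
  apply Rmult_le_compat; [apply Rabs_pos|lra|apply D; lra|lra].
Qed.

Lemma RInt_primitive (f : R -> R) (p : R) : (forall t, continuous f t) ->
  forall t, is_derive (fun x => RInt f p x) t (f t).
Proof.
intros Hf t; apply is_derive_RInt with p; [|apply Hf].
apply filter_forall; intros x; apply (RInt_correct (V := R_CompleteNormedModule)), (ex_RInt_continuous (V := R_CompleteNormedModule)).
intros; apply Hf.
Qed.

(* Solution of [- u'' = f] on [[p, q]] vanishing at [p] and [q]. *)
Definition green (p q : R) (f : R -> R) (t : R) : R :=
  (t - p) / (q - p) * RInt (fun x => RInt f p x) p q - RInt (fun x => RInt f p x) p t.
Definition dgreen (p q : R) (f : R -> R) (t : R) : R :=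
  RInt (fun x => RInt f p x) p q / (q - p) - RInt f p t.

Lemma green_C2 (p q : R) (f : R -> R) : p < q -> (forall t, continuous f t) ->
  C2 (green p q f) (dgreen p q f) (fun t => - f t) /\ green p q f p = 0 /\ green p q f q = 0.
Proof.
intros Hpq Hf.
assert (H1 := RInt_primitive f p Hf).
assert (H2 := RInt_primitive _ p (derive_continuous _ _ H1)).
split; [split; [|split]|split].
- intros t; unfold green, dgreen.
  set (I := RInt (fun x => RInt f p x) p q).
  apply (is_derive_ext (fun t => minus ((t - p) / (q - p) * I) (RInt (fun x => RInt f p x) p t)));
    [reflexivity|].
  apply (is_derive_minus (fun t => (t - p) / (q - p) * I)); [|apply H2].
  auto_derive; [exact Logic.I|field; lra].
- intros t; unfold dgreen.
  set (I := RInt (fun x => RInt f p x) p q / (q - p)).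
  replace (- f t) with (minus 0 (f t)) by (unfold minus, plus, opp; simpl; ring).
  apply (is_derive_minus (fun _ => I)); [apply (is_derive_const (V := R_NormedModule))|apply H1].
- intros t; apply (continuous_opp (V := R_NormedModule)); apply Hf.
- unfold green; rewrite (RInt_point p); unfold zero; simpl; field; lra.
- unfold green; field; lra.
Qed.

(** An operator acting on the scalar unknowns and the unknown function: the source term for [T = R],
    the scalar equations for [T = nat]. *)
Definition fam (T : Type) := (nat -> R) -> (R -> R) -> T -> R.
Definition fam_bdd {T} (F : fam T) : Prop :=
  exists K, 0 <= K /\ forall par v t, Rabs (F par v t) <= K.
Definition fam_uc {T} (d : nat) (F : fam T) : Prop :=
  forall eps, 0 < eps -> exists delta, 0 < delta /\ forall par par' v v',
    (forall i, (i < d)%nat -> Rabs (par i - par' i) <= delta) ->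
    (forall t, Rabs (v t - v' t) <= delta) ->
    forall t, Rabs (F par v t - F par' v' t) <= eps.

Definition fam_ok {T} (d : nat) (F : fam T) : Prop := fam_bdd F /\ fam_uc d F.

(** The equation [- v'' = Ps par v] with zero end values, coupled to scalar equations, as a fixed
    point of the Green operator. Bounds valid for all arguments make a large [adm C] invariant. *)
Theorem bvp (p q : R) (d : nat) (Th : fam nat) (Ps : fam R) : p < q ->
  fam_ok d Th -> fam_ok d Ps ->
  (forall par v, (forall t, continuous v t) -> forall t, continuous (Ps par v) t) ->
  exists par v, (forall t, continuous v t) /\ (forall t, v t = green p q (Ps par v) (clamp p q t)) /\
    (forall i, (i < d)%nat -> Th par v i = par i).
Proof.
intros Hpq [[K1 [K1p B1]] U1] [[K2 [K2p B2]] U2] Hc.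
set (l := q - p). assert (Hl : 0 < l) by (unfold l; lra).
(* By [C2_bounds], [K2 * l] bounds the slope and [K2 * l * l] the values of the new function; [K1]
   bounds the scalar unknowns, and 1 makes [C] positive. *)
set (C := K1 + K2 * l + K2 * l * l + 1).
assert (P1 : 0 <= K2 * l) by (apply Rmult_le_pos; lra).
assert (P2 : 0 <= K2 * l * l) by (apply Rmult_le_pos; lra).
assert (admc : forall v, adm C v -> forall t, continuous v t).
{ intros v [_ Hv] t; apply continuity_pt_filterlim, continuity_pt_locally.
  intros [eps He]; assert (HC : 0 < C) by (unfold C; lra).
  assert (He' : 0 < eps / C) by (apply Rdiv_lt_0_compat; lra).
  exists (mkposreal _ He'); intros y Hy; simpl in *.
  eapply Rle_lt_trans; [apply Hv|].
  unfold ball in Hy; simpl in Hy; unfold AbsRing_ball, abs, minus, plus, opp in Hy; simpl in Hy.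
  apply (Rmult_lt_compat_l C) in Hy; [|exact HC].
  replace (C * (eps / C)) with eps in Hy by (field; lra); exact Hy. }
destruct (schauder p q C d Th (fun par v t => green p q (Ps par v) (clamp p q t)))
  as [par [v [_ [Hv [E1 E2]]]]].
- exact Hpq.
- unfold C; lra.
- intros par v _ Hv; split.
  + intros i _; eapply Rle_trans; [apply B1|unfold C; lra].
  + destruct (green_C2 p q (Ps par v) Hpq (Hc par v (admc v Hv))) as [G [Gp Gq]].
    destruct (C2_bounds _ _ _ p q K2 G Hpq Gp Gq) as [D1 D2].
    { intros t _; rewrite Rabs_Ropp; apply B2. }
    fold l in D1, D2; split.
    * intros t; eapply Rle_trans; [apply D2, clamp_in; lra|unfold C; lra].
    * intros x y; apply Rle_trans with (C * Rabs (clamp p q x - clamp p q y)).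
      2: { apply Rmult_le_compat_l; [unfold C; lra|apply clamp_lip]. }
      assert (lip : forall a b, p <= a -> a < b -> b <= q ->
         Rabs (green p q (Ps par v) b - green p q (Ps par v) a) <= C * (b - a)).
      { intros a b Ha Hab Hb; destruct (mvt _ _ a b (proj1 G) Hab) as [c [Hc' ->]].
        rewrite Rabs_mult, (Rabs_pos_eq (b - a)) by lra; apply Rmult_le_compat_r; [lra|].
        eapply Rle_trans; [apply D1; lra|unfold C; lra]. }
      destruct (clamp_in p q x) as [X1 X2]; [lra|]; destruct (clamp_in p q y) as [Y1 Y2]; [lra|].
      destruct (Rtotal_order (clamp p q x) (clamp p q y)) as [H|[H|H]].
      -- rewrite Rabs_minus_sym, (Rabs_minus_sym (clamp p q x)), (Rabs_pos_eq (_ - clamp p q x)) by lra.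
         apply lip; lra.
      -- rewrite H, !Rminus_diag, Rabs_R0; lra.
      -- rewrite (Rabs_pos_eq (clamp p q x - _)) by lra; apply lip; lra.
- intros par v t; simpl; rewrite (clamp_id p q (clamp p q t)); [reflexivity|apply clamp_in; lra].
- intros eps He.
  assert (Hll : 0 < l * l) by (apply Rmult_lt_0_compat; lra).
  destruct (U1 eps He) as [d1 [D1 H1]].
  destruct (U2 (eps / (l * l))) as [d2 [D2 H2]]; [apply Rdiv_lt_0_compat; lra|].
  exists (Rmin d1 d2); split; [apply Rmin_glb_lt; lra|].
  pose proof (Rmin_l d1 d2); pose proof (Rmin_r d1 d2).
  intros par par' v v' _ _ Hv Hv' Hp Hvv; split.
  + intros t.
    destruct (green_C2 p q (Ps par v) Hpq (Hc par v (admc v Hv))) as [[Ga [Gb Gc]] [Gp Gq]].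
    destruct (green_C2 p q (Ps par' v') Hpq (Hc par' v' (admc v' Hv'))) as [[Ga' [Gb' Gc']] [Gp' Gq']].
    destruct (C2_bounds (fun t => green p q (Ps par v) t - green p q (Ps par' v') t)
      (fun t => dgreen p q (Ps par v) t - dgreen p q (Ps par' v') t)
      (fun t => - Ps par v t - - Ps par' v' t) p q (eps / (l * l))) as [_ DD].
    * split; [|split]; intros x.
      -- apply (is_derive_minus (V := R_NormedModule)); [apply Ga|apply Ga'].
      -- apply (is_derive_minus (V := R_NormedModule)); [apply Gb|apply Gb'].
      -- apply (continuous_minus (V := R_NormedModule)); [apply Gc|apply Gc'].
    * exact Hpq.
    * simpl; lra.
    * simpl; lra.
    * intros x _; replace (- Ps par v x - - Ps par' v' x) with (- (Ps par v x - Ps par' v' x)) by ring.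
      rewrite Rabs_Ropp; apply H2.
      -- intros i Hi; specialize (Hp i Hi); lra.
      -- intros y; specialize (Hvv y); lra.
    * eapply Rle_trans; [apply DD, clamp_in; lra|].
      fold l; apply Req_le; field; lra.
  + intros i _; apply H1.
    -- intros j Hj; specialize (Hp j Hj); lra.
    -- intros y; specialize (Hvv y); lra.
- exists par, v; split; [apply admc, Hv|split; [intros t; symmetry; apply E1|exact E2]].
Qed.

(** * Integrals, nodal intervals, concavity *)

Lemma continuous_eps (f : R -> R) (t : R) : continuous f t <->
  forall eps, 0 < eps -> exists delta, 0 < delta /\ forall y, Rabs (y - t) < delta -> Rabs (f y - f t) < eps.
Proof.
split.
- intros H eps He; apply continuity_pt_filterlim in H; rewrite continuity_pt_locally in H.
  destruct (H (mkposreal eps He)) as [[d Hd] Hy]; exists d; split; [exact Hd|].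
  intros y; apply Hy.
- intros H; apply continuity_pt_filterlim, continuity_pt_locally; intros [eps He].
  destruct (H eps He) as [d [Hd Hy]]; exists (mkposreal d Hd); intros y; apply Hy.
Qed.

Lemma ftc (F f : R -> R) (a b : R) : (forall t, is_derive F t (f t)) -> (forall t, continuous f t) ->
  (RInt f a b : R) = F b - F a.
Proof.
intros H1 H2; apply is_RInt_unique, (is_RInt_derive (V := R_CompleteNormedModule)); auto.
Qed.

Lemma ex_RInt_cont (f : R -> R) (a b : R) : (forall t, continuous f t) -> ex_RInt f a b.
Proof. intros H; apply (ex_RInt_continuous (V := R_CompleteNormedModule)); auto. Qed.

Lemma continuous_pos_near (f : R -> R) (t : R) : continuous f t -> 0 < f t ->
  exists delta, 0 < delta /\ forall y, Rabs (y - t) < delta -> 0 < f y.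
Proof.
intros H Hp; destruct (proj1 (continuous_eps f t) H (f t) Hp) as [d [Hd Hy]].
exists d; split; [exact Hd|]; intros y H1; specialize (Hy y H1); apply Rabs_def2 in Hy; lra.
Qed.

Lemma primitive_mono (f : R -> R) (s x y : R) : (forall t, continuous f t) -> x <= y ->
  (forall t, x < t < y -> 0 <= f t) -> RInt f s x <= RInt f s y.
Proof.
intros Hc Hxy Hf; destruct (Req_dec x y) as [->|ne]; [lra|].
destruct (mvt _ _ x y (RInt_primitive f s Hc)) as [c [Hc' E]]; [lra|].
assert (0 <= f c * (y - x)) by (apply Rmult_le_pos; [apply Hf|]; lra); simpl in E; lra.
Qed.

Lemma RInt_pos (f : R -> R) (s e t0 : R) : (forall t, continuous f t) ->
  (forall t, s < t < e -> 0 <= f t) -> s <= t0 <= e -> s < e -> 0 < f t0 -> 0 < RInt f s e.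
Proof.
intros Hc Hf Ht Hse Hp.
destruct (continuous_pos_near f t0 (Hc t0) Hp) as [d [Hd Hy]].
set (x := Rmax s (t0 - d / 2)); set (y := Rmin e (t0 + d / 2)).
assert (Hx : s <= x /\ t0 - d / 2 <= x /\ x <= t0).
{ unfold x; split; [apply Rmax_l|split; [apply Rmax_r|apply Rmax_lub; lra]]. }
assert (Hy' : y <= e /\ y <= t0 + d / 2 /\ t0 <= y).
{ unfold y; split; [apply Rmin_l|split; [apply Rmin_r|apply Rmin_glb; lra]]. }
assert (Hxy : x < y).
{ unfold x, y; apply Rmax_lub_lt; apply Rmin_glb_lt; lra. }
assert (I0 : RInt f s s = 0) by (apply (RInt_point (V := R_CompleteNormedModule))).
assert (H1 := primitive_mono f s s x Hc ltac:(lra) ltac:(intros; apply Hf; lra)).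
assert (H2 := primitive_mono f s y e Hc ltac:(lra) ltac:(intros; apply Hf; lra)).
destruct (mvt _ _ x y (RInt_primitive f s Hc) Hxy) as [c [Hc' E]]; simpl in E.
assert (0 < f c * (y - x)).
{ apply Rmult_lt_0_compat; [apply Hy, Rabs_def1; lra|lra]. }
lra.
Qed.

Lemma last_zero (f : R -> R) (s t : R) : (forall x, continuous f x) -> s < t -> f s = 0 -> 0 < f t ->
  exists x, s <= x < t /\ f x = 0 /\ forall y, x < y <= t -> 0 < f y.
Proof.
intros Hc Hst Hs Ht.
destruct (completeness (fun y => s <= y <= t /\ f y <= 0)) as [x [Hub Hlub]].
- exists t; intros y [Hy _]; lra.
- exists s; split; lra.
- assert (Hsx : s <= x) by (apply Hub; split; lra).
  assert (Hxt : x <= t) by (apply Hlub; intros y [Hy _]; lra).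
  assert (pos : forall y, x < y <= t -> 0 < f y).
  { intros y Hy; apply Rnot_le_lt; intros H; assert (y <= x) by (apply Hub; split; lra); lra. }
  assert (fx : f x <= 0).
  { apply Rnot_lt_le; intros H; destruct (continuous_pos_near f x (Hc x) H) as [d [Hd Hy]].
    assert (x <= x - d / 2); [|lra].
    apply Hlub; intros y [Hy1 Hy2]; apply Rnot_lt_le; intros Hl.
    assert (y <= x) by (apply Hub; split; assumption).
    assert (0 < f y); [apply Hy, Rabs_def1; lra|lra]. }
  assert (x <> t) by (intros ->; lra).
  exists x; split; [lra|split; [|exact pos]].
  apply Rle_antisym; [exact fx|]; apply Rnot_lt_le; intros Hn.
  assert (Hc' : continuous (fun y => - f y) x) by (apply (continuous_opp (V := R_NormedModule)), Hc).
  destruct (continuous_pos_near _ x Hc') as [d [Hd Hy]]; [lra|].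
  set (y := Rmin t (x + d / 2)).
  assert (x < y) by (apply Rmin_glb_lt; lra).
  pose proof (Rmin_l t (x + d / 2)) as M1; pose proof (Rmin_r t (x + d / 2)) as M2; fold y in M1, M2.
  assert (0 < - f y) by (apply Hy, Rabs_def1; lra).
  assert (0 < f y) by (apply pos; lra); lra.
Qed.

Lemma nodal_interval (f : R -> R) (s t e : R) : (forall x, continuous f x) -> s < t < e ->
  f s = 0 -> f e = 0 -> 0 < f t ->
  exists x y, s <= x /\ x < t < y /\ y <= e /\ f x = 0 /\ f y = 0 /\ forall z, x < z < y -> 0 < f z.
Proof.
intros Hc Ht Hs He Hp.
destruct (last_zero f s t Hc) as [x [Hx [fx px]]]; [lra..|].
destruct (last_zero (fun z => f (- z)) (- e) (- t)) as [y [Hy [fy py]]].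
- intros z; apply (continuous_comp (fun z => - z) f); [|apply Hc].
  apply (continuous_opp (V := R_NormedModule)), continuous_id.
- lra.
- rewrite Ropp_involutive; exact He.
- rewrite Ropp_involutive; exact Hp.
- exists x, (- y); repeat split; try lra.
  intros z Hz; destruct (Rle_lt_dec z t).
  + apply px; lra.
  + rewrite <- (Ropp_involutive z); apply py; lra.
Qed.

Lemma derive_mono (u du : R -> R) (s e x y : R) : (forall t, is_derive u t (du t)) ->
  (forall t, s < t < e -> 0 <= du t) -> s <= x -> x <= y -> y <= e -> u x <= u y.
Proof.
intros Hu Hd Hx Hxy Hy; destruct (Req_dec x y) as [->|ne]; [lra|].
destruct (mvt u du x y Hu) as [c [Hc E]]; [lra|].
assert (0 <= du c * (y - x)) by (apply Rmult_le_pos; [apply Hd|]; lra); lra.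
Qed.

(** The chord inequality of concave functions, multiplied out so that degenerate intervals are
    covered. *)
Lemma concave_chord (u du ddu : R -> R) (s e x y z : R) : C2 u du ddu ->
  (forall t, s < t < e -> ddu t <= 0) -> s <= x -> x <= y -> y <= z -> z <= e ->
  (z - y) * u x + (y - x) * u z <= (z - x) * u y.
Proof.
intros [H1 [H2 _]] Hd Hx Hxy Hyz Hz.
destruct (Req_dec x y) as [->|n1]; [lra|]; destruct (Req_dec y z) as [->|n2]; [lra|].
destruct (mvt u du x y H1) as [c1 [C1 E1]]; [lra|].
destruct (mvt u du y z H1) as [c2 [C2' E2]]; [lra|].
destruct (mvt du ddu c1 c2 H2) as [c [C3 E3]]; [lra|].
assert (ddu c <= 0) by (apply Hd; lra).
assert (D : du c2 <= du c1) by nra.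
assert ((z - y) * (y - x) * (du c1 - du c2) >= 0).
{ apply Rle_ge, Rmult_le_pos; [apply Rmult_le_pos|]; lra. }
nra.
Qed.

(** A quadratic minorant of the tent with zeros [s] and [e]. Being smooth, it also serves as a test
    function. *)
Definition bump (s e t : R) : R := (t - s) * (e - t) / (e - s) ^ 2.

Lemma bump_bounds s e t : s < e -> s <= t <= e ->
  0 <= bump s e t <= (t - s) / (e - s) /\ bump s e t <= (e - t) / (e - s).
Proof.
intros Hse Ht; unfold bump; set (l := e - s); assert (0 < l) by (unfold l; lra).
assert (X : 0 <= (t - s) / l <= 1) by (split; [apply Rdiv_le_0_compat|apply Rle_div_l]; unfold l in *; lra).
assert (Y : 0 <= (e - t) / l <= 1) by (split; [apply Rdiv_le_0_compat|apply Rle_div_l]; unfold l in *; lra).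
replace ((t - s) * (e - t) / l ^ 2) with ((t - s) / l * ((e - t) / l)) by (field; lra).
nra.
Qed.

Lemma bump_cont s e t : continuous (bump s e) t.
Proof.
apply (ex_derive_continuous (V := R_NormedModule)); unfold bump, Rdiv; auto_derive; exact I.
Qed.

(** Chords through the midpoint and an end point. The midpoint value controls the function from both
    sides, which is why one scalar unknown [q_i] can govern the solution on a whole interval. *)
Lemma concave_midpoint (u du ddu : R -> R) (s e : R) : C2 u du ddu -> s < e ->
  (forall t, s < t < e -> ddu t <= 0) -> 0 <= u s -> 0 <= u e ->
  forall t, s <= t <= e -> 0 <= u t /\ u ((s + e) / 2) * bump s e t <= u t <= 2 * u ((s + e) / 2).
Proof.
intros HC Hse Hd Hs He.
assert (N : forall t, s <= t <= e -> 0 <= u t).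
{ intros t Ht; pose proof (concave_chord u du ddu s e s t e HC Hd) as H; nra. }
intros t Ht; set (c := (s + e) / 2); assert (Hc : s < c < e) by (unfold c; lra).
assert (Nc := N c ltac:(lra)); assert (Nt := N t Ht).
split; [exact Nt|].
destruct (bump_bounds s e t Hse Ht) as [[B0 B1] B2].
destruct (Rle_lt_dec t c) as [H|H].
- pose proof (concave_chord u du ddu s e s t c HC Hd) as H1.
  pose proof (concave_chord u du ddu s e t c e HC Hd) as H2.
  assert (H1' : (t - s) * u c <= (c - s) * u t) by nra.
  assert (H2' : (e - c) * u t <= (e - t) * u c) by nra.
  split.
  + apply Rle_trans with (u c * ((t - s) / (e - s))); [apply Rmult_le_compat_l; lra|].
    replace (u c * ((t - s) / (e - s))) with ((t - s) * u c / (e - s)) by (field; lra).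
    apply Rle_div_l; [lra|]; unfold c in *; nra.
  + unfold c in *; nra.
- pose proof (concave_chord u du ddu s e c t e HC Hd) as H1.
  pose proof (concave_chord u du ddu s e s c t HC Hd) as H2.
  assert (H1' : (e - t) * u c <= (e - c) * u t) by nra.
  assert (H2' : (c - s) * u t <= (t - s) * u c) by nra.
  split.
  + apply Rle_trans with (u c * ((e - t) / (e - s))); [apply Rmult_le_compat_l; lra|].
    replace (u c * ((e - t) / (e - s))) with ((e - t) * u c / (e - s)) by (field; lra).
    apply Rle_div_l; [lra|]; unfold c in *; nra.
  + unfold c in *; nra.
Qed.

(** Weak maximum principle: on a nodal interval of [- v] the function would be concave with zero end
    values, hence nonnegative. *)
Lemma nonneg_of_concave_where_neg (v dv ddv : R -> R) (p q : R) : C2 v dv ddv -> v p = 0 -> v q = 0 ->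
  (forall t, p < t < q -> v t < 0 -> ddv t <= 0) -> forall t, p <= t <= q -> 0 <= v t.
Proof.
intros HC Hp Hq Hd t Ht; apply Rnot_lt_le; intros Hn.
assert (p <> t) by (intros ->; lra); assert (t <> q) by (intros ->; lra).
destruct (nodal_interval (fun x => - v x) p t q) as [x [y [Hx [Hxy [Hy [fx [fy Hz]]]]]]]; try lra.
- intros z; apply (continuous_opp (V := R_NormedModule)), (derive_continuous v dv), (proj1 HC).
- pose proof (concave_chord v dv ddv x y x t y HC) as H1.
  assert (HH : forall z, x < z < y -> ddv z <= 0).
  { intros z Hz'; apply Hd; [lra|]; specialize (Hz z Hz'); lra. }
  specialize (H1 HH); replace (v x) with 0 in H1 by lra; replace (v y) with 0 in H1 by lra; nra.
Qed.

Lemma pinned_bounds (v dv ddv : R -> R) (L K : R) : C2 v dv ddv -> 0 < L -> v 0 = 0 -> v L = 0 ->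
  (forall t, 0 <= t <= L -> 0 <= v t) -> (forall t, 0 < t < L -> - K <= ddv t) -> 0 <= K ->
  (forall t, 0 < t < L -> - (K * L) <= dv t <= K * L) /\
  (forall t, 0 <= t <= L -> v t <= K * L * L).
Proof.
intros [H1 [H2 _]] HL v0 vL Hv Hd HK.
assert (D : forall t, 0 < t < L -> - (K * L) <= dv t <= K * L).
{ intros t Ht; split.
  - destruct (mvt v dv 0 t H1) as [x [Hx Ex]]; [lra|].
    destruct (mvt dv ddv x t H2) as [y [Hy Ey]]; [lra|].
    assert (0 <= dv x) by (pose proof (Hv t); nra).
    assert (- K <= ddv y) by (apply Hd; lra).
    assert (- K * (t - x) <= ddv y * (t - x)) by (apply Rmult_le_compat_r; lra); nra.
  - destruct (mvt v dv t L H1) as [x [Hx Ex]]; [lra|].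
    destruct (mvt dv ddv t x H2) as [y [Hy Ey]]; [lra|].
    assert (dv x <= 0) by (pose proof (Hv t); nra).
    assert (- K <= ddv y) by (apply Hd; lra).
    assert (- K * (x - t) <= ddv y * (x - t)) by (apply Rmult_le_compat_r; lra); nra. }
split; [exact D|]; intros t Ht.
assert (0 <= K * L) by (apply Rmult_le_pos; lra).
destruct (Req_dec t 0) as [->|ne]; [rewrite v0; apply Rmult_le_pos; lra|].
destruct (mvt v dv 0 t H1) as [x [Hx Ex]]; [lra|].
destruct (Req_dec t L) as [->|ne']; [rewrite vL; apply Rmult_le_pos; lra|].
destruct (D x ltac:(lra)) as [_ Dx]; assert (dv x * (t - 0) <= K * L * L) by nra.
lra.
Qed.

Lemma C2_cont (u du ddu : R -> R) : C2 u du ddu ->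
  (forall t, continuous u t) /\ (forall t, continuous du t) /\ (forall t, continuous ddu t).
Proof.
intros [H1 [H2 H3]]; split; [|split; [|exact H3]].
- exact (derive_continuous _ _ H1).
- exact (derive_continuous _ _ H2).
Qed.

Lemma cont_mult (f g : R -> R) : (forall t, continuous f t) -> (forall t, continuous g t) ->
  forall t, continuous (fun x => f x * g x) t.
Proof. intros H1 H2 t; apply (continuous_mult f g); auto. Qed.

Lemma cont_plus (f g : R -> R) : (forall t, continuous f t) -> (forall t, continuous g t) ->
  forall t, continuous (fun x => f x + g x) t.
Proof. intros H1 H2 t; apply (continuous_plus (V := R_NormedModule) f g); auto. Qed.

Lemma cont_minus (f g : R -> R) : (forall t, continuous f t) -> (forall t, continuous g t) ->
  forall t, continuous (fun x => f x - g x) t.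
Proof. intros H1 H2 t; apply (continuous_minus (V := R_NormedModule) f g); auto. Qed.

Lemma cont_const (c : R) : forall t, continuous (fun _ : R => c) t.
Proof. intros t; apply continuous_const. Qed.

Ltac cont_auto := repeat match goal with
  | |- forall t, continuous (fun _ => ?c) t => apply (cont_const c)
  | |- forall t, continuous (fun x => @?f x - @?g x) t => apply (cont_minus f g)
  | |- forall t, continuous (fun x => @?f x + @?g x) t => apply (cont_plus f g)
  | |- forall t, continuous (fun x => @?f x * @?g x) t => apply (cont_mult f g)
  | |- forall t, continuous (fun x => bump ?s ?e x) t => exact (bump_cont s e)
  | H : forall t, continuous ?f t |- forall t, continuous (fun x => ?f x) t => exact H
  end.

Lemma wronskian (u du ddu w dw ddw : R -> R) (s e : R) : C2 u du ddu -> C2 w dw ddw ->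
  (RInt (fun t => ddu t * w t - ddw t * u t) s e : R) = (du e * w e - dw e * u e) - (du s * w s - dw s * u s).
Proof.
intros Hu Hw; destruct (C2_cont _ _ _ Hu) as [U0 [U1 U2]]; destruct (C2_cont _ _ _ Hw) as [W0 [W1 W2]].
apply (ftc (fun t => du t * w t - dw t * u t)).
- intros t; destruct Hu as [A1 [A2 _]]; destruct Hw as [B1 [B2 _]].
  replace (ddu t * w t - ddw t * u t) with
    (minus (plus (mult (ddu t) (w t)) (mult (du t) (dw t))) (plus (mult (ddw t) (u t)) (mult (dw t) (du t)))).
  2: { unfold minus, plus, opp, mult; simpl; ring. }
  apply (is_derive_minus (fun t => du t * w t) (fun t => dw t * u t)).
  + apply (is_derive_mult du w); auto; intros; apply Rmult_comm.
  + apply (is_derive_mult dw u); auto; intros; apply Rmult_comm.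
- cont_auto.
Qed.

Lemma derive_start_nonneg (f df : R -> R) (s e : R) : (forall t, is_derive f t (df t)) ->
  (forall t, continuous df t) -> s < e -> f s = 0 -> (forall t, s < t < e -> 0 <= f t) -> 0 <= df s.
Proof.
intros H1 H2 Hse Hs Hf; apply Rnot_lt_le; intros Hn.
assert (Hc : continuous (fun y => - df y) s) by (apply (continuous_opp (V := R_NormedModule)), H2).
destruct (continuous_pos_near _ s Hc) as [d [Hd Hy]]; [lra|].
set (t := Rmin (s + d / 2) ((s + e) / 2)).
assert (s < t) by (apply Rmin_glb_lt; lra).
pose proof (Rmin_l (s + d / 2) ((s + e) / 2)) as M1; pose proof (Rmin_r (s + d / 2) ((s + e) / 2)) as M2.
fold t in M1, M2.
destruct (mvt f df s t H1) as [c [Hc' Ec]]; [lra|].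
assert (0 < - df c) by (apply Hy, Rabs_def1; lra).
assert (0 <= f t) by (apply Hf; lra); nra.
Qed.

Lemma derive_end_nonpos (f df : R -> R) (s e : R) : (forall t, is_derive f t (df t)) ->
  (forall t, continuous df t) -> s < e -> f e = 0 -> (forall t, s < t < e -> 0 <= f t) -> df e <= 0.
Proof.
intros H1 H2 Hse Hs Hf; apply Rnot_lt_le; intros Hn.
destruct (continuous_pos_near df e (H2 e) Hn) as [d [Hd Hy]].
set (t := Rmax (e - d / 2) ((s + e) / 2)).
assert (t < e) by (apply Rmax_lub_lt; lra).
pose proof (Rmax_l (e - d / 2) ((s + e) / 2)) as M1; pose proof (Rmax_r (e - d / 2) ((s + e) / 2)) as M2.
fold t in M1, M2.
destruct (mvt f df t e H1) as [c [Hc' Ec]]; [lra|].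
assert (0 < df c) by (apply Hy, Rabs_def1; lra).
assert (0 <= f t) by (apply Hf; lra); nra.
Qed.

(** * Positive eigenfunctions *)

(** Regularity is asked on the whole line but the equation only on the closed interval, so that the
    end slopes [dphi s] and [dphi e] are ordinary derivatives. *)
Definition pos_eig (a : R -> R) (s e lam : R) (phi dphi ddphi : R -> R) : Prop :=
  C2 phi dphi ddphi /\ phi s = 0 /\ phi e = 0 /\ (forall t, s < t < e -> 0 < phi t) /\
  (forall t, s <= t <= e -> ddphi t = - (lam * a t * phi t)).

Definition weight (a : R -> R) (s e : R) : Prop :=
  s < e /\ (forall t, continuous a t) /\ (forall t, s <= t <= e -> 0 <= a t) /\
  (exists t, s <= t <= e /\ a t <> 0).

Lemma weight_interior (a : R -> R) (s e : R) : weight a s e -> exists t, s < t < e /\ 0 < a t.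
Proof.
intros [Hse [Hc [Hp [t0 [Ht Hne]]]]].
assert (H0 : 0 < a t0) by (pose proof (Hp t0 Ht); lra).
destruct (continuous_pos_near a t0 (Hc t0) H0) as [d [Hd Hy]].
destruct (Rle_lt_dec t0 ((s + e) / 2)).
- exists (Rmin (t0 + d / 2) ((t0 + e) / 2)).
  assert (t0 < Rmin (t0 + d / 2) ((t0 + e) / 2)) by (apply Rmin_glb_lt; lra).
  pose proof (Rmin_l (t0 + d / 2) ((t0 + e) / 2)); pose proof (Rmin_r (t0 + d / 2) ((t0 + e) / 2)).
  split; [lra|apply Hy, Rabs_def1; lra].
- exists (Rmax (t0 - d / 2) ((t0 + s) / 2)).
  assert (Rmax (t0 - d / 2) ((t0 + s) / 2) < t0) by (apply Rmax_lub_lt; lra).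
  pose proof (Rmax_l (t0 - d / 2) ((t0 + s) / 2)); pose proof (Rmax_r (t0 - d / 2) ((t0 + s) / 2)).
  split; [lra|apply Hy, Rabs_def1; lra].
Qed.

Lemma weight_integral_pos (a f : R -> R) (s e : R) : weight a s e -> (forall t, continuous f t) ->
  (forall t, s < t < e -> 0 < f t) -> 0 < RInt (fun t => a t * f t) s e.
Proof.
intros Hw Hf Hp; destruct (weight_interior a s e Hw) as [t0 [Ht0 Ha]].
destruct Hw as [Hse [Hc [Hn _]]].
apply RInt_pos with t0; try lra.
- cont_auto.
- intros t Ht; apply Rmult_le_pos; [apply Hn; lra|apply Rlt_le, Hp; lra].
- apply Rmult_lt_0_compat; [exact Ha|apply Hp, Ht0].
Qed.

Lemma bump_pos s e t : s < t < e -> 0 < bump s e t.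
Proof.
intros H; unfold bump; apply Rdiv_lt_0_compat; [apply Rmult_lt_0_compat|apply pow_lt]; lra.
Qed.

(** * Estimates by pairing with a positive eigenfunction *)

Section WeightedEstimates.
Variables (a : R -> R) (s e lam : R) (phi dphi ddphi : R -> R).
Hypotheses (Hw : weight a s e) (Hphi : pos_eig a s e lam phi dphi ddphi).

Let c := (s + e) / 2.
Let W : R := RInt (fun t => a t * phi t) s e.
Let Wb : R := RInt (fun t => a t * (phi t * bump s e t)) s e.

Lemma eig_cont : (forall t, continuous a t) /\ (forall t, continuous phi t).
Proof. split; [apply Hw|apply (C2_cont phi dphi ddphi), Hphi]. Qed.

Lemma W_pos : 0 < W.
Proof. apply weight_integral_pos; [exact Hw|apply eig_cont|apply Hphi]. Qed.

Lemma Wb_pos : 0 < Wb.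
Proof.
apply weight_integral_pos; [exact Hw| |].
- destruct eig_cont; cont_auto.
- intros t Ht; apply Rmult_lt_0_compat; [now apply Hphi|now apply bump_pos].
Qed.

Lemma eig_ends : 0 <= dphi s /\ dphi e <= 0.
Proof.
destruct Hphi as [HC [H1 [H2 [H3 _]]]]; destruct (C2_cont _ _ _ HC) as [_ [Hd _]].
split.
- apply derive_start_nonneg with phi e; auto; [apply HC|apply Hw|intros; now apply Rlt_le, H3].
- apply derive_end_nonpos with phi s; auto; [apply HC|apply Hw|intros; now apply Rlt_le, H3].
Qed.

Lemma aphi_nonneg t : s < t < e -> 0 <= a t * phi t.
Proof.
intros Ht; apply Rmult_le_pos; [apply Hw; lra|now apply Rlt_le, Hphi].
Qed.

(** Lagrange's identity with [phi], which vanishes at both ends. By [eig_ends] the coefficients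
    [dphi s] and [- dphi e] of the end values of [v] are nonnegative. *)
Lemma pairing (v dv ddv : R -> R) : C2 v dv ddv ->
  (forall t, continuous (fun t => ddv t * phi t + lam * v t * (a t * phi t)) t) /\
  (RInt (fun t => ddv t * phi t + lam * v t * (a t * phi t)) s e : R) = dphi s * v s - dphi e * v e.
Proof.
intros Hv; destruct (C2_cont _ _ _ Hv) as [V0 [_ V2]]; destruct eig_cont as [Ca Cp]; split; [cont_auto|].
apply eq_trans with (RInt (fun t => ddv t * phi t - ddphi t * v t) s e : R).
- apply RInt_ext; intros t; rewrite Rmin_left, Rmax_right by apply Rlt_le, Hw; intros Ht.
  destruct Hphi as [_ [_ [_ [_ Hdd]]]]; rewrite (Hdd t) by lra; apply Rminus_diag_uniq; ring.
- rewrite (wronskian _ _ _ _ _ _ s e Hv (proj1 Hphi)).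
  destruct Hphi as [_ [-> [-> _]]]; ring.
Qed.

Lemma pairing_nonneg (v dv ddv f : R -> R) : C2 v dv ddv -> 0 <= v s -> 0 <= v e ->
  (forall t, continuous f t) ->
  (forall t, s < t < e -> ddv t * phi t + lam * v t * (a t * phi t) <= f t) -> 0 <= RInt f s e.
Proof.
intros Hv Hs He Cf Hf; destruct eig_ends as [E1 E2].
assert (P1 : 0 <= dphi s * v s) by (apply Rmult_le_pos; lra).
assert (P2 : 0 <= - dphi e * v e) by (apply Rmult_le_pos; lra).
destruct (pairing v dv ddv Hv) as [Cp Ep].
apply Rle_trans with (dphi s * v s - dphi e * v e); [lra|rewrite <- Ep].
apply RInt_le; [apply Rlt_le, Hw|apply ex_RInt_cont, Cp|now apply ex_RInt_cont|exact Hf].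
Qed.

Lemma pairing_small (v dv ddv f : R -> R) (eps : R) : C2 v dv ddv -> v s <= eps -> v e <= eps ->
  (forall t, continuous f t) ->
  (forall t, s < t < e -> f t <= ddv t * phi t + lam * v t * (a t * phi t)) ->
  RInt f s e <= eps * (dphi s - dphi e).
Proof.
intros Hv Hs He Cf Hf; destruct eig_ends as [E1 E2].
assert (P1 : dphi s * v s <= dphi s * eps) by (apply Rmult_le_compat_l; lra).
assert (P2 : - dphi e * v e <= - dphi e * eps) by (apply Rmult_le_compat_l; lra).
destruct (pairing v dv ddv Hv) as [Cp Ep].
apply Rle_trans with (dphi s * v s - dphi e * v e); [rewrite <- Ep|lra].
apply RInt_le; [apply Rlt_le, Hw|now apply ex_RInt_cont|apply ex_RInt_cont, Cp|exact Hf].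
Qed.

Lemma RInt_scal_cont (k : R) (f : R -> R) : (forall t, continuous f t) ->
  (RInt (fun t => k * f t) s e : R) = k * RInt f s e.
Proof. intros Hf; apply (RInt_scal (V := R_CompleteNormedModule)), ex_RInt_cont, Hf. Qed.

Lemma RInt_minus_cont (f g : R -> R) : (forall t, continuous f t) -> (forall t, continuous g t) ->
  (RInt (fun t => f t - g t) s e : R) = RInt f s e - RInt g s e.
Proof. intros Hf Hg; apply (RInt_minus (V := R_CompleteNormedModule)); apply ex_RInt_cont; auto. Qed.

(** Pairing bounds [lam' - lam] times the integral of [a * v * phi] by [K0 * W]; then
    [v c * bump <= v] extracts [v c] from the integral. *)
Lemma superlinear_bound (lam' K0 : R) (v dv ddv : R -> R) : lam < lam' -> C2 v dv ddv ->
  0 <= v s -> 0 <= v e -> (forall t, s < t < e -> ddv t <= 0) ->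
  (forall t, s < t < e -> ddv t <= - (a t * (lam' * v t - K0))) ->
  v c <= K0 * W / ((lam' - lam) * Wb).
Proof.
intros Hl Hv Hs He Hcv Hd; destruct eig_cont as [Ca Cp]; pose proof Wb_pos as Wbp.
assert (M : 0 <= RInt (fun t => K0 * (a t * phi t) - (lam' - lam) * v c * (a t * (phi t * bump s e t))) s e).
{ apply (pairing_nonneg v dv ddv); auto; [cont_auto|]; intros t Ht.
  destruct (concave_midpoint v dv ddv s e Hv (proj1 Hw) Hcv Hs He t) as [_ [B _]]; [lra|]; fold c in B.
  pose proof (aphi_nonneg t Ht) as A; pose proof (Hd t Ht) as D.
  apply (Rmult_le_compat_r (phi t)) in D; [|now apply Rlt_le, Hphi].
  apply (Rmult_le_compat_l (a t * phi t)) in B; [|exact A].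
  apply (Rmult_le_compat_l (lam' - lam)) in B; [|lra].
  lra. }
rewrite (RInt_minus_cont (fun t => K0 * (a t * phi t)) (fun t => (lam' - lam) * v c * (a t * (phi t * bump s e t)))) in M by cont_auto.
rewrite !RInt_scal_cont in M by cont_auto; fold W Wb in M.
assert (0 < (lam' - lam) * Wb) by (apply Rmult_lt_0_compat; lra).
apply Rle_div_r; [lra|]; lra.
Qed.

(** Below the eigenvalue the pairing bounds the weighted integral of [v] by the boundary terms, so
    small end values force a small midpoint value. *)
Lemma sublinear_bound (lam' eps : R) (v dv ddv : R -> R) : lam' < lam -> C2 v dv ddv ->
  0 <= v s <= eps -> 0 <= v e <= eps -> (forall t, s < t < e -> ddv t <= 0) ->
  (forall t, s < t < e -> - (lam' * a t * v t) <= ddv t) ->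
  v c <= eps * ((dphi s - dphi e) / ((lam - lam') * Wb)).
Proof.
intros Hl Hv Hs He Hcv Hd; destruct eig_cont as [Ca Cp]; pose proof Wb_pos as Wbp.
assert (M : RInt (fun t => (lam - lam') * v c * (a t * (phi t * bump s e t))) s e <= eps * (dphi s - dphi e)).
{ apply (pairing_small v dv ddv); auto; [apply Hs|apply He|cont_auto|]; intros t Ht.
  destruct (concave_midpoint v dv ddv s e Hv (proj1 Hw) Hcv (proj1 Hs) (proj1 He) t) as [_ [B _]]; [lra|]; fold c in B.
  pose proof (aphi_nonneg t Ht) as A; pose proof (Hd t Ht) as D.
  apply (Rmult_le_compat_r (phi t)) in D; [|now apply Rlt_le, Hphi].
  apply (Rmult_le_compat_l (a t * phi t)) in B; [|exact A].
  apply (Rmult_le_compat_l (lam - lam')) in B; [|lra].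
  lra. }
rewrite RInt_scal_cont in M by cont_auto; fold Wb in M.
assert (0 < (lam - lam') * Wb) by (apply Rmult_lt_0_compat; lra).
unfold Rdiv; rewrite <- Rmult_assoc; apply Rle_div_r; [lra|]; lra.
Qed.

(** Pairing bounds [M * W] by [lam] times the integral of [a * v * phi], and [v <= 2 * v c] bounds
    that by [2 * lam * v c * W]. *)
Lemma forced_bound (M : R) (v dv ddv : R -> R) : 0 < lam -> C2 v dv ddv ->
  0 <= v s -> 0 <= v e -> (forall t, s < t < e -> ddv t <= 0) ->
  (forall t, s < t < e -> ddv t <= - (M * a t)) -> M <= 2 * lam * v c.
Proof.
intros Hl Hv Hs He Hcv Hd; destruct eig_cont as [Ca Cp]; pose proof W_pos as Wp.
assert (B : 0 <= RInt (fun t => (2 * lam * v c - M) * (a t * phi t)) s e).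
{ apply (pairing_nonneg v dv ddv); auto; [cont_auto|]; intros t Ht.
  destruct (concave_midpoint v dv ddv s e Hv (proj1 Hw) Hcv Hs He t) as [_ [_ B]]; [lra|]; fold c in B.
  pose proof (aphi_nonneg t Ht) as A; pose proof (Hd t Ht) as D.
  apply (Rmult_le_compat_r (phi t)) in D; [|now apply Rlt_le, Hphi].
  apply (Rmult_le_compat_l (a t * phi t)) in B; [|exact A].
  apply (Rmult_le_compat_l lam) in B; [|lra].
  lra. }
rewrite RInt_scal_cont in B by cont_auto; fold W in B; nra.
Qed.
End WeightedEstimates.

Lemma C2_scal (k : R) (u du ddu : R -> R) : C2 u du ddu ->
  C2 (fun t => k * u t) (fun t => k * du t) (fun t => k * ddu t).
Proof.
intros [H1 [H2 H3]]; split; [|split]; intros t.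
- apply (is_derive_scal u), H1.
- apply (is_derive_scal du), H2.
- apply cont_mult; [apply cont_const|exact H3].
Qed.

(** If [mu < lam], the boundary terms of Lagrange's identity make the integral of
    [(lam - mu) * a * u * w] at most 0. It is positive as soon as [ddu] is nonzero somewhere inside;
    otherwise [u] is affine with zero end values. *)
Lemma sturm_comparison (a w dw ddw u du ddu : R -> R) (x y lam mu : R) : x < y ->
  (forall t, x < t < y -> 0 <= a t) ->
  C2 w dw ddw -> (forall t, x <= t <= y -> 0 <= w t) -> (forall t, x < t < y -> 0 < w t) ->
  (forall t, x < t < y -> ddw t = - (lam * a t * w t)) ->
  C2 u du ddu -> u x = 0 -> u y = 0 -> (forall t, x < t < y -> 0 < u t) ->
  (forall t, x < t < y -> ddu t = - (mu * a t * u t)) -> lam <= mu.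
Proof.
intros Hxy Ha Hw W0 Wp Ew Hu ux uy Up Eu; apply Rnot_lt_le; intros Hl.
assert (I1 := wronskian _ _ _ _ _ _ x y Hw Hu).
destruct (C2_cont _ _ _ Hw) as [cw [cdw cddw]]; destruct (C2_cont _ _ _ Hu) as [cu [cdu cddu]].
assert (D1 : 0 <= du x).
{ apply derive_start_nonneg with u y; auto; [apply Hu|intros; now apply Rlt_le, Up]. }
assert (D2 : du y <= 0).
{ apply derive_end_nonpos with u x; auto; [apply Hu|intros; now apply Rlt_le, Up]. }
assert (P1 : 0 <= du x * w x) by (apply Rmult_le_pos; [lra|apply W0; lra]).
assert (P2 : 0 <= - du y * w y) by (apply Rmult_le_pos; [lra|apply W0; lra]).
rewrite ux, uy in I1.
destruct (classic (exists t, x < t < y /\ ddu t <> 0)) as [[t [Ht Hne]]|Hall].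
- assert (at0 : 0 < a t).
  { destruct (Ha t Ht) as [H|H]; [exact H|exfalso; apply Hne; rewrite Eu, <- H by lra; ring]. }
  assert (0 < RInt (fun t => - (ddw t * u t - ddu t * w t)) x y).
  { apply RInt_pos with t; try lra.
    - intros z; apply (continuous_opp (V := R_NormedModule)).
      apply (cont_minus (fun t => ddw t * u t) (fun t => ddu t * w t)); cont_auto.
    - intros z Hz; rewrite Eu, Ew by lra.
      replace (- _) with ((lam - mu) * (a z * (u z * w z))) by ring.
      apply Rmult_le_pos; [lra|]; apply Rmult_le_pos; [now apply Ha|].
      apply Rmult_le_pos; apply Rlt_le; auto.
    - rewrite Eu, Ew by lra.
      replace (- _) with ((lam - mu) * (a t * (u t * w t))) by ring.
      apply Rmult_lt_0_compat; [lra|]; apply Rmult_lt_0_compat; [exact at0|].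
      apply Rmult_lt_0_compat; auto. }
  rewrite (RInt_opp (V := R_CompleteNormedModule)) in H.
  2: apply ex_RInt_cont; cont_auto.
  rewrite I1 in H; unfold opp in H; simpl in H; lra.
- set (m := (x + y) / 2).
  assert (Hn : forall t, x < t < y -> ddu t = 0).
  { intros t Ht; apply NNPP; intros H; apply Hall; now exists t. }
  assert (Hum : 0 < u m) by (apply Up; unfold m; lra).
  pose proof (concave_chord _ _ _ x y x m y (C2_scal (-1) _ _ _ Hu)) as H.
  assert (HH : forall t, x < t < y -> -1 * ddu t <= 0) by (intros t Ht; rewrite Hn by lra; lra).
  specialize (H HH ltac:(lra) ltac:(unfold m; lra) ltac:(unfold m; lra) ltac:(lra)); simpl in H.
  rewrite ux, uy in H; nra.
Qed.

(** * Clamped functions; bounded and uniformly continuous families *)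

Lemma clamp_cont a b t : continuous (clamp a b) t.
Proof.
apply continuous_eps; intros eps He; exists eps; split; [exact He|]; intros y Hy.
eapply Rle_lt_trans; [apply clamp_lip|exact Hy].
Qed.

Lemma cont_Rmax (f g : R -> R) : (forall t, continuous f t) -> (forall t, continuous g t) ->
  forall t, continuous (fun x => Rmax (f x) (g x)) t.
Proof.
intros Hf Hg t; apply continuous_eps; intros eps He.
destruct (proj1 (continuous_eps _ t) (Hf t) eps He) as [d1 [D1 H1]].
destruct (proj1 (continuous_eps _ t) (Hg t) eps He) as [d2 [D2 H2]].
exists (Rmin d1 d2); split; [apply Rmin_glb_lt; lra|]; intros y Hy.
pose proof (Rmin_l d1 d2); pose proof (Rmin_r d1 d2).
specialize (H1 y ltac:(lra)); specialize (H2 y ltac:(lra)).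
apply Rabs_def2 in H1; apply Rabs_def2 in H2; apply Rabs_def1;
  unfold Rmax; destruct (Rle_dec _ _), (Rle_dec _ _); lra.
Qed.

Lemma cont_on_clamp (f : R -> R) (a b : R) : a <= b -> cont_on_R (fun t => a <= t <= b) f ->
  forall t, continuous (fun x => f (clamp a b x)) t.
Proof.
intros Hab Hf t; apply continuous_eps; intros eps He.
destruct (Hf (clamp a b t) (clamp_in a b t Hab) eps He) as [d [Hd H]].
exists d; split; [exact Hd|]; intros y Hy; apply H; [now apply clamp_in|].
eapply Rle_lt_trans; [apply clamp_lip|exact Hy].
Qed.

Lemma clamped_bdd (f : R -> R) (a b : R) : a <= b -> (forall t, continuous (fun x => f (clamp a b x)) t) ->
  exists K, 0 <= K /\ forall t, Rabs (f (clamp a b t)) <= K.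
Proof.
intros Hab Hc.
destruct (continuity_ab_maj (fun x => Rabs (f (clamp a b x))) a b Hab) as [M [HM _]].
- intros x _; apply continuity_pt_filterlim.
  apply (continuous_comp (fun x => f (clamp a b x)) Rabs); [apply Hc|apply continuous_Rabs].
- exists (Rabs (f (clamp a b M))); split; [apply Rabs_pos|]; intros t.
  pose proof (HM (clamp a b t) (clamp_in a b t Hab)) as H; simpl in H.
  rewrite (clamp_id a b (clamp a b t)) in H; [exact H|now apply clamp_in].
Qed.

Lemma clamped_uc (f : R -> R) (a b : R) : a <= b -> (forall t, continuous (fun x => f (clamp a b x)) t) ->
  forall eps, 0 < eps -> exists delta, 0 < delta /\ forall x y, Rabs (x - y) <= delta ->
    Rabs (f (clamp a b x) - f (clamp a b y)) <= eps.
Proof.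
intros Hab Hc eps He.
destruct (Heine_cor2 (f := fun x => f (clamp a b x)) (a := a) (b := b)) with (eps := mkposreal eps He)
  as [[d Hd] H].
- intros x _; apply continuity_pt_filterlim, Hc.
- exists (d / 2); split; [lra|]; intros x y Hxy.
  pose proof (H (clamp a b x) (clamp a b y) (clamp_in a b x Hab) (clamp_in a b y Hab)) as H1.
  simpl in H1; rewrite !(clamp_id a b (clamp a b _)) in H1 by (now apply clamp_in).
  apply Rlt_le, H1; eapply Rle_lt_trans; [apply clamp_lip|lra].
Qed.

(** Complementarity: the increment [y] vanishes unless [x] is at the end towards which [y] points.
    Every scalar unknown below is introduced by an equation of this form. *)
Lemma clamp_fixed lo hi x y : lo <= hi -> x = clamp lo hi (x + y) ->
  lo <= x <= hi /\ (y = 0 \/ (0 < y /\ x = hi) \/ (y < 0 /\ x = lo)).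
Proof.
intros H E; assert (Hx : lo <= x <= hi) by (rewrite E; now apply clamp_in).
split; [exact Hx|].
destruct (Rtotal_order y 0) as [h|[h|h]]; [right; right|now left|right; left]; split; try exact h.
- revert E; unfold clamp, Rmax, Rmin; destruct (Rle_dec hi _), (Rle_dec lo _); lra.
- revert E; unfold clamp, Rmax, Rmin; destruct (Rle_dec hi _), (Rle_dec lo _); lra.
Qed.

Section Fam.
Context {T : Type}.
Implicit Types F G : fam T.

Lemma uc_par d i : (i < d)%nat -> fam_uc d (fun par _ (_ : T) => par i).
Proof. intros Hi eps He; exists eps; split; [exact He|]; intros; auto. Qed.

Lemma ok_fun d (f : T -> R) K : (forall t, Rabs (f t) <= K) -> fam_ok d (fun _ _ t => f t).
Proof.
intros H; split.
- exists (Rabs K); split; [apply Rabs_pos|]; intros _ _ t; eapply Rle_trans; [apply H|apply Rle_abs].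
- intros eps He; exists 1; split; [lra|]; intros; rewrite Rminus_diag, Rabs_R0; lra.
Qed.

Lemma ok_comp d F (h : T -> R -> R) K : fam_uc d F -> (forall t x, Rabs (h t x) <= K) ->
  (forall eps, 0 < eps -> exists delta, 0 < delta /\
     forall t x y, Rabs (x - y) <= delta -> Rabs (h t x - h t y) <= eps) ->
  fam_ok d (fun par v t => h t (F par v t)).
Proof.
intros HF HK Hh; split.
- exists (Rabs K); split; [apply Rabs_pos|]; intros; eapply Rle_trans; [apply HK|apply Rle_abs].
- intros eps He; destruct (Hh eps He) as [e1 [E1 H1]]; destruct (HF e1 E1) as [d1 [D1 H2]].
  exists d1; split; [exact D1|]; intros; apply H1; auto.
Qed.

Lemma ok_lip d F (h : T -> R -> R) K : fam_uc d F -> (forall t x, Rabs (h t x) <= K) ->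
  (forall t x y, Rabs (h t x - h t y) <= Rabs (x - y)) -> fam_ok d (fun par v t => h t (F par v t)).
Proof.
intros HF HK Hh; apply (ok_comp d F h K HF HK); intros eps He; exists eps; split; [exact He|].
intros t x y H; eapply Rle_trans; [apply Hh|exact H].
Qed.

Lemma ok_plus d F G : fam_ok d F -> fam_ok d G -> fam_ok d (fun par v t => F par v t + G par v t).
Proof.
intros [[K1 [P1 B1]] HF] [[K2 [P2 B2]] HG]; split.
- exists (K1 + K2); split; [lra|]; intros.
  eapply Rle_trans; [apply Rabs_triang|]; specialize (B1 par v t); specialize (B2 par v t); lra.
- intros eps He.
  destruct (HF (eps / 2)) as [d1 [D1 H1]]; [lra|]; destruct (HG (eps / 2)) as [d2 [D2 H2]]; [lra|].
  exists (Rmin d1 d2); split; [apply Rmin_glb_lt; lra|].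
  pose proof (Rmin_l d1 d2) as M1; pose proof (Rmin_r d1 d2) as M2; intros par par' v v' Hp Hv t.
  assert (A : Rabs (F par v t - F par' v' t) <= eps / 2).
  { apply H1; [intros i Hi; specialize (Hp i Hi)|intros z; specialize (Hv z)]; lra. }
  assert (B : Rabs (G par v t - G par' v' t) <= eps / 2).
  { apply H2; [intros i Hi; specialize (Hp i Hi)|intros z; specialize (Hv z)]; lra. }
  apply Rabs_le_between in A; apply Rabs_le_between in B; apply Rabs_le; lra.
Qed.

Lemma ok_mult d F G : fam_ok d F -> fam_ok d G -> fam_ok d (fun par v t => F par v t * G par v t).
Proof.
intros [[K1 [P1 B1]] HF] [[K2 [P2 B2]] HG]; split.
- exists (K1 * K2); split; [now apply Rmult_le_pos|]; intros.
  rewrite Rabs_mult; apply Rmult_le_compat; auto using Rabs_pos.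
- intros eps He.
  set (e := eps / (K1 + K2 + 1)).
  assert (E : 0 < e) by (apply Rdiv_lt_0_compat; lra).
  assert (Ee : e * (K1 + K2 + 1) = eps) by (unfold e; field; lra).
  destruct (HF e E) as [d1 [D1 H1]]; destruct (HG e E) as [d2 [D2 H2]].
  exists (Rmin d1 d2); split; [apply Rmin_glb_lt; lra|].
  pose proof (Rmin_l d1 d2) as M1; pose proof (Rmin_r d1 d2) as M2; intros par par' v v' Hp Hv t.
  assert (A : Rabs (F par v t - F par' v' t) <= e).
  { apply H1; [intros i Hi; specialize (Hp i Hi)|intros z; specialize (Hv z)]; lra. }
  assert (B : Rabs (G par v t - G par' v' t) <= e).
  { apply H2; [intros i Hi; specialize (Hp i Hi)|intros z; specialize (Hv z)]; lra. }
  replace (_ - _) with (F par v t * (G par v t - G par' v' t) + (F par v t - F par' v' t) * G par' v' t) by ring.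
  eapply Rle_trans; [apply Rabs_triang|]; rewrite !Rabs_mult.
  assert (Rabs (F par v t) * Rabs (G par v t - G par' v' t) <= K1 * e)
    by (apply Rmult_le_compat; auto using Rabs_pos).
  assert (Rabs (F par v t - F par' v' t) * Rabs (G par' v' t) <= e * K2)
    by (apply Rmult_le_compat; auto using Rabs_pos).
  nra.
Qed.
End Fam.

Lemma uc_eval d : fam_uc d (fun _ v (t : R) => v t).
Proof. intros eps He; exists eps; split; [exact He|]; intros; auto. Qed.

Lemma clamp_bdd lo hi x : lo <= hi -> Rabs (clamp lo hi x) <= Rabs lo + Rabs hi.
Proof.
intros H; pose proof (clamp_in lo hi x H).
unfold Rabs; repeat destruct (Rcase_abs _); lra.
Qed.

Lemma bump_C2 s e : s < e ->
  C2 (bump s e) (fun t => (s + e - 2 * t) / (e - s) ^ 2) (fun _ => - 2 / (e - s) ^ 2) /\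
  bump s e s = 0 /\ bump s e e = 0.
Proof.
intros H; split; [split; [|split]|split].
- intros t; unfold bump; auto_derive; [exact I|field; lra].
- intros t; auto_derive; [exact I|field; lra].
- intros t; apply continuous_const.
- unfold bump; field; lra.
- unfold bump; field; lra.
Qed.

(** The eigenvalue is itself a scalar unknown, driven by [1 - v c]. If it sat at 0 with [v c > 1],
    the solution would vanish; if it sat at [M] with [v c < 1], pairing with [bump] would give
    [v c > 1]. So [v c = 1]. *)
Lemma pos_eig_exists (a : R -> R) (s e : R) : weight a s e ->
  exists lam phi dphi ddphi, 0 < lam /\ pos_eig a s e lam phi dphi ddphi.
Proof.
intros Hw; assert (Hw' := Hw); destruct Hw' as [Hse [Ca [Pa _]]].
set (c := (s + e) / 2).
set (B := RInt (fun t => a t * (bump s e t * bump s e t)) s e : R).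
assert (HB : 0 < B).
{ apply weight_integral_pos; [exact Hw|cont_auto|].
  intros t Ht; apply Rmult_lt_0_compat; now apply bump_pos. }
(* As [- bump'' = 2 / (e - s) ^ 2] and [v <= 2 * v c], the integral of [- bump'' * v] is at most
   [4 * v c / (e - s)]; for [v c < 1] this has to be less than [M * B]. *)
set (M := 4 / ((e - s) * B) + 1).
assert (HM : 0 < 4 / ((e - s) * B)) by (apply Rdiv_lt_0_compat; [lra|apply Rmult_lt_0_compat; lra]).
assert (Cac : forall t, continuous (fun x => a (clamp s e x)) t).
{ intros t; apply (continuous_comp (clamp s e) a); [apply clamp_cont|apply Ca]. }
destruct (clamped_bdd a s e (Rlt_le _ _ Hse) Cac) as [Ka [_ HKa]].
(* [tr] truncates between [bump] and [2], the a priori bounds of a concave function equal to [1] at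
   the midpoint; the fixed-point equation for [mu] forces that normalisation. *)
set (tr := fun t x => clamp 0 2 (Rmax (bump s e (clamp s e t)) x)).
set (Ps := (fun par v t => a (clamp s e t) * (clamp 0 M (par 0%nat) * tr t (v t))) : fam R).
set (Th := (fun par v _ => clamp 0 M ((par 0%nat + 1) + - v c)) : fam nat).
assert (bb : forall t, 0 <= bump s e (clamp s e t) <= 1).
{ intros t; pose proof (clamp_in s e t (Rlt_le _ _ Hse)) as Ht.
  destruct (bump_bounds s e _ Hse Ht) as [[H1 H2] _]; split; [exact H1|].
  eapply Rle_trans; [exact H2|]; apply Rle_div_l; lra. }
assert (trB : forall t x, 0 <= tr t x <= 2).
{ intros t x; apply clamp_in; lra. }
assert (trL : forall t x y, Rabs (tr t x - tr t y) <= Rabs (x - y)).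
{ intros t x y; eapply Rle_trans; [apply clamp_lip|].
  unfold Rmax, Rabs; destruct (Rle_dec _ x), (Rle_dec _ y); repeat destruct (Rcase_abs _); lra. }
assert (Okmu : fam_ok 1 ((fun par _ _ => clamp 0 M (par 0%nat)) : fam R)).
{ apply (ok_lip 1 (fun par _ _ => par 0%nat) (fun _ => clamp 0 M) (Rabs 0 + Rabs M)).
  - apply uc_par; lia.
  - intros _ x; apply clamp_bdd; unfold M; lra.
  - intros; apply clamp_lip. }
assert (Oktr : fam_ok 1 ((fun _ v t => tr t (v t)) : fam R)).
{ apply (ok_lip 1 (fun _ v t => v t) tr 2); [apply uc_eval| |exact trL].
  intros t x; apply Rabs_le; specialize (trB t x); lra. }
assert (CPs0 : forall par v, (forall t, continuous v t) -> forall t, continuous (Ps par v) t).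
{ intros par v Hv; unfold Ps; apply cont_mult; [exact Cac|].
  apply cont_mult; [apply cont_const|]; intros t.
  apply (continuous_comp (fun t => Rmax (bump s e (clamp s e t)) (v t)) (clamp 0 2)); [|apply clamp_cont].
  apply cont_Rmax; [|exact Hv]; intros z.
  apply (continuous_comp (clamp s e) (bump s e)); [apply clamp_cont|apply bump_cont]. }
destruct (bvp s e 1 Th Ps Hse) as [par [v [Cv [Ev Ep]]]].
- apply (ok_lip 1 (fun par v _ => par 0%nat + 1 + - v c) (fun _ => clamp 0 M) (Rabs 0 + Rabs M)).
  + intros eps He; exists (eps / 2); split; [lra|]; intros par par' v v' Hp Hv _.
    specialize (Hp 0%nat ltac:(lia)); specialize (Hv c).
    apply Rabs_le_between in Hp; apply Rabs_le_between in Hv; apply Rabs_le; lra.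
  + intros _ x; apply clamp_bdd; unfold M; lra.
  + intros; apply clamp_lip.
- exact (ok_mult 1 _ _ (ok_fun 1 (fun t => a (clamp s e t)) Ka HKa) (ok_mult 1 _ _ Okmu Oktr)).
- exact CPs0.
- set (mu := par 0%nat) in *.
  destruct (clamp_fixed 0 M mu (1 - v c)) as [Hmu cases].
  { unfold M; lra. }
  { specialize (Ep 0%nat ltac:(lia)); unfold Th in Ep; fold mu in Ep; rewrite <- Ep at 1; f_equal; ring. }
  assert (CPs : forall t, continuous (Ps par v) t).
  { now apply CPs0. }
  destruct (green_C2 s e (Ps par v) Hse CPs) as [HC [Gs Ge]].
  set (V := green s e (Ps par v)) in *; set (dV := dgreen s e (Ps par v)) in *.
  set (ddV := fun t => - Ps par v t) in *.
  assert (EV : forall t, s <= t <= e -> v t = V t).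
  { intros t Ht; rewrite Ev, clamp_id by exact Ht; reflexivity. }
  assert (PsE : forall t, s <= t <= e -> Ps par v t = a t * (mu * tr t (V t))).
  { intros t Ht; unfold Ps; fold mu; rewrite !clamp_id, EV by lra; reflexivity. }
  assert (conc : forall t, s < t < e -> ddV t <= 0).
  { intros t Ht; unfold ddV; rewrite PsE by lra.
    assert (0 <= a t * (mu * tr t (V t))); [|lra].
    apply Rmult_le_pos; [apply Pa; lra|apply Rmult_le_pos; [lra|apply trB]]. }
  assert (mid := concave_midpoint V dV ddV s e HC Hse conc ltac:(lra) ltac:(lra)).
  assert (Hc : s < c < e) by (unfold c; lra); fold c in mid; rewrite EV in cases by lra.
  assert (mu0 : mu = 0 -> V c = 0).
  { intros E0; destruct (C2_bounds V dV ddV s e 0 HC Hse Gs Ge) as [_ D].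
    - intros t Ht; unfold ddV; rewrite PsE, E0 by lra.
      rewrite Rmult_0_l, Rmult_0_r, Ropp_0, Rabs_R0; lra.
    - specialize (D c ltac:(lra)); rewrite !Rmult_0_l in D.
      apply Rabs_le_between in D; lra. }
  assert (Vc : V c = 1).
  { destruct cases as [H|[[H E]|[H E]]]; [lra| |specialize (mu0 E); lra].
    exfalso; destruct (bump_C2 s e Hse) as [Hb [bs be]].
    assert (I1 := wronskian _ _ _ _ _ _ s e HC Hb).
    rewrite bs, be, Gs, Ge in I1.
    destruct (C2_cont _ _ _ HC) as [c0 [_ c2]].
    assert (LE : RInt (fun t => ddV t * bump s e t - - 2 / (e - s) ^ 2 * V t) s e <=
      RInt (fun t => 4 / (e - s) ^ 2 * V c - M * (a t * (bump s e t * bump s e t))) s e).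
    { apply RInt_le.
      - lra.
      - apply ex_RInt_cont; cont_auto.
      - apply ex_RInt_cont; cont_auto.
      - intros t Ht; destruct (mid t) as [m1 [m2 m3]]; [lra|].
        unfold ddV; rewrite PsE, E by lra.
        assert (Bt := bump_pos s e t Ht).
        assert (T1 : bump s e t <= tr t (V t)).
        { pose proof (bb t) as b1; rewrite clamp_id in b1 by lra; unfold tr; rewrite (clamp_id s e t) by lra.
          pose proof (Rmax_l (bump s e t) (V t)); unfold clamp.
          eapply Rle_trans; [|apply Rmax_r]; apply Rmin_glb; lra. }
        assert (T2 : (a t * M * bump s e t) * bump s e t <= (a t * M * bump s e t) * tr t (V t)).
        { apply Rmult_le_compat_l; [|exact T1].
          apply Rmult_le_pos; [apply Rmult_le_pos; [apply Pa|unfold M]|]; lra. }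
        assert (T3 : 2 / (e - s) ^ 2 * V t <= 2 / (e - s) ^ 2 * (2 * V c)).
        { apply Rmult_le_compat_l; [apply Rdiv_le_0_compat; [lra|apply pow_lt; lra]|lra]. }
        replace (- 2 / (e - s) ^ 2) with (- (2 / (e - s) ^ 2)) by (field; lra).
        replace (4 / (e - s) ^ 2) with (2 * (2 / (e - s) ^ 2)) by (field; lra).
        lra. }
    rewrite I1 in LE.
    rewrite (RInt_minus_cont s e (fun t => 4 / (e - s) ^ 2 * V c)) in LE.
    2, 3: cont_auto.
    rewrite (RInt_scal_cont s e M) in LE by cont_auto.
    fold B in LE; rewrite (RInt_const (V := R_CompleteNormedModule)) in LE.
    unfold scal in LE; simpl in LE; unfold mult in LE; simpl in LE.
    replace ((e - s) * (4 / ((e - s) * ((e - s) * 1)) * V c)) with (4 / (e - s) * V c) in LE by (field; lra).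
    assert (MB : M * B = 4 / (e - s) + B) by (unfold M; field; lra).
    assert (0 < 4 / (e - s)) by (apply Rdiv_lt_0_compat; lra).
    nra. }
  exists mu, V, dV, ddV; split.
  + destruct (proj1 Hmu) as [H|H]; [exact H|symmetry in H; specialize (mu0 H); lra].
  + split; [exact HC|split; [exact Gs|split; [exact Ge|split]]].
    * intros t Ht; destruct (mid t) as [_ [m2 _]]; [lra|].
      pose proof (bump_pos s e t Ht); rewrite Vc in m2; lra.
    * intros t Ht; unfold ddV; rewrite PsE by exact Ht.
      destruct (mid t Ht) as [_ [m2 m3]]; rewrite Vc in m2, m3.
      replace (tr t (V t)) with (V t); [ring|].
      unfold tr; rewrite (clamp_id s e t) by exact Ht.
      rewrite Rmax_right, clamp_id by (destruct (mid t Ht); lra); reflexivity.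
Qed.

(** [dirichlet_eig] provides derivatives only inside the interval. The Green solution with the same
    second derivative is regular everywhere; its difference from [u] has constant slope inside and
    zero end values, so it vanishes. *)
Lemma dirichlet_is_green (a u du : R -> R) (s e lam : R) : weight a s e ->
  (forall t, s < t < e -> derivable_pt_lim u t (du t) /\
     derivable_pt_lim du t (- (lam * a t * u t))) ->
  cont_on_R (fun t => s <= t <= e) u -> u s = 0 -> u e = 0 ->
  exists w dw ddw, C2 w dw ddw /\ forall t, s <= t <= e -> u t = w t /\ ddw t = - (lam * a t * w t).
Proof.
intros [Hse [Ca _]] Hd Hc us ue.
set (f := fun t => lam * (a (clamp s e t) * u (clamp s e t))).
assert (Cf : forall t, continuous f t).
{ apply cont_mult; [apply cont_const|]; apply cont_mult.
  - intros t; apply (continuous_comp (clamp s e) a); [apply clamp_cont|apply Ca].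
  - apply cont_on_clamp; [lra|exact Hc]. }
destruct (green_C2 s e f Hse Cf) as [HC [Gs Ge]].
set (G := green s e f) in *; set (dG := dgreen s e f) in *.
assert (Edd : forall t, s <= t <= e -> - f t = - (lam * a t * u t)).
{ intros t Ht; unfold f; rewrite clamp_id by exact Ht; ring. }
set (k := du ((s + e) / 2) - dG ((s + e) / 2)).
assert (Ek : forall x y, s < x -> x < y -> y < e -> du x - dG x = du y - dG y).
{ intros x y Hx Hxy Hy.
  destruct (MVT_cor2 (fun t => du t - dG t) (fun _ => 0) x y Hxy) as [c [E _]]; [|lra].
  intros c Hc'; replace 0 with (- (lam * a c * u c) - (- f c)) by (rewrite Edd by lra; ring).
  apply derivable_pt_lim_minus; [apply Hd; lra|apply is_derive_Reals, HC]. }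
assert (Ek' : forall x, s < x < e -> du x - dG x = k).
{ intros x Hx; unfold k; destruct (Rtotal_order x ((s + e) / 2)) as [H|[->|H]]; [apply Ek; lra|reflexivity|].
  symmetry; apply Ek; lra. }
set (D := fun t => u (clamp s e t) - G t).
assert (CD : forall t, continuous D t).
{ apply cont_minus; [apply cont_on_clamp; [lra|exact Hc]|apply (C2_cont _ _ _ HC)]. }
assert (ED : forall t, s < t -> t <= e -> D t - D s = k * (t - s)).
{ intros t H1 H2.
  destruct (MVT_gen D s t (fun _ => k)) as [c [_ E]]; rewrite ?Rmin_left, ?Rmax_right by lra.
  - intros x Hx; rewrite <- (Ek' x) by lra.
    apply (is_derive_ext_loc (fun t => u t - G t)).
    + assert (Hp : 0 < Rmin (x - s) (e - x)) by (apply Rmin_glb_lt; lra).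
      exists (mkposreal _ Hp); intros y Hy; simpl in *.
      unfold ball in Hy; simpl in Hy; unfold AbsRing_ball, abs, minus, plus, opp in Hy; simpl in Hy.
      pose proof (Rmin_l (x - s) (e - x)); pose proof (Rmin_r (x - s) (e - x)).
      apply Rabs_def2 in Hy; unfold D; rewrite clamp_id by lra; reflexivity.
    + apply (is_derive_minus (V := R_NormedModule)); [apply is_derive_Reals, Hd; lra|apply HC].
  - intros x _; apply continuity_pt_filterlim, CD.
  - exact E. }
assert (Ds : D s = 0) by (unfold D; rewrite clamp_id by lra; lra).
assert (De : D e = 0) by (unfold D; rewrite clamp_id by lra; lra).
assert (k0 : k = 0) by (pose proof (ED e ltac:(lra) ltac:(lra)); nra).
assert (E0 : forall t, s <= t <= e -> u t = G t).
{ intros t Ht; destruct (Req_dec t s) as [->|ne]; [lra|].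
  pose proof (ED t ltac:(lra) ltac:(lra)) as E; rewrite k0, Ds in E.
  unfold D in E; rewrite clamp_id in E by lra; lra. }
exists G, dG, (fun t => - f t); split; [exact HC|]; intros t Ht.
split; [now apply E0|]; rewrite <- E0 by exact Ht; now apply Edd.
Qed.

(** [first_eig] speaks of the least eigenvalue, not of a sign. The eigenvalue [mu] of a positive
    eigenfunction equals [lam]: minimality gives one inequality, Sturm comparison on a nodal
    interval of the given eigenfunction the other. *)
Lemma first_eig_pos (a : R -> R) (s e lam : R) : weight a s e -> first_eig a s e lam ->
  exists phi dphi ddphi, pos_eig a s e lam phi dphi ddphi.
Proof.
intros Hw [Hl [[u [du [Hd [Hc [us [ue [t0 [Ht0 Hne]]]]]]]] Hmin]].
destruct (pos_eig_exists a s e Hw) as [mu [w [dw [ddw [Hmu Hpe]]]]].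
assert (Hpe' := Hpe); destruct Hpe' as [HC [ws [we [wp Ew]]]].
exists w, dw, ddw; replace lam with mu; [exact Hpe|].
apply Rle_antisym.
- destruct (dirichlet_is_green a u du s e lam Hw Hd Hc us ue) as [U [dU [ddU [HU EU]]]].
  assert (Hk : exists k, 0 < k * U t0).
  { rewrite (proj1 (EU t0 ltac:(lra))) in Hne; exists (U t0).
    destruct (Rdichotomy _ _ Hne); nra. }
  destruct Hk as [k Hk]; assert (HkU := C2_scal k _ _ _ HU).
  destruct (nodal_interval (fun t => k * U t) s t0 e) as [x [y [Hx [Hxy [Hy [fx [fy fp]]]]]]];
    [apply (C2_cont _ _ _ HkU)|exact Ht0| | |exact Hk|].
  + rewrite <- (proj1 (EU s ltac:(destruct Hw; lra))), us; ring.
  + rewrite <- (proj1 (EU e ltac:(destruct Hw; lra))), ue; ring.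
  + apply (sturm_comparison a w dw ddw _ _ _ x y mu lam ltac:(lra)) with (6 := HkU) (7 := fx) (8 := fy); auto.
    * intros t Ht; apply Hw; lra.
    * intros t Ht; destruct (Req_dec t s) as [->|n1]; [lra|]; destruct (Req_dec t e) as [->|n2]; [lra|].
      apply Rlt_le, wp; lra.
    * intros t Ht; apply wp; lra.
    * intros t Ht; apply Ew; lra.
    * intros t Ht; rewrite (proj2 (EU t ltac:(lra))); ring.
- apply Hmin; [exact Hmu|]; exists w, dw; split; [|split; [|split; [exact ws|split; [exact we|]]]].
  + intros t Ht; split; apply is_derive_Reals; [apply HC|].
    rewrite <- Ew by lra; apply HC.
  + intros x _ eps He.
    destruct (proj1 (continuous_eps w x) (proj1 (C2_cont _ _ _ HC) x) eps He) as [d [Hd1 H]].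
    exists d; split; [exact Hd1|]; intros y _; apply H.
  + exists ((s + e) / 2); destruct Hw as [Hse _]; split; [lra|].
    apply Rgt_not_eq, wp; lra.
Qed.

(** Domain monotonicity: Sturm comparison on the smaller interval, inside which the eigenfunction of
    the larger one is still positive. *)
Lemma pos_eig_mono (a b : R -> R) (p q s e lam mu : R) (w dw ddw phi dphi ddphi : R -> R) :
  pos_eig a p q lam w dw ddw -> pos_eig b s e mu phi dphi ddphi ->
  p <= s -> s < e -> e <= q -> (forall t, s <= t <= e -> 0 <= b t /\ a t = b t) -> lam <= mu.
Proof.
intros [HC [wp [wq [Hw Ew]]]] [HD [ps [pe [Hp Ep]]]] H1 H2 H3 Hab.
apply (sturm_comparison b w dw ddw phi dphi ddphi s e lam mu); auto.
- intros t Ht; apply Hab; lra.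
- intros t Ht; destruct (Req_dec t p) as [->|n1]; [lra|]; destruct (Req_dec t q) as [->|n2]; [lra|].
  apply Rlt_le, Hw; lra.
- intros t Ht; apply Hw; lra.
- intros t Ht; rewrite Ew by lra; rewrite (proj2 (Hab t ltac:(lra))); reflexivity.
- intros t Ht; apply Ep; lra.
Qed.

(** * The one-dimensional problem *)

Lemma sum_ext (f g : nat -> R) n : (forall i, (i < n)%nat -> f i = g i) -> sum_upto f n = sum_upto g n.
Proof.
induction n as [|n IH]; intros H; simpl; [reflexivity|].
rewrite IH, H by (intros; try apply H; lia); reflexivity.
Qed.

Lemma sum_zero (f : nat -> R) n : (forall i, (i < n)%nat -> f i = 0) -> sum_upto f n = 0.
Proof.
induction n as [|n IH]; intros H; simpl; [reflexivity|].
rewrite IH, H by (intros; try apply H; lia); ring.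
Qed.

Lemma sum_single (f : nat -> R) n j : (j < n)%nat -> (forall i, (i < n)%nat -> i <> j -> f i = 0) ->
  sum_upto f n = f j.
Proof.
induction n as [|n IH]; intros Hj H; simpl; [lia|].
destruct (Nat.eq_dec j n) as [->|ne].
- rewrite sum_zero by (intros; apply H; lia); ring.
- rewrite IH, (H n) by (intros; try apply H; lia); ring.
Qed.

Lemma sum_le (f g : nat -> R) n : (forall i, (i < n)%nat -> f i <= g i) -> sum_upto f n <= sum_upto g n.
Proof.
induction n as [|n IH]; intros H; simpl; [lra|].
apply Rplus_le_compat; [apply IH; intros|]; apply H; lia.
Qed.

Lemma sum_nonneg (f : nat -> R) n : (forall i, (i < n)%nat -> 0 <= f i) -> 0 <= sum_upto f n.
Proof.
intros H; rewrite <- (sum_zero (fun _ => 0) n) by auto; now apply sum_le.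
Qed.

Lemma sum_ge_term (f : nat -> R) n j : (j < n)%nat -> (forall i, (i < n)%nat -> 0 <= f i) -> f j <= sum_upto f n.
Proof.
induction n as [|n IH]; intros Hj H; simpl; [lia|].
destruct (Nat.eq_dec j n) as [->|ne].
- assert (0 <= sum_upto f n) by (apply sum_nonneg; intros; apply H; lia); lra.
- assert (f j <= sum_upto f n) by (apply IH; [lia|intros; apply H; lia]).
  assert (0 <= f n) by (apply H; lia); lra.
Qed.

Lemma sum_scal_r (f : nat -> R) (c : R) n : sum_upto (fun i => f i * c) n = sum_upto f n * c.
Proof. induction n as [|n IH]; simpl; [ring|rewrite IH; ring]. Qed.

Lemma cont_sum (F : nat -> R -> R) n : (forall i, (i < n)%nat -> forall t, continuous (F i) t) ->
  forall t, continuous (fun x => sum_upto (fun i => F i x) n) t.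
Proof.
induction n as [|n IH]; intros H; simpl; [apply cont_const|].
apply cont_plus; [apply IH; intros; apply H; lia|apply H; lia].
Qed.

Lemma ok_sum d (F : nat -> fam R) n : (forall i, (i < n)%nat -> fam_ok d (F i)) ->
  fam_ok d (fun par v t => sum_upto (fun i => F i par v t) n).
Proof.
induction n as [|n IH]; intros H; simpl.
- apply (ok_fun d (fun _ => 0) 0); intros _; rewrite Rabs_R0; lra.
- apply (ok_plus d (fun par v t => sum_upto (fun i => F i par v t) n) (F n)); [apply IH; intros|]; apply H; lia.
Qed.

Lemma finite_small (D : nat -> Prop) (P : nat -> R -> Prop) n :
  (forall i, (i <= n)%nat -> D i -> exists d, 0 < d /\ forall x, 0 < x <= d -> P i x) ->
  exists d, 0 < d /\ forall i, (i <= n)%nat -> D i -> forall x, 0 < x <= d -> P i x.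
Proof.
intros H; assert (Hs : forall k, (k <= S n)%nat -> exists d, 0 < d /\
  forall i, (i < k)%nat -> D i -> forall x, 0 < x <= d -> P i x).
{ induction k as [|k IH]; intros Hk; [exists 1; split; [lra|intros; lia]|].
  destruct IH as [d1 [D1 H1]]; [lia|].
  destruct (classic (D k)) as [Dk|nDk].
  - destruct (H k ltac:(lia) Dk) as [d2 [D2 H2]].
    exists (Rmin d1 d2); split; [apply Rmin_glb_lt; lra|].
    pose proof (Rmin_l d1 d2); pose proof (Rmin_r d1 d2); intros i Hi Di x Hx.
    destruct (Nat.eq_dec i k) as [->|]; [apply H2; lra|apply H1; [lia|exact Di|lra]].
  - exists d1; split; [exact D1|]; intros i Hi Di.
    destruct (Nat.eq_dec i k) as [->|]; [contradiction|apply H1; [lia|exact Di]]. }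
destruct (Hs (S n) (le_n _)) as [d [Hd Hd']]; exists d; split; [exact Hd|].
intros i Hi; apply Hd'; lia.
Qed.

Lemma finite_large (D : nat -> Prop) (P : nat -> R -> Prop) n :
  (forall i, (i <= n)%nat -> D i -> exists K, forall x, K < x -> P i x) ->
  exists K, 0 < K /\ forall i, (i <= n)%nat -> D i -> forall x, K < x -> P i x.
Proof.
intros H; destruct (finite_small D (fun i y => forall x, / y < x -> P i x) n) as [d [Hd HP]].
- intros i Hi Di; destruct (H i Hi Di) as [K HK]; exists (/ (Rabs K + 1)).
  assert (0 < Rabs K + 1) by (pose proof (Rabs_pos K); lra).
  split; [now apply Rinv_0_lt_compat|]; intros y Hy x Hx; apply HK.
  apply Rle_lt_trans with (/ y); [|exact Hx].
  apply Rle_trans with (Rabs K + 1); [pose proof (Rle_abs K); lra|].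
  rewrite <- (Rinv_inv (Rabs K + 1)); apply Rinv_le_contravar; lra.
- exists (/ d); split; [now apply Rinv_0_lt_compat|]; intros i Hi Di x; apply (HP i Hi Di); lra.
Qed.

Lemma half_line_clamp_cont (f : R -> R) (a b : R) : 0 <= a <= b -> cont_on_R (fun s => 0 <= s) f ->
  forall t, continuous (fun x => f (clamp a b x)) t.
Proof.
intros Hab Hf; apply cont_on_clamp; [lra|]; intros x Hx eps He.
destruct (Hf x ltac:(lra) eps He) as [d [Hd H]]; exists d; split; [exact Hd|].
intros y Hy; apply H; lra.
Qed.

Lemma pos_lower_bound (f : R -> R) (a b : R) : 0 < a <= b -> cont_on_R (fun s => 0 <= s) f ->
  (forall s, 0 < s -> 0 < f s) -> exists c, 0 < c /\ forall s, a <= s <= b -> c <= f s.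
Proof.
intros Hab Hc Hp.
destruct (continuity_ab_min (fun x => f (clamp a b x)) a b (proj2 Hab)) as [x [Hx Hin]].
- intros x _; apply continuity_pt_filterlim, half_line_clamp_cont; [lra|exact Hc].
- exists (f x); split; [apply Hp; lra|]; intros s Hs; specialize (Hx s Hs); simpl in Hx.
  rewrite !clamp_id in Hx by lra; exact Hx.
Qed.

Lemma linear_bound (f : R -> R) (l S : R) : cont_on_R (fun s => 0 <= s) f -> f 0 = 0 ->
  limsup0_lt (fun s => f s / s) l -> 0 < S -> exists c, 0 <= c /\ forall s, 0 <= s <= S -> f s <= c * s.
Proof.
intros Hc f0 [c [_ [d [Hd H]]]] HS.
destruct (clamped_bdd f 0 S) as [K [HK B]]; [lra|apply half_line_clamp_cont; [lra|exact Hc]|].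
exists (Rmax c 0 + K / d).
assert (0 <= K / d) by (apply Rdiv_le_0_compat; lra).
pose proof (Rmax_l c 0); pose proof (Rmax_r c 0).
split; [lra|]; intros s Hs.
destruct (Req_dec s 0) as [->|ne]; [rewrite f0; lra|].
destruct (Rlt_le_dec s d) as [Hl|Hl].
- specialize (H s ltac:(lra)); apply Rle_div_l in H; [|lra].
  apply Rle_trans with (c * s); [exact H|apply Rmult_le_compat_r; lra].
- specialize (B s); rewrite clamp_id in B by lra; apply Rabs_le_between in B.
  assert (K / d * d <= K / d * s) by (apply Rmult_le_compat_l; lra).
  replace (K / d * d) with K in * by (field; lra).
  assert (0 <= Rmax c 0 * s) by (apply Rmult_le_pos; lra); lra.
Qed.

(** Strong maximum principle. An interior zero is a minimum, so [dv] vanishes there as well, and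
    comparison with exponentials shows that [v] can only decrease away from it. *)
Lemma zero_propagates (v dv ddv : R -> R) (L M t0 : R) : C2 v dv ddv -> 0 <= M -> 0 < t0 < L ->
  (forall t, 0 <= t <= L -> 0 <= v t) -> (forall t, 0 <= t <= L -> ddv t <= M * v t) ->
  v t0 = 0 -> forall t, 0 <= t <= L -> v t = 0.
Proof.
intros [H1 [H2 _]] HM Ht0 Hv Hd E0.
set (k := sqrt M); assert (Hk : 0 <= k) by apply sqrt_pos.
assert (Hkk : k * k = M) by (apply sqrt_sqrt, HM).
assert (d0 : dv t0 = 0).
{ assert (cdv := derive_continuous dv ddv H2); apply Rle_antisym.
  - apply (derive_end_nonpos v dv 0 t0); auto; [lra|intros; apply Hv; lra].
  - apply (derive_start_nonneg v dv t0 L); auto; [lra|intros; apply Hv; lra]. }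
(* [(dv + k v) exp (- k t)] is nonincreasing, [(dv - k v) exp (k t)] is too. *)
assert (F : forall t, t0 <= t <= L -> dv t + k * v t <= 0).
{ intros t Ht.
  assert (HH := derive_mono (fun t => - ((dv t + k * v t) * exp (- k * t)))
     (fun t => - ((ddv t - k * k * v t) * exp (- k * t))) 0 L t0 t).
  assert (E : - ((dv t0 + k * v t0) * exp (- k * t0)) <= - ((dv t + k * v t) * exp (- k * t))).
  { apply HH; try lra.
    - intros x; assert (A1 := H1 x); assert (A2 := H2 x).
      auto_derive; [repeat split; eexists; eassumption|].
      replace (Derive (fun y : R => v y) x) with (dv x) by (symmetry; apply is_derive_unique, A1).
      replace (Derive (fun y : R => dv y) x) with (ddv x) by (symmetry; apply is_derive_unique, A2).
      ring.
    - intros x Hx; rewrite Hkk; specialize (Hd x ltac:(lra)); pose proof (exp_pos (- k * x)); nra. }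
  rewrite d0, E0 in E; pose proof (exp_pos (- k * t)); nra. }
assert (B : forall t, 0 <= t <= t0 -> 0 <= dv t - k * v t).
{ intros t Ht.
  assert (HH := derive_mono (fun t => - ((dv t - k * v t) * exp (k * t)))
     (fun t => - ((ddv t - k * k * v t) * exp (k * t))) 0 L t t0).
  assert (E : - ((dv t - k * v t) * exp (k * t)) <= - ((dv t0 - k * v t0) * exp (k * t0))).
  { apply HH; try lra.
    - intros x; assert (A1 := H1 x); assert (A2 := H2 x).
      auto_derive; [repeat split; eexists; eassumption|].
      replace (Derive (fun y : R => v y) x) with (dv x) by (symmetry; apply is_derive_unique, A1).
      replace (Derive (fun y : R => dv y) x) with (ddv x) by (symmetry; apply is_derive_unique, A2).
      ring.
    - intros x Hx; rewrite Hkk; specialize (Hd x ltac:(lra)); pose proof (exp_pos (k * x)); nra. }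
  rewrite d0, E0 in E; pose proof (exp_pos (k * t)); nra. }
intros t Ht; apply Rle_antisym; [|now apply Hv].
rewrite <- E0; destruct (Rle_lt_dec t0 t) as [Hl|Hl].
- assert (E := derive_mono (fun t => - v t) (fun t => - dv t) t0 L t0 t).
  assert (- v t0 <= - v t); [|lra]; apply E; try lra.
  + intros x; apply (is_derive_opp (V := R_NormedModule)), H1.
  + intros x Hx; specialize (F x ltac:(lra)).
    assert (0 <= k * v x) by (apply Rmult_le_pos; [lra|apply Hv; lra]); lra.
- apply (derive_mono v dv 0 t0); try lra; [exact H1|].
  intros x Hx; specialize (B x ltac:(lra)).
  assert (0 <= k * v x) by (apply Rmult_le_pos; [lra|apply Hv; lra]); lra.
Qed.

Lemma steep_growth (v dv ddv b : R -> R) (A K x y : R) : C2 v dv ddv -> (forall t, continuous b t) ->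
  x <= y -> - A <= dv x -> dv y <= A -> (forall t, x < t < y -> K * b t <= ddv t) ->
  K * RInt b x y <= 2 * A.
Proof.
intros HC Cb Hxy Hx Hy Hd; destruct (C2_cont _ _ _ HC) as [_ [_ c2]].
assert (E : (RInt ddv x y : R) = dv y - dv x) by (apply ftc; [apply HC|exact c2]).
assert (LE : RInt (fun t => K * b t) x y <= RInt ddv x y).
{ apply RInt_le; [exact Hxy| |apply ex_RInt_cont, c2|exact Hd].
  apply ex_RInt_cont, cont_mult; [apply cont_const|exact Cb]. }
rewrite RInt_scal_cont in LE by exact Cb; lra.
Qed.

(** * The truncated system on [0, L] and its fixed points *)

Section Core.
Variables (m : nat) (L : R) (s e : nat -> R) (a b G k : nat -> R -> R) (lam cs : nat -> R) (d0 : R).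
Hypothesis HL : 0 < L.
Hypothesis He0 : e 0%nat = 0.
Hypothesis HsL : s (S m) = L.
Hypothesis Hse : forall i, (1 <= i <= m)%nat -> s i < e i.
Hypothesis Hes : forall i, (i <= m)%nat -> e i <= s (S i).
Hypothesis Hes_lt : forall i, (1 <= i < m)%nat -> e i < s (S i).
Hypothesis a_weight : forall i, (1 <= i <= m)%nat -> weight (a i) (s i) (e i).
Hypothesis a_bdd : forall i, (1 <= i <= m)%nat -> exists K, forall t, 0 <= a i t <= K.
Hypothesis a_out : forall i, (1 <= i <= m)%nat -> forall t, 0 <= t <= L -> t < s i \/ e i < t -> a i t = 0.
Hypothesis b_cont : forall j, (j <= m)%nat -> forall t, continuous (b j) t.
Hypothesis b_bdd : forall j, (j <= m)%nat -> exists K, forall t, 0 <= b j t <= K.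
Hypothesis b_out : forall j, (j <= m)%nat -> forall t, 0 <= t <= L -> t < e j \/ s (S j) < t -> b j t = 0.
Hypothesis b_right : forall j, (j <= m)%nat -> e j < s (S j) -> forall d, 0 < d ->
  exists t, e j <= t < e j + d /\ t <= s (S j) /\ b j t <> 0.
Hypothesis b_left : forall j, (j <= m)%nat -> e j < s (S j) -> forall d, 0 < d ->
  exists t, s (S j) - d < t <= s (S j) /\ e j <= t /\ b j t <> 0.
Hypothesis G_cont : forall i, (1 <= i <= m)%nat -> cont_on_R (fun x => 0 <= x) (G i).
Hypothesis G_nonneg : forall i, (1 <= i <= m)%nat -> forall x, 0 <= x -> 0 <= G i x.
Hypothesis k_cont : forall j, (j <= m)%nat -> cont_on_R (fun x => 0 <= x) (k j).
Hypothesis k_zero : forall j, (j <= m)%nat -> k j 0 = 0.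
Hypothesis k_pos : forall j, (j <= m)%nat -> forall x, 0 < x -> 0 < k j x.
Hypothesis k_lin : forall j, (j <= m)%nat -> exists l, limsup0_lt (fun x => k j x / x) l.
Hypothesis lam_pos : forall i, (1 <= i <= m)%nat -> 0 < lam i.
Hypothesis lam_eig : forall i, (1 <= i <= m)%nat ->
  exists phi dphi ddphi, pos_eig (a i) (s i) (e i) (lam i) phi dphi ddphi.
Hypothesis d0_pos : 0 < d0.
Hypothesis cs_small : forall i, (1 <= i <= m)%nat -> 0 <= cs i < lam i /\
  forall x, 0 <= x <= d0 -> G i x <= cs i * x.
Hypothesis G_large : forall i, (1 <= i <= m)%nat -> exists c K, lam i < c /\
  forall x, 0 <= x -> c * x - K <= G i x.

Let c (i : nat) := (s i + e i) / 2.

Lemma k_nonneg j x : (j <= m)%nat -> 0 <= x -> 0 <= k j x.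
Proof.
intros Hj [Hx|Hx]; [now apply Rlt_le, k_pos|rewrite <- Hx, k_zero by exact Hj; lra].
Qed.

Lemma e_le_s i j : (i < j)%nat -> (j <= S m)%nat -> e i <= s j.
Proof.
induction j as [|j IH]; intros H1 H2; [lia|].
destruct (Nat.eq_dec i j) as [->|ne]; [apply Hes; lia|].
apply Rle_trans with (s j); [apply IH; lia|].
apply Rle_trans with (e j); [apply Rlt_le, Hse; lia|apply Hes; lia].
Qed.

Lemma s_mono i j : (1 <= i <= j)%nat -> (j <= S m)%nat -> s i <= s j.
Proof.
intros H1 H2; destruct (Nat.eq_dec i j) as [->|ne]; [lra|].
apply Rle_trans with (e i); [apply Rlt_le, Hse; lia|apply e_le_s; lia].
Qed.

Lemma e_mono i j : (i <= j <= m)%nat -> e i <= e j.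
Proof.
intros H; destruct (Nat.eq_dec i j) as [->|ne]; [lra|].
apply Rle_trans with (s j); [apply e_le_s; lia|apply Rlt_le, Hse; lia].
Qed.

Lemma nodes_in_range i : (1 <= i <= m)%nat -> 0 <= s i /\ s i < e i /\ e i <= L.
Proof.
intros Hi; split; [rewrite <- He0; apply e_le_s; lia|split; [now apply Hse|]].
rewrite <- HsL; apply e_le_s; lia.
Qed.

Lemma a_off_diag i i' t : (1 <= i <= m)%nat -> (1 <= i' <= m)%nat -> i' <> i ->
  s i < t < e i -> a i' t = 0.
Proof.
intros Hi Hi' ne Ht; destruct (nodes_in_range i Hi) as [? [? ?]].
apply a_out; [exact Hi'|lra|].
destruct (Nat.lt_total i i') as [h|[h|h]]; [left|lia|right].
- pose proof (e_le_s i i' h ltac:(lia)); lra.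
- pose proof (e_le_s i' i h ltac:(lia)); lra.
Qed.

Lemma b_on_J i j t : (1 <= i <= m)%nat -> (j <= m)%nat -> s i < t < e i -> b j t = 0.
Proof.
intros Hi Hj Ht; destruct (nodes_in_range i Hi) as [? [? ?]].
apply b_out; [exact Hj|lra|].
destruct (Nat.lt_ge_cases j i) as [h|h]; [right|left].
- pose proof (s_mono (S j) i ltac:(lia) ltac:(lia)); lra.
- pose proof (e_mono i j ltac:(lia)); lra.
Qed.

Lemma a_off_gap i j t : (1 <= i <= m)%nat -> (j <= m)%nat -> 0 <= t <= L ->
  e j < t < s (S j) -> a i t = 0.
Proof.
intros Hi Hj HtL Ht; apply a_out; [exact Hi|exact HtL|].
destruct (Nat.lt_ge_cases j i) as [h|h]; [left|right].
- pose proof (s_mono (S j) i ltac:(lia) ltac:(lia)); lra.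
- pose proof (e_mono i j ltac:(lia)); lra.
Qed.

(** Truncation makes all nonlinearities bounded, as [bvp] requires. The levels stay free here,
    because they depend on the index set. *)
Lemma truncated_system (beta lv lo hi : nat -> R) (r Rr Sv : R) : r <= Rr -> 0 <= Sv ->
  (forall i, 0 <= lv i) -> (forall i, lo i <= hi i) -> (exists Kb, forall i, Rabs (lo i) + Rabs (hi i) <= Kb) ->
  exists (q mu : nat -> R) (V dV ddV : R -> R), C2 V dV ddV /\ V 0 = 0 /\ V L = 0 /\
    (forall i, (1 <= i <= m)%nat -> q i = clamp r Rr (q i + mu i) /\
       mu i = clamp (lo i) (hi i) (mu i + (q i - V (c i)))) /\
    (forall t, 0 <= t <= L -> ddV t =
       - (sum_upto (fun i => a (S i) t * (G (S i) (clamp 0 (lv (S i)) (V t)) * (1 + Rmin 0 (mu (S i)))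
              + Rmax 0 (mu (S i)))) m
          - sum_upto (fun j => beta j * (b j t * k j (clamp 0 Sv (V t)))) (S m))).
Proof.
intros HrR HSv Hlv Hlh [Kb HKb].
(* [par] holds [q] in its first [m] entries and [mu] in the next [m], shifted by one since intervals
   are numbered from 1. This clamp bounds the source for every [par]; at a fixed point it is the
   identity. *)
set (muof := fun (par : nat -> R) i => clamp (lo (S i)) (hi (S i)) (par (m + i)%nat)).
set (Fa := fun i => (fun par v t => a (S i) t * (G (S i) (clamp 0 (lv (S i)) (v t)) * (1 + Rmin 0 (muof par i))
              + Rmax 0 (muof par i))) : fam R).
set (Fb := fun j => (fun par v t => - beta j * (b j t * k j (clamp 0 Sv (v t)))) : fam R).
set (Ps := (fun par v t => sum_upto (fun i => Fa i par v t) m + sum_upto (fun j => Fb j par v t) (S m)) : fam R).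
set (Th := (fun par v n => if lt_dec n m then clamp r Rr (par n + par (m + n)%nat)
   else if lt_dec n (m + m) then clamp (lo (S (n - m))) (hi (S (n - m))) (par n + (par (n - m)%nat + - v (c (S (n - m)))))
   else 0) : fam nat).
assert (Mlip : forall i, (forall x y, Rabs (1 + Rmin 0 (clamp (lo i) (hi i) x) - (1 + Rmin 0 (clamp (lo i) (hi i) y))) <= Rabs (x - y))
   /\ (forall x y, Rabs (Rmax 0 (clamp (lo i) (hi i) x) - Rmax 0 (clamp (lo i) (hi i) y)) <= Rabs (x - y))).
{ intros i; split; intros x y; eapply Rle_trans; try apply (clamp_lip (lo i) (hi i));
    generalize (clamp (lo i) (hi i) x) (clamp (lo i) (hi i) y); intros z w;
    unfold Rmin, Rmax, Rabs; destruct (Rle_dec 0 z), (Rle_dec 0 w); repeat destruct (Rcase_abs _); lra. }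
assert (Mbd : forall i x, Rabs (1 + Rmin 0 (clamp (lo i) (hi i) x)) <= 1 + Kb /\ Rabs (Rmax 0 (clamp (lo i) (hi i) x)) <= Kb).
{ intros i x; pose proof (clamp_bdd (lo i) (hi i) x (Hlh i)) as B; specialize (HKb i).
  revert B; generalize (clamp (lo i) (hi i) x); intros z B.
  assert (B' : Rabs z <= Kb) by lra; apply Rabs_le_between in B'.
  split; apply Rabs_le; unfold Rmin, Rmax; destruct (Rle_dec 0 z); lra. }
assert (Fa_ok : forall i, (i < m)%nat -> fam_ok (m + m) (Fa i)).
{ intros i Hi; destruct (a_bdd (S i)) as [Ka HKa]; [lia|].
  assert (Cg : forall t, continuous (fun x => G (S i) (clamp 0 (lv (S i)) x)) t).
  { apply half_line_clamp_cont; [split; [lra|apply Hlv]|apply G_cont; lia]. }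
  destruct (clamped_bdd (G (S i)) 0 (lv (S i)) (Hlv _) Cg) as [Kg [_ HKg]].
  apply (ok_mult _ (fun _ _ t => a (S i) t)).
  { apply (ok_fun _ (a (S i)) Ka); intros t; specialize (HKa t); rewrite Rabs_pos_eq; lra. }
  assert (Up := uc_par (T := R) (m + m) (m + i) ltac:(lia)).
  apply ok_plus; [apply (ok_mult _ (fun _ v t => G (S i) (clamp 0 (lv (S i)) (v t))))|].
  - apply (ok_comp _ (fun _ v t => v t) (fun _ x => G (S i) (clamp 0 (lv (S i)) x)) Kg (uc_eval _)); [auto|].
    intros eps He; destruct (clamped_uc (G (S i)) 0 (lv (S i)) (Hlv _) Cg eps He) as [d [Hd H]].
    exists d; split; [exact Hd|auto].
  - apply (ok_lip _ _ (fun _ x => 1 + Rmin 0 (clamp (lo (S i)) (hi (S i)) x)) (1 + Kb) Up); intros; [apply Mbd|apply Mlip].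
  - apply (ok_lip _ _ (fun _ x => Rmax 0 (clamp (lo (S i)) (hi (S i)) x)) Kb Up); intros; [apply Mbd|apply Mlip]. }
assert (Fb_ok : forall j, (j < S m)%nat -> fam_ok (m + m) (Fb j)).
{ intros j Hj; destruct (b_bdd j) as [Ka HKa]; [lia|].
  assert (Cg : forall t, continuous (fun x => k j (clamp 0 Sv x)) t).
  { apply half_line_clamp_cont; [lra|apply k_cont; lia]. }
  destruct (clamped_bdd (k j) 0 Sv HSv Cg) as [Kg [_ HKg]].
  apply (ok_mult _ (fun _ _ _ => - beta j)); [|apply (ok_mult _ (fun _ _ t => b j t))].
  - apply (ok_fun _ (fun _ => - beta j) (Rabs (- beta j))); intros; lra.
  - apply (ok_fun _ (b j) Ka); intros t; specialize (HKa t); rewrite Rabs_pos_eq; lra.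
  - apply (ok_comp _ (fun _ v t => v t) (fun _ x => k j (clamp 0 Sv x)) Kg (uc_eval _)); [auto|].
    intros eps He; destruct (clamped_uc (k j) 0 Sv HSv Cg eps He) as [d [Hd H]].
    exists d; split; [exact Hd|auto]. }
assert (CPs : forall par v, (forall t, continuous v t) -> forall t, continuous (Ps par v) t).
{ intros par v Cv; unfold Ps; apply cont_plus.
  - apply cont_sum; intros i Hi; unfold Fa; apply cont_mult; [apply a_weight; lia|].
    apply cont_plus; [apply cont_mult|]; try apply cont_const.
    intros t; apply (continuous_comp v (fun x => G (S i) (clamp 0 (lv (S i)) x))); [apply Cv|].
    apply half_line_clamp_cont; [split; [lra|apply Hlv]|apply G_cont; lia].
  - apply cont_sum; intros j Hj; unfold Fb; apply cont_mult; [apply cont_const|].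
    apply cont_mult; [apply b_cont; lia|].
    intros t; apply (continuous_comp v (fun x => k j (clamp 0 Sv x))); [apply Cv|].
    apply half_line_clamp_cont; [lra|apply k_cont; lia]. }
destruct (bvp 0 L (m + m) Th Ps HL) as [par [v [Cv [Ev Ep]]]].
- split.
  + pose proof (Rabs_pos r); pose proof (Rabs_pos Rr); pose proof (Rabs_pos Kb); pose proof (Rle_abs Kb).
    exists (Rabs r + Rabs Rr + Rabs Kb); split; [lra|]; intros par v n; unfold Th.
    destruct (lt_dec n m); [|destruct (lt_dec n (m + m)); [|rewrite Rabs_R0; lra]].
    * eapply Rle_trans; [now apply clamp_bdd|lra].
    * eapply Rle_trans; [now apply clamp_bdd|]; specialize (HKb (S (n - m))); lra.
  + intros eps He; exists (eps / 3); split; [lra|]; intros par par' v v' Hp Hv n; unfold Th.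
    destruct (lt_dec n m); [|destruct (lt_dec n (m + m)); [|rewrite Rminus_diag, Rabs_R0; lra]];
      (eapply Rle_trans; [apply clamp_lip|]); pose proof (Hp n ltac:(lia)) as P1; apply Rabs_le_between in P1.
    * pose proof (Hp (m + n)%nat ltac:(lia)) as P2; apply Rabs_le_between in P2; apply Rabs_le; lra.
    * pose proof (Hp (n - m)%nat ltac:(lia)) as P2; pose proof (Hv (c (S (n - m)))) as P3.
      apply Rabs_le_between in P2; apply Rabs_le_between in P3; apply Rabs_le; lra.
- apply (ok_plus _ (fun par v t => sum_upto (fun i => Fa i par v t) m) (fun par v t => sum_upto (fun j => Fb j par v t) (S m)));
    now apply ok_sum.
- exact CPs.
- destruct (green_C2 0 L (Ps par v) HL (CPs par v Cv)) as [HC [G0 GL]].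
  assert (EV : forall t, 0 <= t <= L -> v t = green 0 L (Ps par v) t).
  { intros t Ht; rewrite Ev, clamp_id by exact Ht; reflexivity. }
  revert HC G0 GL EV; generalize (green 0 L (Ps par v)) (dgreen 0 L (Ps par v)); intros V dV HC G0 GL EV.
  exists (fun i => par (pred i)), (fun i => par (m + pred i)%nat), V, dV, (fun t => - Ps par v t).
  split; [exact HC|split; [exact G0|split; [exact GL|]]].
  assert (Emu : forall i, (1 <= i <= m)%nat -> par (m + pred i)%nat =
      clamp (lo i) (hi i) (par (m + pred i)%nat + (par (pred i) - v (c i)))).
  { intros i Hi; pose proof (Ep (m + pred i)%nat ltac:(lia)) as E; unfold Th in E.
    destruct (lt_dec (m + pred i) m); [lia|]; destruct (lt_dec (m + pred i) (m + m)); [|lia].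
    replace (m + pred i - m)%nat with (pred i) in E by lia.
    replace (S (pred i)) with i in E by lia; rewrite <- E at 1; reflexivity. }
  split.
  + intros i Hi; destruct (nodes_in_range i Hi) as [n1 [n2 n3]]; split.
    * pose proof (Ep (pred i) ltac:(lia)) as E; unfold Th in E.
      destruct (lt_dec (pred i) m); [|lia]; rewrite <- E at 1; reflexivity.
    * rewrite <- EV by (unfold c; lra); now apply Emu.
  + intros t Ht; f_equal; unfold Ps; unfold Rminus; f_equal.
    * apply sum_ext; intros i Hi; unfold Fa, muof; rewrite EV by exact Ht; cbn [pred].
      destruct (clamp_fixed (lo (S i)) (hi (S i)) (par (m + i)%nat) (par i - v (c (S i))) (Hlh _)) as [In _].
      { pose proof (Emu (S i) ltac:(lia)) as E; exact E. }
      rewrite (clamp_id (lo (S i)) (hi (S i))) by exact In; reflexivity.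
    * rewrite <- (Rmult_1_r (sum_upto (fun j => beta j * _) (S m))), Ropp_mult_distr_r, <- sum_scal_r.
      apply sum_ext; intros j Hj; unfold Fb; rewrite EV by exact Ht; cbv beta; ring.
Qed.

(** Sublinear regime. The target is [r / 2] and not [r], so that it contradicts [r <= V (c i)] and
    also yields [V <= r] on all of [J_i]. *)
Lemma small_on_J (r : R) : 0 < r -> exists e0, 0 < e0 /\ forall i, (1 <= i <= m)%nat ->
  forall V dV ddV, C2 V dV ddV -> 0 <= V (s i) <= e0 -> 0 <= V (e i) <= e0 ->
  (forall t, s i < t < e i -> ddV t <= 0) ->
  (forall t, s i < t < e i -> - (cs i * a i t * V t) <= ddV t) -> V (c i) < r / 2.
Proof.
intros Hr.
destruct (finite_small (fun i => (1 <= i <= m)%nat) (fun i x => forall V dV ddV, C2 V dV ddV ->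
  0 <= V (s i) <= x -> 0 <= V (e i) <= x ->
  (forall t, s i < t < e i -> ddV t <= 0) ->
  (forall t, s i < t < e i -> - (cs i * a i t * V t) <= ddV t) -> V (c i) < r / 2) m) as [e0 [He HP]].
- intros i _ Hi; destruct (lam_eig i Hi) as [phi [dphi [ddphi Hphi]]].
  destruct (cs_small i Hi) as [[c1 c2] _].
  assert (Hb := sublinear_bound (a i) (s i) (e i) (lam i) phi dphi ddphi (a_weight i Hi) Hphi).
  set (K := (dphi (s i) - dphi (e i)) / ((lam i - cs i) *
    RInt (fun t => a i t * (phi t * bump (s i) (e i) t)) (s i) (e i))) in *.
  exists (r / (2 * (Rabs K + 1))).
  assert (HK : 0 < 2 * (Rabs K + 1)) by (pose proof (Rabs_pos K); lra).
  split; [apply Rdiv_lt_0_compat; lra|]; intros x Hx V dV ddV HC Vs Ve Hcv Hd.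
  apply Rle_lt_trans with (x * K); [now apply (Hb (cs i) x V dV ddV)|].
  assert (Hx' := proj2 Hx); apply Rle_div_r in Hx'; [|exact HK].
  pose proof (Rle_abs K); nra.
- exists e0; split; [exact He|]; intros i Hi; apply (HP i (proj2 Hi) Hi); lra.
Qed.

(** Superlinear regime: an a priori bound of the midpoint value that depends neither on [beta] nor
    on the other intervals. *)
Lemma large_on_J : exists R0, 0 < R0 /\ forall i, (1 <= i <= m)%nat ->
  forall Rr V dV ddV, R0 < Rr -> C2 V dV ddV -> 0 <= V (s i) -> 0 <= V (e i) ->
  (forall t, s i < t < e i -> ddV t <= 0) ->
  (forall t, s i < t < e i -> ddV t <= - (a i t * G i (V t))) -> V (c i) < Rr.
Proof.
destruct (finite_large (fun i => (1 <= i <= m)%nat) (fun i x => forall V dV ddV, C2 V dV ddV ->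
  0 <= V (s i) -> 0 <= V (e i) -> (forall t, s i < t < e i -> ddV t <= 0) ->
  (forall t, s i < t < e i -> ddV t <= - (a i t * G i (V t))) -> V (c i) < x) m) as [R0 [HR HP]].
- intros i _ Hi; destruct (lam_eig i Hi) as [phi [dphi [ddphi Hphi]]].
  destruct (G_large i Hi) as [c' [K0 [Hc' HG]]].
  eexists; intros x Hx V dV ddV HC Vs Ve Hcv Hd; eapply Rle_lt_trans; [|exact Hx].
  apply (superlinear_bound (a i) (s i) (e i) (lam i) phi dphi ddphi (a_weight i Hi) Hphi c' K0 V dV ddV); auto.
  intros t Ht; eapply Rle_trans; [now apply Hd|]; apply Ropp_le_contravar, Rmult_le_compat_l.
  + apply a_weight; [exact Hi|lra].
  + apply HG, (concave_midpoint V dV ddV (s i) (e i)); auto; lra.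
- exists R0; split; [exact HR|]; intros i Hi Rr V dV ddV Hx; exact (HP i (proj2 Hi) Hi Rr Hx V dV ddV).
Qed.

Lemma forced_on_J (Rr : R) : exists M0, 0 < M0 /\ forall i, (1 <= i <= m)%nat ->
  forall M V dV ddV, M0 < M -> C2 V dV ddV -> 0 <= V (s i) -> 0 <= V (e i) ->
  (forall t, s i < t < e i -> ddV t <= 0) ->
  (forall t, s i < t < e i -> ddV t <= - (M * a i t)) -> Rr < V (c i).
Proof.
destruct (finite_large (fun i => (1 <= i <= m)%nat) (fun i x => 2 * lam i * Rr < x) m) as [M0 [HM HP]].
- intros i _ Hi; exists (2 * lam i * Rr); auto.
- exists M0; split; [exact HM|]; intros i Hi M V dV ddV Hx HC Vs Ve Hcv Hd.
  specialize (HP i (proj2 Hi) Hi M Hx).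
  destruct (lam_eig i Hi) as [phi [dphi [ddphi Hphi]]].
  assert (B := forced_bound (a i) (s i) (e i) (lam i) phi dphi ddphi (a_weight i Hi) Hphi M V dV ddV
    (lam_pos i Hi) HC Vs Ve Hcv Hd); fold (c i) in B.
  apply Rmult_lt_reg_l with (2 * lam i); [pose proof (lam_pos i Hi)|]; lra.
Qed.

(* Otherwise [V >= eps / 2] near the end point, and there [dV] grows by more than [2 A]. *)
Lemma decay_at_gap_ends (eps A Sv : R) : 0 < eps <= Sv -> 0 < A -> exists bs, 0 < bs /\
  forall j, (j <= m)%nat -> e j < s (S j) -> forall be V dV ddV, bs < be -> C2 V dV ddV ->
  (forall t, 0 <= t <= L -> 0 <= V t <= Sv) -> (forall t, 0 < t < L -> - A <= dV t <= A) ->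
  (forall t, e j < t < s (S j) -> be * (b j t * k j (V t)) <= ddV t) ->
  (0 < e j -> V (e j) <= eps) /\ (s (S j) < L -> V (s (S j)) <= eps).
Proof.
intros Heps HA.
destruct (finite_large (fun j => e j < s (S j)) (fun j be => forall V dV ddV, C2 V dV ddV ->
  (forall t, 0 <= t <= L -> 0 <= V t <= Sv) -> (forall t, 0 < t < L -> - A <= dV t <= A) ->
  (forall t, e j < t < s (S j) -> be * (b j t * k j (V t)) <= ddV t) ->
  (0 < e j -> V (e j) <= eps) /\ (s (S j) < L -> V (s (S j)) <= eps)) m) as [bs [Hbs HP]].
- intros j Hj Hes'.
  destruct (pos_lower_bound (k j) (eps / 2) Sv) as [kap [Hkap Hk]]; [lra|now apply k_cont|now apply k_pos|].
  (* With slope at most [A] the value cannot fall from above [eps] to below [eps / 2] within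
     distance [d]; half the gap length keeps the test interval inside the gap. *)
  set (d := Rmin (eps / (2 * A)) ((s (S j) - e j) / 2)).
  assert (Hd : 0 < d) by (apply Rmin_glb_lt; [apply Rdiv_lt_0_compat|]; lra).
  assert (Hd1 : d <= eps / (2 * A)) by apply Rmin_l.
  assert (Hd2 : d <= (s (S j) - e j) / 2) by apply Rmin_r.
  assert (HdA : A * d <= eps / 2).
  { apply Rle_trans with (A * (eps / (2 * A))); [apply Rmult_le_compat_l; lra|apply Req_le; field; lra]. }
  assert (E0 : 0 <= e j) by (rewrite <- He0; apply e_mono; lia).
  assert (SL : s (S j) <= L) by (rewrite <- HsL; apply s_mono; lia).
  assert (bpos : forall t, 0 <= b j t) by (destruct (b_bdd j Hj) as [Kb HKb]; apply HKb).
  set (B1 := RInt (b j) (e j) (e j + d) : R); set (B2 := RInt (b j) (s (S j) - d) (s (S j)) : R).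
  assert (HB1 : 0 < B1).
  { destruct (b_right j Hj Hes' d Hd) as [t [Ht1 [Ht2 Ht3]]].
    apply RInt_pos with t; [now apply b_cont|intros; apply bpos|lra|lra|pose proof (bpos t); lra]. }
  assert (HB2 : 0 < B2).
  { destruct (b_left j Hj Hes' d Hd) as [t [Ht1 [Ht2 Ht3]]].
    apply RInt_pos with t; [now apply b_cont|intros; apply bpos|lra|lra|pose proof (bpos t); lra]. }
  (* Above this threshold [be * kap * B1] and [be * kap * B2] exceed [2 * A], more than the slope
     can grow. [B1] and [B2] are positive because [b j] does not vanish near the ends of its gap. *)
  exists (2 * A / (kap * Rmin B1 B2)).
  assert (HB : 0 < Rmin B1 B2) by (apply Rmin_glb_lt; lra).
  assert (HkB : 0 < kap * Rmin B1 B2) by (apply Rmult_lt_0_compat; lra).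
  intros be Hbe V dV ddV HC HV HdV Hdd.
  assert (Hbe' : 2 * A < be * kap * Rmin B1 B2).
  { apply Rlt_div_l in Hbe; [lra|exact HkB]. }
  assert (be0 : 0 < be).
  { apply Rle_lt_trans with (2 * A / (kap * Rmin B1 B2)); [|exact Hbe]; apply Rlt_le, Rdiv_lt_0_compat; lra. }
  assert (steep : forall x y, e j <= x -> x < y -> y <= s (S j) -> 0 < x -> y < L ->
     (forall t, x <= t <= y -> eps / 2 <= V t) -> be * kap * RInt (b j) x y <= 2 * A).
  { intros x y Hx Hxy Hy Hx0 HyL Hlow.
    apply (steep_growth V dV ddV (b j) A (be * kap) x y HC (b_cont j Hj)); [lra|apply HdV; lra|apply HdV; lra|].
    intros t Ht; eapply Rle_trans; [|apply Hdd; lra].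
    rewrite (Rmult_comm (b j t)), <- Rmult_assoc; apply Rmult_le_compat_r; [apply bpos|].
    apply Rmult_le_compat_l; [lra|]; apply Hk; split; [apply Hlow; lra|apply HV; lra]. }
  split; intros Hpos; apply Rnot_lt_le; intros Hlt.
  + assert (be * kap * B1 <= 2 * A).
    { apply steep; try lra; intros t Ht.
      destruct (Req_dec t (e j)) as [->|ne]; [lra|].
      destruct (mvt V dV (e j) t (proj1 HC)) as [z [Hz Ez]]; [lra|].
      destruct (HdV z) as [Hz1 _]; [lra|].
      assert (- A * (t - e j) <= dV z * (t - e j)) by (apply Rmult_le_compat_r; lra).
      assert (A * (t - e j) <= A * d) by (apply Rmult_le_compat_l; lra); lra. }
    assert (be * kap * Rmin B1 B2 <= be * kap * B1).
    { apply Rmult_le_compat_l; [apply Rmult_le_pos; lra|apply Rmin_l]. }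
    lra.
  + assert (be * kap * B2 <= 2 * A).
    { apply steep; try lra; intros t Ht.
      destruct (Req_dec t (s (S j))) as [->|ne]; [lra|].
      destruct (mvt V dV t (s (S j)) (proj1 HC)) as [z [Hz Ez]]; [lra|].
      destruct (HdV z) as [_ Hz1]; [lra|].
      assert (dV z * (s (S j) - t) <= A * (s (S j) - t)) by (apply Rmult_le_compat_r; lra).
      assert (A * (s (S j) - t) <= A * d) by (apply Rmult_le_compat_l; lra); lra. }
    assert (be * kap * Rmin B1 B2 <= be * kap * B2).
    { apply Rmult_le_compat_l; [apply Rmult_le_pos; lra|apply Rmin_r]. }
    lra.
- exists bs; split; [exact Hbs|]; intros j Hj Hgap be V dV ddV Hbe.
  exact (HP j Hj Hgap be Hbe V dV ddV).
Qed.

(** One constant for all truncation levels up to [Rr] and all [mu] in [[-1, M]], hence common to all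
    index sets and all [beta]. *)
Lemma source_bound (Rr M : R) : 0 < Rr -> 0 < M -> exists K, 0 < K /\
  forall (lv mu : nat -> R) (t x : R),
  (forall i, (1 <= i <= m)%nat -> 0 <= lv i <= Rr /\ -1 <= mu i <= M) ->
  sum_upto (fun i => a (S i) t * (G (S i) (clamp 0 (lv (S i)) x) * (1 + Rmin 0 (mu (S i)))
              + Rmax 0 (mu (S i)))) m <= K.
Proof.
intros HR HM.
assert (term : forall i, exists K, 0 <= K /\ ((i < m)%nat -> forall lv mu t x, 0 <= lv <= Rr -> -1 <= mu <= M ->
   a (S i) t * (G (S i) (clamp 0 lv x) * (1 + Rmin 0 mu) + Rmax 0 mu) <= K)).
{ intros i; destruct (lt_dec i m) as [Hi|]; [|exists 0; split; [lra|intros; contradiction]].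
  destruct (a_bdd (S i)) as [Ka HKa]; [lia|].
  destruct (clamped_bdd (G (S i)) 0 Rr) as [Kg [Kg0 HKg]]; [lra| |].
  { apply half_line_clamp_cont; [lra|apply G_cont; lia]. }
  assert (Ka0 : 0 <= Ka) by (specialize (HKa 0); lra).
  exists (Ka * (Kg + M)); split; [apply Rmult_le_pos; lra|].
  intros _ lv mu t x Hlv Hmu; pose proof (clamp_in 0 lv x (proj1 Hlv)) as Hc.
  assert (HG : 0 <= G (S i) (clamp 0 lv x) <= Kg).
  { split; [apply G_nonneg; [lia|lra]|].
    specialize (HKg (clamp 0 lv x)); rewrite (clamp_id 0 Rr) in HKg by lra.
    apply Rabs_le_between in HKg; lra. }
  assert (Hm1 : 0 <= 1 + Rmin 0 mu <= 1) by (unfold Rmin; destruct (Rle_dec 0 mu); lra).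
  assert (Hm2 : 0 <= Rmax 0 mu <= M) by (unfold Rmax; destruct (Rle_dec 0 mu); lra).
  assert (H1 : 0 <= G (S i) (clamp 0 lv x) * (1 + Rmin 0 mu) <= Kg).
  { split; [apply Rmult_le_pos; lra|].
    rewrite <- (Rmult_1_r Kg); apply Rmult_le_compat; lra. }
  apply Rmult_le_compat; [apply HKa|lra|apply HKa|lra]. }
destruct (choice _ term) as [Kf HKf].
exists (sum_upto Kf m + 1); split.
- assert (0 <= sum_upto Kf m) by (apply sum_nonneg; intros; apply HKf); lra.
- intros lv mu t x H.
  assert (sum_upto (fun i => a (S i) t * (G (S i) (clamp 0 (lv (S i)) x) * (1 + Rmin 0 (mu (S i)))
              + Rmax 0 (mu (S i)))) m <= sum_upto Kf m); [|lra].
  apply sum_le; intros i Hi; apply HKf; [exact Hi|apply H; lia|apply H; lia].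
Qed.

(** All constants are fixed before [beta] and [I] are given, so one threshold serves every index
    set; the position of the midpoint values relative to [r] recovers [I] from the solution. *)
Theorem multiplicity_1d : exists r bs, 0 < r /\ 0 < bs /\ forall beta : nat -> R,
  (forall j, (j <= m)%nat -> bs < beta j) -> forall I : nat -> bool,
  (exists i, (1 <= i <= m)%nat /\ I i = true) ->
  exists V dV ddV, C2 V dV ddV /\ V 0 = 0 /\ V L = 0 /\
    (forall t, 0 <= t <= L -> ddV t = - (sum_upto (fun i => a (S i) t * G (S i) (V t)) m -
       sum_upto (fun j => beta j * (b j t * k j (V t))) (S m))) /\
    (forall t, 0 < t < L -> 0 < V t) /\
    forall i, (1 <= i <= m)%nat -> (I i = true -> r <= V (c i)) /\ (I i = false -> V (c i) < r).
Proof.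
(* Then [V (c i) = r] implies [V <= 2 * r = d0] on [J_i], the range where [G i] is sublinear. *)
set (r := d0 / 2).
destruct large_on_J as [R0 [HR0 Hlarge]].
set (Rr := R0 + r + 1).
destruct (forced_on_J Rr) as [M0 [HM0 Hforced]].
set (M := M0 + 1).
assert (Hr : 0 < r) by (unfold r; lra).
assert (HRr : r < Rr /\ R0 < Rr) by (unfold Rr; lra).
assert (HM : M0 < M) by (unfold M; lra).
destruct (source_bound (2 * Rr) M) as [K [HK Hsrc]]; [lra|lra|].
destruct (small_on_J r Hr) as [e0 [Hpe0 Hsmall]].
set (A := K * L); assert (HA : 0 < A) by (apply Rmult_lt_0_compat; lra).
assert (HAL : 0 < A * L) by (apply Rmult_lt_0_compat; lra).
(* [A * L = K * L * L] bounds [V], so the truncation of [k j] is never active; adding [e0] ensures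
   [e0 <= Sv]. *)
set (Sv := A * L + e0).
destruct (decay_at_gap_ends e0 A Sv) as [bs [Hbs Hdecay]]; [unfold Sv; lra|exact HA|].
exists r, bs; split; [exact Hr|split; [exact Hbs|]].
intros beta Hbeta I [i0 [Hi0 Ii0]].
(* For [i] in [I] the level [2 * Rr] accommodates [V <= 2 * V (c i)] with [V (c i) <= Rr]. For the
   other [i] the bounds of [mu i] are both 0, which switches it off, and truncation at [r] alone
   keeps [V] small. *)
set (lv := fun i => if I i then 2 * Rr else r).
set (lo := fun i => if I i then -1 else 0).
set (hi := fun i => if I i then M else 0).
assert (Hlv : forall i, 0 <= lv i <= 2 * Rr) by (intros i; unfold lv; destruct (I i); lra).
assert (Hlh : forall i, -1 <= lo i /\ lo i <= 0 /\ 0 <= hi i /\ hi i <= M).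
{ intros i; unfold lo, hi; destruct (I i); lra. }
destruct (truncated_system beta lv lo hi r Rr Sv) as [q [mu [V [dV [ddV [HC [V0 [VL [Hq Hdd]]]]]]]]].
{ lra. } { unfold Sv; lra. } { intros i; apply Hlv. } { intros i; specialize (Hlh i); lra. }
{ exists (1 + M); intros i; specialize (Hlh i); rewrite (Rabs_left1 (lo i)), (Rabs_pos_eq (hi i)); lra. }
set (P := fun t => sum_upto (fun i => a (S i) t * (G (S i) (clamp 0 (lv (S i)) (V t)) * (1 + Rmin 0 (mu (S i)))
              + Rmax 0 (mu (S i)))) m) in Hdd.
set (Nt := fun t => sum_upto (fun j => beta j * (b j t * k j (clamp 0 Sv (V t)))) (S m)) in Hdd.
assert (Hdd' : forall t, 0 <= t <= L -> ddV t = - P t + Nt t).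
{ intros t Ht; rewrite Hdd by exact Ht; fold (P t) (Nt t); ring. }
assert (Hmu : forall i, (1 <= i <= m)%nat -> lo i <= mu i <= hi i /\
   (q i - V (c i) = 0 \/ (0 < q i - V (c i) /\ mu i = hi i) \/ (q i - V (c i) < 0 /\ mu i = lo i))).
{ intros i Hi; apply clamp_fixed; [specialize (Hlh i); lra|now apply Hq]. }
assert (Hqi : forall i, (1 <= i <= m)%nat -> r <= q i <= Rr /\
   (mu i = 0 \/ (0 < mu i /\ q i = Rr) \/ (mu i < 0 /\ q i = r))).
{ intros i Hi; apply clamp_fixed; [lra|now apply Hq]. }
assert (Hmu1 : forall i, (1 <= i <= m)%nat -> -1 <= mu i <= M).
{ intros i Hi; specialize (Hlh i); destruct (Hmu i Hi) as [H _]; lra. }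
set (src := fun i t => G i (clamp 0 (lv i) (V t)) * (1 + Rmin 0 (mu i)) + Rmax 0 (mu i)).
assert (src0 : forall i t, (1 <= i <= m)%nat -> 0 <= G i (clamp 0 (lv i) (V t)) /\
   0 <= G i (clamp 0 (lv i) (V t)) * (1 + Rmin 0 (mu i)) /\ Rmax 0 (mu i) <= src i t /\ 0 <= src i t).
{ intros i t Hi; specialize (Hmu1 i Hi).
  assert (g0 : 0 <= G i (clamp 0 (lv i) (V t))) by (apply G_nonneg; [exact Hi|apply clamp_in, Hlv]).
  assert (m0 : 0 <= 1 + Rmin 0 (mu i)) by (unfold Rmin; destruct (Rle_dec 0 (mu i)); lra).
  assert (0 <= G i (clamp 0 (lv i) (V t)) * (1 + Rmin 0 (mu i))) by (apply Rmult_le_pos; lra).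
  pose proof (Rmax_l 0 (mu i)); unfold src; lra. }
assert (a0 : forall i t, (1 <= i <= m)%nat -> 0 <= a i t).
{ intros i t Hi; destruct (a_bdd i Hi) as [Kb HKb]; apply HKb. }
assert (b0 : forall j t, (j <= m)%nat -> 0 <= b j t).
{ intros j t Hj; destruct (b_bdd j Hj) as [Kb HKb]; apply HKb. }
assert (bk0 : forall j t, (j < S m)%nat -> 0 <= beta j * (b j t * k j (clamp 0 Sv (V t)))).
{ intros j t Hj; apply Rmult_le_pos; [specialize (Hbeta j ltac:(lia)); lra|].
  apply Rmult_le_pos; [apply b0; lia|apply k_nonneg; [lia|apply clamp_in; unfold Sv; lra]]. }
assert (P0 : forall t, 0 <= P t).
{ intros t; apply sum_nonneg; intros i Hi; apply Rmult_le_pos; [apply a0; lia|apply src0; lia]. }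
assert (N0 : forall t, 0 <= Nt t) by (intros t; apply sum_nonneg; auto).
assert (PK : forall t, P t <= K) by (intros t; apply Hsrc; split; [apply Hlv|now apply Hmu1]).
(* Where [V < 0] the truncated argument of [k j] is 0, the absorption vanishes and [V] is
   concave. *)
assert (Vpos : forall t, 0 <= t <= L -> 0 <= V t).
{ apply (nonneg_of_concave_where_neg V dV ddV 0 L HC V0 VL); intros t Ht Hneg.
  rewrite Hdd' by lra; replace (Nt t) with 0; [specialize (P0 t); lra|].
  symmetry; apply sum_zero; intros j Hj.
  replace (clamp 0 Sv (V t)) with 0; [rewrite k_zero by lia; ring|].
  unfold clamp; rewrite (Rmin_right Sv) by (unfold Sv; lra); rewrite Rmax_left by lra; reflexivity. }
destruct (pinned_bounds V dV ddV L K HC HL V0 VL Vpos) as [HdV HVup].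
{ intros t Ht; rewrite Hdd' by lra; specialize (PK t); specialize (N0 t); lra. }
{ lra. }
fold A in HdV, HVup.
assert (HVS : forall t, 0 <= t <= L -> 0 <= V t <= Sv).
{ intros t Ht; specialize (Vpos t Ht); specialize (HVup t Ht); unfold Sv; lra. }
assert (HJ : forall i, (1 <= i <= m)%nat -> forall t, s i < t < e i -> ddV t = - (a i t * src i t)).
{ intros i Hi t Ht; destruct (nodes_in_range i Hi) as [n1 [n2 n3]].
  rewrite Hdd' by lra; replace (Nt t) with 0.
  - unfold P; rewrite (sum_single _ m (pred i)); [replace (S (pred i)) with i by lia; unfold src; ring|lia|].
    intros i' Hi' ne; rewrite (a_off_diag i (S i') t) by (lia || exact Ht); ring.
  - symmetry; apply sum_zero; intros j Hj; rewrite (b_on_J i j t) by (lia || exact Ht); ring. }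
assert (Hcv : forall i, (1 <= i <= m)%nat -> forall t, s i < t < e i -> ddV t <= 0).
{ intros i Hi t Ht; rewrite (HJ i Hi t Ht).
  assert (0 <= a i t * src i t); [apply Rmult_le_pos; [now apply a0|now apply src0]|lra]. }
assert (Hgap : forall j, (j <= m)%nat -> e j < s (S j) ->
   (0 < e j -> V (e j) <= e0) /\ (s (S j) < L -> V (s (S j)) <= e0)).
{ intros j Hj Hg; apply (Hdecay j Hj Hg (beta j) V dV ddV (Hbeta j Hj) HC HVS HdV).
  assert (E0 : 0 <= e j) by (rewrite <- He0; apply e_mono; lia).
  assert (SL : s (S j) <= L) by (rewrite <- HsL; apply s_mono; lia).
  intros t Ht; rewrite Hdd' by lra; replace (P t) with 0.
  - rewrite Ropp_0, Rplus_0_l.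
    pose proof (sum_ge_term (fun j => beta j * (b j t * k j (clamp 0 Sv (V t)))) (S m) j ltac:(lia)
      (fun j Hj => bk0 j t Hj)) as H; cbv beta in H.
    rewrite (clamp_id 0 Sv (V t)) in H at 1 by (apply HVS; lra); exact H.
  - symmetry; apply sum_zero; intros i Hi; rewrite (a_off_gap (S i) j t) by (lia || lra); ring. }
(* An end of [J_i] bounds a nondegenerate gap or is one of the points 0 and [L], because the gaps
   between consecutive [J_i] are nondegenerate by [Hes_lt]. *)
assert (Hends : forall i, (1 <= i <= m)%nat -> 0 <= V (s i) <= e0 /\ 0 <= V (e i) <= e0).
{ intros i Hi; destruct (nodes_in_range i Hi) as [n1 [n2 n3]].
  split; (split; [apply Vpos; lra|]).
  - destruct (Hes (pred i)) as [Hg|Hg]; [lia| |]; replace (S (pred i)) with i in Hg by lia.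
    + replace i with (S (pred i)) by lia; apply Hgap; replace (S (pred i)) with i by lia; [lia|exact Hg|lra].
    + destruct (Nat.eq_dec i 1) as [->|ne].
      * rewrite <- Hg; simpl; rewrite He0, V0; lra.
      * pose proof (Hes_lt (pred i) ltac:(lia)) as H; replace (S (pred i)) with i in H by lia; lra.
  - destruct (Hes i) as [Hg|Hg]; [lia| |].
    + apply Hgap; [lia|exact Hg|lra].
    + destruct (Nat.eq_dec i m) as [->|ne].
      * rewrite Hg, HsL, VL; lra.
      * pose proof (Hes_lt i ltac:(lia)); lra. }
assert (Hmid : forall i, (1 <= i <= m)%nat -> forall t, s i <= t <= e i ->
   0 <= V t /\ V (c i) * bump (s i) (e i) t <= V t <= 2 * V (c i)).
{ intros i Hi; destruct (Hends i Hi) as [[S1 _] [S2 _]].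
  exact (concave_midpoint V dV ddV (s i) (e i) HC (Hse i Hi) (Hcv i Hi) S1 S2). }
assert (small : forall i, (1 <= i <= m)%nat ->
   (forall t, s i < t < e i -> a i t * src i t <= cs i * a i t * V t) -> V (c i) < r / 2).
{ intros i Hi H; apply (Hsmall i Hi V dV ddV HC (proj1 (Hends i Hi)) (proj2 (Hends i Hi)) (Hcv i Hi)).
  intros t Ht; rewrite (HJ i Hi t Ht); specialize (H t Ht); lra. }
assert (cs_bound : forall i t x, (1 <= i <= m)%nat -> 0 <= x <= d0 -> x <= V t -> a i t * G i x <= cs i * a i t * V t).
{ intros i t x Hi Hx HxV; destruct (cs_small i Hi) as [[c1 _] Hc]; specialize (Hc x Hx).
  assert (cs i * x <= cs i * V t) by (apply Rmult_le_compat_l; lra).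
  apply Rle_trans with (a i t * (cs i * V t)); [apply Rmult_le_compat_l; [now apply a0|lra]|lra]. }
assert (key : forall i, (1 <= i <= m)%nat -> mu i = 0 /\ (forall t, s i <= t <= e i -> V t <= lv i) /\
   (I i = true -> r <= V (c i)) /\ (I i = false -> V (c i) < r)).
{ intros i Hi; destruct (nodes_in_range i Hi) as [n1 [n2 n3]].
  destruct (Hends i Hi) as [[S1 _] [S2 _]].
  destruct (Hmu i Hi) as [Hm Hmc]; destruct (Hqi i Hi) as [Hqr Hqc].
  unfold lo, hi in Hm, Hmc; unfold lv; destruct (I i) eqn:Ii.
  - assert (Eq : q i - V (c i) = 0).
    { destruct Hmc as [H|[[H Em]|[H Em]]]; [exact H|exfalso|exfalso].
      (* Here [mu i = M] while [V (c i) < q i <= Rr]: excluded by forcing. *)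
      - assert (Rr < V (c i)); [|lra].
        apply (Hforced i Hi M V dV ddV HM HC S1 S2 (Hcv i Hi)); intros t Ht.
        rewrite (HJ i Hi t Ht); apply Ropp_le_contravar; rewrite Rmult_comm.
        apply Rmult_le_compat_l; [now apply a0|].
        destruct (src0 i t Hi) as [_ [_ [H1 _]]]; rewrite Em, Rmax_right in H1 by lra; exact H1.
      (* Here [mu i = -1] while [r <= q i < V (c i)]: the source on [J_i] is switched off
         completely, so [V] is small there. *)
      - assert (V (c i) < r / 2); [|lra]; apply small; [exact Hi|]; intros t Ht.
        assert (Es : src i t = 0).
        { unfold src; rewrite Em, Rmin_right, Rmax_left by lra; ring. }
        rewrite Es, Rmult_0_r; apply Rmult_le_pos; [apply Rmult_le_pos|]; [apply cs_small, Hi|now apply a0|].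
        apply Vpos; lra. }
    assert (Vup : forall t, s i <= t <= e i -> V t <= 2 * q i).
    { intros t Ht; destruct (Hmid i Hi t Ht); lra. }
    assert (Ecl : forall t, s i <= t <= e i -> clamp 0 (lv i) (V t) = V t).
    { intros t Ht; apply clamp_id; split; [apply Vpos; lra|].
      unfold lv; rewrite Ii; specialize (Vup t Ht); lra. }
    assert (Em : mu i = 0).
    { destruct Hqc as [H|[[H Em]|[H Em]]]; [exact H|exfalso|exfalso].
      (* Here [mu i > 0] and [V (c i) = q i = Rr]: the source is at least [a i * G i V], against the
         a priori bound. *)
      - assert (V (c i) < Rr); [|lra].
        apply (Hlarge i Hi Rr V dV ddV (proj2 HRr) HC S1 S2 (Hcv i Hi)); intros t Ht.
        rewrite (HJ i Hi t Ht); apply Ropp_le_contravar, Rmult_le_compat_l; [now apply a0|].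
        unfold src; rewrite Ecl, Rmin_left, Rmax_right by lra; lra.
      (* Here [mu i < 0] and [V (c i) = q i = r]: damping lowers a source that is already sublinear,
         since [V <= 2 * r]. *)
      - assert (V (c i) < r / 2); [|lra]; apply small; [exact Hi|]; intros t Ht.
        unfold src; rewrite Ecl, Rmin_right, Rmax_left by lra.
        specialize (Vup t ltac:(lra)); rewrite Em in Vup.
        assert (Vt : 0 <= V t) by (apply Vpos; lra).
        apply Rle_trans with (a i t * G i (V t)); [|apply cs_bound; [exact Hi|unfold r in Vup|]; lra].
        apply Rmult_le_compat_l; [now apply a0|].
        pose proof (G_nonneg i Hi (V t) Vt); nra. }
    split; [exact Em|split; [|split; [intros _; lra|discriminate]]].
    intros t Ht; specialize (Vup t Ht); lra.
  - assert (Em : mu i = 0) by lra.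
    (* The truncated source is sublinear whatever the size of [V], since [clamp 0 r V] is at most
       [d0] and at most [V]. Then [V <= 2 * V (c i) < r] on [J_i] makes the truncation inactive. *)
    assert (Vc : V (c i) < r / 2).
    { apply small; [exact Hi|]; intros t Ht.
      unfold src; rewrite Em, Rmin_left, Rmax_left by lra.
      replace (_ + 0) with (G i (clamp 0 (lv i) (V t))) by ring.
      assert (Vt : 0 <= V t) by (apply Vpos; lra).
      assert (Hcl := clamp_in 0 (lv i) (V t) (proj1 (Hlv i))).
      assert (El : lv i = r) by (unfold lv; rewrite Ii; reflexivity); rewrite El in Hcl |- *.
      apply cs_bound; [exact Hi|unfold r in *; lra|].
      unfold clamp; apply Rmax_lub; [exact Vt|apply Rmin_r]. }
    split; [exact Em|split; [|split; [discriminate|intros _; lra]]].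
    intros t Ht; destruct (Hmid i Hi t Ht); lra. }
assert (Hfin : forall t, 0 <= t <= L -> ddV t = - (sum_upto (fun i => a (S i) t * G (S i) (V t)) m -
       sum_upto (fun j => beta j * (b j t * k j (V t))) (S m))).
{ intros t Ht; rewrite Hdd by exact Ht; f_equal; f_equal.
  - apply sum_ext; intros i Hi; destruct (key (S i) ltac:(lia)) as [Em [Hle _]].
    rewrite Em, Rmin_left, Rmax_left by lra.
    destruct (Rlt_dec t (s (S i))) as [h|h]; [rewrite a_out by (lia || lra); ring|].
    destruct (Rlt_dec (e (S i)) t) as [h'|h']; [rewrite a_out by (lia || lra); ring|].
    rewrite clamp_id by (split; [apply Vpos; lra|apply Hle; lra]); ring.
  - apply sum_ext; intros j Hj; rewrite clamp_id by (apply HVS; exact Ht); reflexivity. }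
exists V, dV, ddV; split; [exact HC|split; [exact V0|split; [exact VL|split; [exact Hfin|split]]]].
(* Linear growth of the [k j] on [[0, Sv]]. By [zero_propagates] an interior zero would make [V]
   vanish identically, against [r <= V (c i0)]. *)
- assert (growth : exists Kg, 0 <= Kg /\ forall t, 0 <= t <= L -> ddV t <= Kg * V t).
  { assert (term : forall j, exists Kj, 0 <= Kj /\ ((j < S m)%nat -> forall t, 0 <= t <= L ->
       beta j * (b j t * k j (V t)) <= Kj * V t)).
    { intros j; destruct (lt_dec j (S m)) as [Hj|]; [|exists 0; split; [lra|intros; contradiction]].
      destruct (k_lin j) as [l Hl]; [lia|].
      destruct (linear_bound (k j) l Sv) as [ck [Hck Hk]]; [apply k_cont; lia|apply k_zero; lia|exact Hl|unfold Sv; lra|].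
      destruct (b_bdd j) as [Kb HKb]; [lia|].
      assert (Kb0 : 0 <= Kb) by (specialize (HKb 0); lra).
      assert (be0 : 0 <= beta j) by (specialize (Hbeta j ltac:(lia)); lra).
      exists (beta j * (Kb * ck)); split; [repeat apply Rmult_le_pos; lra|].
      intros _ t Ht; specialize (Hk (V t) (HVS t Ht)).
      rewrite !Rmult_assoc; apply Rmult_le_compat_l; [exact be0|].
      apply Rmult_le_compat; [apply b0; lia|apply k_nonneg; [lia|now apply Vpos]|apply HKb|exact Hk]. }
    destruct (choice _ term) as [Kf HKf].
    exists (sum_upto Kf (S m)); split; [apply sum_nonneg; intros; apply HKf|].
    intros t Ht; rewrite Hfin by exact Ht; rewrite <- sum_scal_r.
    assert (0 <= sum_upto (fun i => a (S i) t * G (S i) (V t)) m).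
    { apply sum_nonneg; intros i Hi; apply Rmult_le_pos; [apply a0; lia|apply G_nonneg; [lia|now apply Vpos]]. }
    assert (sum_upto (fun j => beta j * (b j t * k j (V t))) (S m) <= sum_upto (fun j => Kf j * V t) (S m)); [|lra].
    apply sum_le; intros j Hj; now apply HKf. }
  destruct growth as [Kg [Kg0 HKg]]; intros t Ht.
  destruct (Vpos t ltac:(lra)) as [H|H]; [exact H|exfalso].
  assert (Z := zero_propagates V dV ddV L Kg t HC Kg0 Ht Vpos HKg (eq_sym H)).
  destruct (key i0 Hi0) as [_ [_ [H1 _]]]; specialize (H1 Ii0).
  destruct (nodes_in_range i0 Hi0) as [n1 [n2 n3]].
  rewrite Z in H1 by (unfold c; lra); lra.
- intros i Hi; apply key, Hi.
Qed.
End Core.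

(** * Radial solutions in the annulus *)

Lemma hfun_derive (N : nat) (R1 r : R) : (2 <= N)%nat -> 0 < R1 -> 0 < r ->
  is_derive (hfun N R1) r (/ r ^ (N - 1)).
Proof.
intros HN H1 Hr; destruct (Nat.eq_dec N 2) as [->|ne].
- apply (is_derive_ext (fun r => ln (r / R1))); [reflexivity|].
  simpl; auto_derive; [apply Rdiv_lt_0_compat; lra|field; lra].
- apply (is_derive_ext (fun r => (/ R1 ^ (N - 2) - / r ^ (N - 2)) / INR (N - 2))).
  { intros t; unfold hfun; destruct (Nat.eq_dec N 2); [contradiction|reflexivity]. }
  set (n := (N - 3)%nat); replace (N - 2)%nat with (S n) by (unfold n; lia).
  replace (N - 1)%nat with (S (S n)) by (unfold n; lia).
  assert (Hn : INR (S n) <> 0) by (apply not_0_INR; lia).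
  assert (Hp : r ^ n <> 0) by (apply pow_nonzero; lra).
  assert (HR : R1 ^ n <> 0) by (apply pow_nonzero; lra).
  auto_derive; [simpl; nra|].
  rewrite <- !tech_pow_Rmult; simpl pred; field; repeat split; lra || auto.
Qed.

Lemma hfun_R1 (N : nat) (R1 : R) : 0 < R1 -> hfun N R1 R1 = 0.
Proof.
intros H; unfold hfun; destruct (Nat.eq_dec N 2).
- unfold Rdiv; rewrite Rinv_r by lra; apply ln_1.
- unfold Rdiv; rewrite Rminus_diag; ring.
Qed.

Lemma hfun_lt (N : nat) (R1 x y : R) : (2 <= N)%nat -> 0 < R1 -> 0 < x -> x < y -> hfun N R1 x < hfun N R1 y.
Proof.
intros HN H1 Hx Hxy.
destruct (MVT_cor2 (hfun N R1) (fun r => / r ^ (N - 1)) x y Hxy) as [z [Ez Hz]].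
- intros z Hz; apply is_derive_Reals, hfun_derive; lra || exact HN.
- assert (0 < / z ^ (N - 1)) by (apply Rinv_0_lt_compat, pow_lt; lra).
  assert (0 < / z ^ (N - 1) * (y - x)) by (apply Rmult_lt_0_compat; lra); lra.
Qed.

Lemma hfun_le (N : nat) (R1 x y : R) : (2 <= N)%nat -> 0 < R1 -> 0 < x -> x <= y -> hfun N R1 x <= hfun N R1 y.
Proof.
intros HN H1 Hx [Hxy| ->]; [apply Rlt_le, hfun_lt; auto|lra].
Qed.

Lemma hfun_lt_inv (N : nat) (R1 x y : R) : (2 <= N)%nat -> 0 < R1 -> 0 < x -> 0 < y ->
  hfun N R1 x < hfun N R1 y -> x < y.
Proof.
intros HN H1 Hx Hy H; apply Rnot_le_lt; intros Hl.
pose proof (hfun_le N R1 y x HN H1 Hy Hl); lra.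
Qed.

Lemma r_of_hfun (N : nat) (R1 r : R) : (2 <= N)%nat -> 0 < R1 -> 0 < r -> r_of N R1 (hfun N R1 r) = r.
Proof.
intros HN H1 Hr; unfold r_of, hfun; destruct (Nat.eq_dec N 2) as [_|ne].
- rewrite exp_ln by (apply Rdiv_lt_0_compat; lra); field; lra.
- assert (Hn : 0 < INR (N - 2)) by (apply lt_0_INR; lia).
  assert (Hp : 0 < r ^ (N - 2)) by (apply pow_lt; lra).
  replace (_ - INR (N - 2) * _) with (/ r ^ (N - 2)) by (field; repeat split; try apply pow_nonzero; lra).
  unfold Rpower; rewrite ln_Rinv, ln_pow by lra.
  replace (- / INR (N - 2) * - (INR (N - 2) * ln r)) with (ln r) by (field; lra).
  apply exp_ln; lra.
Qed.

Lemma hfun_cont (N : nat) (R1 r : R) : (2 <= N)%nat -> 0 < R1 -> 0 < r -> continuous (hfun N R1) r.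
Proof.
intros HN H1 Hr; apply (ex_derive_continuous (V := R_NormedModule)).
eexists; now apply hfun_derive.
Qed.

Lemma hfun_onto (N : nat) (R1 R2 t : R) : (2 <= N)%nat -> 0 < R1 -> R1 < R2 -> 0 <= t <= hfun N R1 R2 ->
  exists r, R1 <= r <= R2 /\ hfun N R1 r = t.
Proof.
intros HN H1 H12 Ht.
destruct (IVT_gen (fun r => hfun N R1 (clamp R1 R2 r)) R1 R2 t) as [r [Hr Er]].
- intros r; apply continuity_pt_filterlim.
  apply (continuous_comp (clamp R1 R2) (hfun N R1)); [apply clamp_cont|].
  apply hfun_cont; [exact HN|exact H1|pose proof (clamp_in R1 R2 r); lra].
- rewrite !clamp_id by lra; rewrite hfun_R1 by exact H1.
  rewrite Rmin_left, Rmax_right by lra; exact Ht.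
- rewrite Rmin_left, Rmax_right in Hr by lra; rewrite clamp_id in Er by exact Hr.
  exists r; split; assumption.
Qed.

Lemma r_of_range (N : nat) (R1 R2 t : R) : (2 <= N)%nat -> 0 < R1 -> R1 < R2 -> 0 <= t <= hfun N R1 R2 ->
  R1 <= r_of N R1 t <= R2 /\ hfun N R1 (r_of N R1 t) = t.
Proof.
intros HN H1 H12 Ht; destruct (hfun_onto N R1 R2 t HN H1 H12 Ht) as [r [Hr <-]].
rewrite r_of_hfun by lra || exact HN; split; [exact Hr|reflexivity].
Qed.

Lemma r_of_cont (N : nat) (R1 R2 t : R) : (2 <= N)%nat -> 0 < R1 -> R1 < R2 -> 0 <= t <= hfun N R1 R2 ->
  continuous (r_of N R1) t.
Proof.
intros HN H1 H12 Ht; destruct (hfun_onto N R1 R2 t HN H1 H12 Ht) as [r [Hr Er]].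
apply (ex_derive_continuous (V := R_NormedModule)).
unfold hfun in Er; destruct (Nat.eq_dec N 2) as [e2|ne].
- apply (ex_derive_ext (fun t => R1 * exp t)).
  { intros x; unfold r_of; destruct (Nat.eq_dec N 2); [reflexivity|contradiction]. }
  auto_derive; exact I.
- apply (ex_derive_ext (fun t => exp (- / INR (N - 2) * ln (/ R1 ^ (N - 2) - INR (N - 2) * t)))).
  { intros x; unfold r_of; destruct (Nat.eq_dec N 2); [contradiction|reflexivity]. }
  assert (Hn : 0 < INR (N - 2)) by (apply lt_0_INR; lia).
  assert (Hp : 0 < r ^ (N - 2)) by (apply pow_lt; lra).
  auto_derive; rewrite <- Er.
  replace (_ + - _) with (/ r ^ (N - 2)) by (field; repeat split; try apply pow_nonzero; lra).
  now apply Rinv_0_lt_compat.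
Qed.

Lemma aweight_cont_on (N : nat) (R1 R2 : R) (f : R -> R) : (2 <= N)%nat -> 0 < R1 -> R1 < R2 ->
  cont_on_R (fun r => R1 <= r <= R2) f ->
  cont_on_R (fun t => 0 <= t <= hfun N R1 R2) (aweight N R1 f).
Proof.
intros HN H1 H12 Hf t Ht eps He.
set (F := fun r => r ^ (2 * (N - 1)) * f (clamp R1 R2 r)).
assert (CF : forall r, continuous F r).
{ apply cont_mult; [|apply cont_on_clamp; [lra|exact Hf]].
  intros r; apply (ex_derive_continuous (V := R_NormedModule)); auto_derive; exact I. }
assert (CC : continuous (fun t => F (r_of N R1 t)) t).
{ apply (continuous_comp (r_of N R1) F); [now apply (r_of_cont N R1 R2)|apply CF]. }
destruct (proj1 (continuous_eps _ t) CC eps He) as [d [Hd H]].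
exists d; split; [exact Hd|]; intros y Hy Hyt; specialize (H y Hyt); unfold F in H.
destruct (r_of_range N R1 R2 y HN H1 H12 Hy); destruct (r_of_range N R1 R2 t HN H1 H12 Ht).
rewrite !clamp_id in H by assumption; exact H.
Qed.

(** * Continuity and partial derivatives of radial functions *)

Lemma cont_on_comp (N : nat) (S : vec -> Prop) (f : vec -> R) (g : R -> R) :
  cont_on N S f -> (forall x, S x -> continuous g (f x)) -> cont_on N S (fun x => g (f x)).
Proof.
intros Hf Hg x Hx eps He.
destruct (proj1 (continuous_eps g (f x)) (Hg x Hx) eps He) as [d1 [D1 H1]].
destruct (Hf x Hx d1 D1) as [d [Hd H]]; exists d; split; [exact Hd|]; intros y Hy Hxy; auto.
Qed.

Lemma cont_on_plus (N : nat) (S : vec -> Prop) (f g : vec -> R) :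
  cont_on N S f -> cont_on N S g -> cont_on N S (fun x => f x + g x).
Proof.
intros Hf Hg x Hx eps He.
destruct (Hf x Hx (eps / 2)) as [d1 [D1 H1]]; [lra|]; destruct (Hg x Hx (eps / 2)) as [d2 [D2 H2]]; [lra|].
exists (Rmin d1 d2); split; [apply Rmin_glb_lt; lra|]; intros y Hy Hxy.
pose proof (Rmin_l d1 d2); pose proof (Rmin_r d1 d2).
specialize (H1 y Hy ltac:(lra)); specialize (H2 y Hy ltac:(lra)).
apply Rabs_def2 in H1; apply Rabs_def2 in H2; apply Rabs_def1; lra.
Qed.

Lemma cont_on_ext (N : nat) (S : vec -> Prop) (f g : vec -> R) :
  (forall x, f x = g x) -> cont_on N S f -> cont_on N S g.
Proof.
intros E Hf x Hx eps He; destruct (Hf x Hx eps He) as [d [Hd H]]; exists d; split; [exact Hd|].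
intros y Hy Hxy; rewrite <- !E; auto.
Qed.

Lemma cont_on_const (N : nat) (S : vec -> Prop) (c : R) : cont_on N S (fun _ => c).
Proof.
intros x Hx eps He; exists 1; split; [lra|]; intros; rewrite Rminus_diag, Rabs_R0; exact He.
Qed.

(** Polarisation reduces products to squares, which are compositions with a function of one
    variable. *)
Lemma cont_on_mult (N : nat) (S : vec -> Prop) (f g : vec -> R) :
  cont_on N S f -> cont_on N S g -> cont_on N S (fun x => f x * g x).
Proof.
intros Hf Hg.
assert (Hsq : forall (c : R) u, cont_on N S u -> cont_on N S (fun x => c * u x ^ 2)).
{ intros c u Hu; apply (cont_on_comp N S u (fun z => c * z ^ 2) Hu); intros x _.
  apply (ex_derive_continuous (V := R_NormedModule)); auto_derive; exact I. }
apply (cont_on_ext N S (fun x => / 2 * (f x + g x) ^ 2 + (- / 2 * f x ^ 2 + - / 2 * g x ^ 2))).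
- intros x; field.
- repeat apply cont_on_plus; apply Hsq; auto; now apply cont_on_plus.
Qed.

Lemma cont_on_coord (N : nat) (S : vec -> Prop) (k : nat) : (k < N)%nat -> cont_on N S (fun x => x k).
Proof.
intros Hk x Hx eps He; exists eps; split; [exact He|]; intros y Hy Hxy.
eapply Rle_lt_trans; [|exact Hxy].
unfold edist, enorm; rewrite Rabs_minus_sym, <- sqrt_Rsqr_abs; apply sqrt_le_1_alt.
replace (Rsqr (x k - y k)) with ((x k - y k) ^ 2) by (unfold Rsqr; ring).
apply (sum_ge_term (fun j => (x j - y j) ^ 2)); [exact Hk|intros; apply pow2_ge_0].
Qed.

Lemma cont_on_enorm (N : nat) (S : vec -> Prop) : cont_on N S (enorm N).
Proof.
apply (cont_on_comp N S (fun x => sum_upto (fun k => x k ^ 2) N) sqrt).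
- assert (H : forall n, (n <= N)%nat -> cont_on N S (fun x => sum_upto (fun k => x k ^ 2) n)).
  { induction n as [|n IH]; intros Hn; simpl; [apply cont_on_const|].
    apply cont_on_plus; [apply IH; lia|].
    apply (cont_on_mult N S (fun x => x n)); [apply cont_on_coord; lia|].
    apply (cont_on_mult N S (fun x => x n)); [apply cont_on_coord; lia|apply cont_on_const]. }
  apply H; lia.
- intros x _; apply continuous_sqrt.
Qed.

Lemma enorm_upd (N : nat) (x : vec) (k : nat) (t : R) : (k < N)%nat ->
  enorm N (upd x k t) = sqrt (sum_upto (fun j => x j ^ 2) N - x k ^ 2 + t ^ 2).
Proof.
intros Hk; unfold enorm; f_equal.
induction N as [|N IH]; [lia|]; cbn [sum_upto].
destruct (Nat.eq_dec k N) as [->|ne].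
- rewrite (sum_ext (fun j => upd x N t j ^ 2) (fun j => x j ^ 2) N).
  + unfold upd at 1; destruct (Nat.eq_dec N N); [ring|contradiction].
  + intros i Hi; unfold upd; destruct (Nat.eq_dec i N); [lia|reflexivity].
- rewrite IH by lia; unfold upd at 1; destruct (Nat.eq_dec N k); [lia|ring].
Qed.

Lemma enorm_sqr (N : nat) (x : vec) : enorm N x * enorm N x = sum_upto (fun j => x j ^ 2) N.
Proof. apply sqrt_sqrt, sum_nonneg; intros; apply pow2_ge_0. Qed.

Lemma enorm_upd_derive (N : nat) (x : vec) (k : nat) : (k < N)%nat -> 0 < enorm N x ->
  is_derive (fun t => enorm N (upd x k t)) (x k) (x k / enorm N x) /\ enorm N (upd x k (x k)) = enorm N x.
Proof.
intros Hk Hx.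
assert (E : sum_upto (fun j => x j ^ 2) N - x k ^ 2 + x k ^ 2 = enorm N x * enorm N x) by (rewrite enorm_sqr; ring).
assert (E0 : sqrt (sum_upto (fun j => x j ^ 2) N - x k ^ 2 + x k ^ 2) = enorm N x).
{ rewrite E; apply sqrt_square; lra. }
split; [|rewrite enorm_upd by exact Hk; exact E0].
apply (is_derive_ext (fun t => sqrt (sum_upto (fun j => x j ^ 2) N - x k ^ 2 + t ^ 2))).
{ intros t; symmetry; now apply enorm_upd. }
set (Q := sum_upto (fun j => x j ^ 2) N - x k ^ 2) in *.
auto_derive.
- assert (0 < enorm N x * enorm N x) by (apply Rmult_lt_0_compat; lra).
  simpl in E; simpl; lra.
- replace (Q + x k * (x k * 1)) with (Q + x k ^ 2) by ring; rewrite E0; field; lra.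
Qed.

Lemma sum_affine (f : nat -> R) (c d : R) (n : nat) :
  sum_upto (fun k => f k * c + d) n = sum_upto f n * c + INR n * d.
Proof.
induction n as [|n IH]; [simpl; ring|].
rewrite S_INR; cbn [sum_upto]; rewrite IH; ring.
Qed.

Lemma is_derive_quotient_pow (p w n : R -> R) (t p' w' n' : R) (N : nat) : (1 <= N)%nat -> n t <> 0 ->
  is_derive p t p' -> is_derive w t w' -> is_derive n t n' ->
  is_derive (fun z => p z * (w z / n z ^ N)) t
    (p' * (w t / n t ^ N) + p t * (w' / n t ^ N - INR N * w t * n' / n t ^ (N + 1))).
Proof.
intros HN Hn Hp Hw Hn'; destruct N as [|N]; [lia|].
assert (Hq : n t ^ N <> 0) by now apply pow_nonzero.
auto_derive.
- repeat split; try (eexists; eassumption).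
  cbn [pow]; now apply Rmult_integral_contrapositive_currified.
- replace (Derive (fun z : R => p z) t) with p' by (symmetry; now apply is_derive_unique).
  replace (Derive (fun z : R => w z) t) with w' by (symmetry; now apply is_derive_unique).
  replace (Derive (fun z : R => n z) t) with n' by (symmetry; now apply is_derive_unique).
  rewrite pow_add, pow_1, <- !tech_pow_Rmult; simpl pred.
  change (match N with O => 1 | S _ => INR N + 1 end) with (INR (S N)); field; auto.
Qed.

(** Since [h' = r^(1 - N)], the gradient is [dV (h |x|) * x / |x|^N]. The field [x / |x|^N] is
    divergence free, so the Laplacian is just [ddV (h |x|) / |x|^(2 * (N - 1))]. *)
Lemma radial_lift (N : nat) (R1 R2 : R) (F : vec -> R -> R) (V dV ddV : R -> R) :
  (2 <= N)%nat -> 0 < R1 -> R1 < R2 -> C2 V dV ddV -> V 0 = 0 -> V (hfun N R1 R2) = 0 ->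
  (forall t, 0 < t < hfun N R1 R2 -> 0 < V t) ->
  (forall x, annulus N R1 R2 x ->
     - (ddV (hfun N R1 (enorm N x)) / enorm N x ^ (2 * (N - 1))) = F x (V (hfun N R1 (enorm N x)))) ->
  pos_radial_solution N R1 R2 F (fun x => V (hfun N R1 (enorm N x))).
Proof.
intros HN H1 H12 HC V0 VL Vp HF.
set (rho := enorm N); set (h := hfun N R1).
destruct (C2_cont _ _ _ HC) as [cV [cdV cddV]].
exists (fun k x => dV (h (rho x)) * (x k / rho x ^ N)).
exists (fun k l x => ddV (h (rho x)) * (x l / rho x ^ N) * (x k / rho x ^ N) +
  dV (h (rho x)) * ((if Nat.eq_dec k l then 1 else 0) / rho x ^ N
     - INR N * x k * (x l / rho x) / rho x ^ (N + 1))).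
assert (comp : forall (f df : R -> R) x l, (l < N)%nat -> 0 < rho x -> (forall t, is_derive f t (df t)) ->
   is_derive (fun t => f (h (rho (upd x l t)))) (x l) (df (h (rho x)) * (x l / rho x ^ N))).
{ intros f df x l Hl Hx Hf; destruct (enorm_upd_derive N x l Hl Hx) as [Hn En]; fold rho in Hn, En.
  assert (Hh : is_derive (fun t => h (rho (upd x l t))) (x l) (/ rho x ^ (N - 1) * (x l / rho x))).
  { assert (Hd := is_derive_comp h (fun t => rho (upd x l t)) (x l) (/ rho x ^ (N - 1)) (x l / rho x)).
    cbv beta in Hd; rewrite En in Hd.
    specialize (Hd (hfun_derive N R1 (rho x) HN H1 Hx) Hn).
    unfold scal in Hd; simpl in Hd; unfold mult in Hd; simpl in Hd.
    rewrite Rmult_comm; exact Hd. }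
  assert (Hd := is_derive_comp f (fun t => h (rho (upd x l t))) (x l) (df (h (rho x))) (/ rho x ^ (N - 1) * (x l / rho x))).
  cbv beta in Hd; rewrite En in Hd; specialize (Hd (Hf _) Hh).
  unfold scal in Hd; simpl in Hd; unfold mult in Hd; simpl in Hd.
  replace (df (h (rho x)) * (x l / rho x ^ N)) with (/ rho x ^ (N - 1) * (x l / rho x) * df (h (rho x))); [exact Hd|].
  assert (E : rho x ^ N = rho x * rho x ^ (N - 1)) by (rewrite tech_pow_Rmult; f_equal; lia).
  rewrite E; field; split; [apply pow_nonzero|]; lra. }
assert (Hrho : forall x, annulus N R1 R2 x -> 0 < rho x) by (intros x [_ Hx]; unfold rho; lra).
assert (Hcl : forall x, annulus_cl N R1 R2 x -> 0 < rho x) by (intros x [_ Hx]; unfold rho; lra).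
assert (Ch : cont_on N (annulus_cl N R1 R2) (fun x => h (rho x))).
{ apply (cont_on_comp N _ rho h); [apply cont_on_enorm|].
  intros x Hx; apply hfun_cont; auto. }
assert (Cf : forall f : R -> R, (forall t, continuous f t) -> cont_on N (annulus_cl N R1 R2) (fun x => f (h (rho x)))).
{ intros f Hf; apply (cont_on_comp N _ (fun x => h (rho x)) f Ch); auto. }
assert (Ci : forall n, cont_on N (annulus_cl N R1 R2) (fun x => / rho x ^ n)).
{ intros n; apply (cont_on_comp N _ rho (fun z => / z ^ n)); [apply cont_on_enorm|].
  intros x Hx; apply (ex_derive_continuous (V := R_NormedModule)); auto_derive.
  apply pow_nonzero; specialize (Hcl x Hx); lra. }
assert (Cx : forall k n, (k < N)%nat -> cont_on N (annulus_cl N R1 R2) (fun x => x k / rho x ^ n)).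
{ intros k n Hk; apply (cont_on_mult N _ (fun x => x k) (fun x => / rho x ^ n)); [now apply cont_on_coord|apply Ci]. }
split; [|split; [|split; [|split; [|split; [|split; [|split; [|split]]]]]]].
- intros x Hx k Hk; apply is_derive_Reals; apply comp; auto; apply HC.
- intros x Hx k l Hk Hl; apply is_derive_Reals; unfold is_partial.
  specialize (Hrho x Hx); destruct (enorm_upd_derive N x l Hl Hrho) as [Hn En]; fold rho in Hn, En.
  assert (Hw : is_derive (fun t => upd x l t k) (x l) (if Nat.eq_dec k l then 1 else 0)).
  { unfold upd; destruct (Nat.eq_dec k l); [apply (is_derive_id (K := R_AbsRing))|].
    apply (is_derive_const (V := R_NormedModule)). }
  assert (Ew : upd x l (x l) k = x k) by (unfold upd; destruct (Nat.eq_dec k l); congruence).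
  assert (Hp := comp dV ddV x l Hl Hrho (proj1 (proj2 HC))).
  assert (Hnz : rho (upd x l (x l)) <> 0) by (rewrite En; lra).
  assert (Hd := is_derive_quotient_pow (fun t => dV (h (rho (upd x l t)))) (fun t => upd x l t k)
    (fun t => rho (upd x l t)) (x l) _ _ _ N ltac:(lia) Hnz Hp Hw Hn).
  cbv beta in Hd; rewrite En, Ew in Hd; exact Hd.
- now apply Cf.
- intros k Hk; apply (cont_on_mult N _ (fun x => dV (h (rho x)))); [now apply Cf|now apply Cx].
- intros k l Hk Hl; apply cont_on_plus.
  + apply (cont_on_mult N _ (fun x => ddV (h (rho x)) * (x l / rho x ^ N))); [|now apply Cx].
    apply (cont_on_mult N _ (fun x => ddV (h (rho x)))); [now apply Cf|now apply Cx].
  + apply (cont_on_mult N _ (fun x => dV (h (rho x)))); [now apply Cf|].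
    apply (cont_on_plus N _ (fun x => (if Nat.eq_dec k l then 1 else 0) / rho x ^ N)
       (fun x => - (INR N * x k * (x l / rho x) / rho x ^ (N + 1)))).
    * apply (cont_on_mult N _ (fun _ => if Nat.eq_dec k l then 1 else 0)); [apply cont_on_const|apply Ci].
    * apply (cont_on_ext N _ (fun x => (- INR N) * ((x k / rho x ^ (N + 1)) * (x l / rho x ^ 1)))).
      { intros x; simpl; unfold Rdiv; rewrite Rmult_1_r; ring. }
      apply (cont_on_mult N _ (fun _ => - INR N)); [apply cont_on_const|].
      apply (cont_on_mult N _ (fun x => x k / rho x ^ (N + 1))); now apply Cx.
- intros x Hx; rewrite <- HF by exact Hx; f_equal; specialize (Hrho x Hx); fold rho h.
  set (p := ddV (h (rho x))); set (q := dV (h (rho x))).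
  destruct N as [|[|n]]; [lia|lia|].
  assert (Hn : rho x ^ n <> 0) by (apply pow_nonzero; lra).
  (* Grouped so that the squares sum to [|x|^2]; the two terms with [q] then cancel, being minus and
     plus [N * q / |x|^N]. *)
  rewrite (sum_ext _ (fun k => x k ^ 2 * (p / (rho x ^ S (S n)) ^ 2 - q * INR (S (S n)) / (rho x * rho x ^ (S (S n) + 1)))
    + q / rho x ^ S (S n))).
  2: { intros k Hk; destruct (Nat.eq_dec k k) as [_|]; [|contradiction].
       rewrite pow_add, pow_1, <- !tech_pow_Rmult; field; split; auto; lra. }
  rewrite sum_affine, <- enorm_sqr; fold rho.
  replace (2 * (S (S n) - 1))%nat with (S (S (n + n)))%nat by lia.
  rewrite pow_add, pow_1, <- !tech_pow_Rmult, pow_add; field; split; auto; lra.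
- intros x [_ [Hx|Hx]]; unfold h, rho; rewrite Hx; [rewrite hfun_R1 by exact H1; exact V0|exact VL].
- intros x [_ Hx]; apply Vp; split.
  + rewrite <- (hfun_R1 N R1 H1); apply hfun_lt; unfold rho; lra || auto; lra.
  + apply hfun_lt; unfold rho; lra || auto; lra.
- exists (fun r => V (h r)); reflexivity.
Qed.

(** Allows the clamped extension, continuous on the whole line, to replace the original weight in
    the eigenvalue hypotheses. *)
Lemma first_eig_ext (a a' : R -> R) (s e lam : R) : (forall t, s < t < e -> a t = a' t) ->
  first_eig a s e lam -> first_eig a' s e lam.
Proof.
assert (ext : forall f f' mu, (forall t, s < t < e -> f t = f' t) -> dirichlet_eig f s e mu -> dirichlet_eig f' s e mu).
{ intros f f' mu E [u [du [Hd H]]]; exists u, du; split; [|exact H].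
  intros t Ht; rewrite <- E by exact Ht; now apply Hd. }
intros E [H1 [H2 H3]]; split; [exact H1|split; [now apply (ext a)|]].
intros mu Hmu H; apply H3; [exact Hmu|]; apply (ext a'); [|exact H].
intros t Ht; symmetry; now apply E.
Qed.

Lemma clamped_aweight (N : nat) (R1 R2 : R) (f : R -> R) : (2 <= N)%nat -> 0 < R1 -> R1 < R2 ->
  cont_on_R (fun r => R1 <= r <= R2) f -> (forall r, R1 <= r <= R2 -> 0 <= f r) ->
  let w := fun t => aweight N R1 f (clamp 0 (hfun N R1 R2) t) in
  (forall t, continuous w t) /\ (exists K, forall t, 0 <= w t <= K) /\
  (forall r, R1 <= r <= R2 -> w (hfun N R1 r) = r ^ (2 * (N - 1)) * f r).
Proof.
intros HN H1 H12 Hc Hp; set (L := hfun N R1 R2); intros w.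
assert (HL : 0 < L) by (rewrite <- (hfun_R1 N R1 H1); now apply hfun_lt).
assert (Hrange : forall r, R1 <= r <= R2 -> 0 <= hfun N R1 r <= L).
{ intros r Hr; split; [rewrite <- (hfun_R1 N R1 H1)|]; apply hfun_le; lra || exact HN. }
assert (Cw : forall t, continuous w t).
{ apply cont_on_clamp; [exact (Rlt_le _ _ HL)|now apply aweight_cont_on]. }
assert (w0 : forall t, 0 <= w t).
{ intros t; unfold w, aweight.
  destruct (r_of_range N R1 R2 (clamp 0 L t) HN H1 H12) as [Hr _]; [exact (clamp_in 0 L t (Rlt_le _ _ HL))|].
  apply Rmult_le_pos; [apply pow_le; lra|now apply Hp]. }
split; [exact Cw|split].
- destruct (clamped_bdd (aweight N R1 f) 0 L ltac:(lra) Cw) as [K [_ HK]].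
  exists K; intros t; split; [apply w0|]; eapply Rle_trans; [apply Rle_abs|apply HK].
- intros r Hr; unfold w; rewrite clamp_id by (now apply Hrange).
  unfold aweight; rewrite r_of_hfun by lra || exact HN; reflexivity.
Qed.

Lemma enorm_axis (N : nat) (r : R) : (1 <= N)%nat -> 0 <= r ->
  enorm N (fun k => if Nat.eq_dec k 0 then r else 0) = r.
Proof.
intros HN Hr; unfold enorm; rewrite (sum_single _ N 0%nat).
- simpl; rewrite Rmult_1_r; now apply sqrt_square.
- lia.
- intros i _ ne; destruct (Nat.eq_dec i 0); [contradiction|ring].
Qed.

Lemma nonzero_has_low_bit (m n : nat) : (0 < n < 2 ^ m)%nat -> exists i, (i < m)%nat /\ Nat.testbit n i = true.
Proof.
intros Hn; apply NNPP; intros H; assert (n = 0%nat); [|lia].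
apply Nat.bits_inj_0; intros i; destruct (lt_dec i m) as [Hi|Hi].
- destruct (Nat.testbit n i) eqn:E; [exfalso; apply H; now exists i|reflexivity].
- rewrite <- (Nat.mod_small n (2 ^ m)) by lia; apply Nat.mod_pow2_bits_high; lia.
Qed.

(** Numbers below [2 ^ m] have no bits from [m] on. This yields an interval on which two of the
    solutions behave differently. *)
Lemma low_bits_differ (m n n' : nat) : (n < 2 ^ m)%nat -> (n' < 2 ^ m)%nat -> n <> n' ->
  exists i, (i < m)%nat /\ Nat.testbit n i <> Nat.testbit n' i.
Proof.
intros Hn Hn' ne; apply NNPP; intros H; apply ne, Nat.bits_inj; intros i.
destruct (lt_dec i m) as [Hi|Hi].
- destruct (Bool.bool_dec (Nat.testbit n i) (Nat.testbit n' i)) as [E|E]; [exact E|].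
  exfalso; apply H; now exists i.
- rewrite <- (Nat.mod_small n (2 ^ m)), <- (Nat.mod_small n' (2 ^ m)) by lia.
  rewrite !Nat.mod_pow2_bits_high by lia; reflexivity.
Qed.

Theorem theorem5p1 (N m : nat) (R1 R2 : R) (alpha : nat -> R)
  (A B g k : nat -> R -> R) (sigma tau : nat -> R) (lam0 : R) (lam1 : nat -> R) :
  (2 <= N)%nat -> 0 < R1 -> R1 < R2 -> (1 <= m)%nat ->
  (* data *)
  (forall i, (1 <= i <= m)%nat -> 0 < alpha i) ->
  (forall i, (1 <= i <= m)%nat ->
     cont_on_R (fun r => R1 <= r <= R2) (A i) /\
     (forall r, R1 <= r <= R2 -> 0 <= A i r)) ->
  (forall j, (j <= m)%nat ->
     cont_on_R (fun r => R1 <= r <= R2) (B j) /\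
     (forall r, R1 <= r <= R2 -> 0 <= B j r)) ->
  (forall i, (1 <= i <= m)%nat ->
     cont_on_R (fun s => 0 <= s) (g i) /\ (forall s, 0 <= s -> 0 <= g i s)) ->
  (forall j, (j <= m)%nat ->
     cont_on_R (fun s => 0 <= s) (k j) /\ (forall s, 0 <= s -> 0 <= k j s)) ->
  (* (h_1^* ) *)
  h1star m R1 R2 A B sigma tau ->
  (* (h_2) *)
  (forall i, (1 <= i <= m)%nat -> g i 0 = 0 /\ (forall s, 0 < s -> 0 < g i s)) ->
  (forall j, (j <= m)%nat -> k j 0 = 0 /\ (forall s, 0 < s -> 0 < k j s)) ->
  (* (h_3) *)
  (forall i, (1 <= i <= m)%nat ->
     (exists L, limsup0_lt (fun s => g i s / s) L) /\
     liminfinf_gt (fun s => g i s / s) 0) ->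
  (forall j, (j <= m)%nat -> exists L, limsup0_lt (fun s => k j s / s) L) ->
  (* eigenvalues *)
  first_eig (fun t => sum_upto (fun i => aweight N R1 (A (S i)) t) m)
            0 (hfun N R1 R2) lam0 ->
  (forall i, (1 <= i <= m)%nat ->
     first_eig (aweight N R1 (A i)) (hfun N R1 (sigma i)) (hfun N R1 (tau i))
               (lam1 i)) ->
  (* alpha_i g_0^i < lam0  and  alpha_i g_oo^i > lam1^i *)
  (forall i, (1 <= i <= m)%nat ->
     limsup0_lt (fun s => g i s / s) (lam0 / alpha i) /\
     liminfinf_gt (fun s => g i s / s) (lam1 i / alpha i)) ->
  exists beta_star, 0 < beta_star /\
    forall beta : nat -> R, (forall j, (j <= m)%nat -> beta_star < beta j) ->
      exists sols : nat -> vec -> R,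
        (forall n, (n < 2 ^ m - 1)%nat ->
           pos_radial_solution N R1 R2 (Fnl N m alpha beta A B g k) (sols n)) /\
        (forall n1 n2, (n1 < 2 ^ m - 1)%nat -> (n2 < 2 ^ m - 1)%nat -> n1 <> n2 ->
           exists x, annulus_cl N R1 R2 x /\ sols n1 x <> sols n2 x).
Proof.
intros HN H1 H12 Hm Hal HA HB Hg Hk Hstar Hg2 Hk2 _ Hk3 Hlam0 Hlam1 Hlam.
destruct Hstar as [t0 [sm [c1 [cm [Hst [Hts [HAs HBs]]]]]]].
set (h := hfun N R1) in *; set (L := h R2) in *.
assert (Hts' : forall i, (i <= m)%nat -> tau i <= sigma (S i)).
{ intros i Hi; destruct (Nat.eq_dec i 0) as [->|]; [exact c1|].
  destruct (Nat.eq_dec i m) as [->|]; [exact cm|apply Rlt_le, Hts; lia]. }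
assert (tau_lo : forall i, (i <= m)%nat -> R1 <= tau i).
{ induction i as [|i IH]; intros Hi; [lra|].
  specialize (IH ltac:(lia)); specialize (Hts' i ltac:(lia)); specialize (Hst (S i) ltac:(lia)); lra. }
assert (sig_lo : forall i, (1 <= i <= S m)%nat -> R1 <= sigma i).
{ intros i Hi; specialize (tau_lo (pred i) ltac:(lia)); specialize (Hts' (pred i) ltac:(lia)).
  replace (S (pred i)) with i in Hts' by lia; lra. }
assert (tau_hi : forall d, (d <= m)%nat -> tau (m - d)%nat <= R2).
{ induction d as [|d IH]; intros Hd; [rewrite Nat.sub_0_r; lra|].
  specialize (IH ltac:(lia)); specialize (Hts' (m - S d)%nat ltac:(lia)).
  replace (S (m - S d)) with (m - d)%nat in Hts' by lia; specialize (Hst (m - d)%nat ltac:(lia)); lra. }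
assert (nodes : forall i, (1 <= i <= m)%nat -> R1 <= sigma i /\ sigma i < tau i /\ tau i <= R2).
{ intros i Hi; specialize (tau_hi (m - i)%nat ltac:(lia)); replace (m - (m - i))%nat with i in tau_hi by lia.
  split; [apply sig_lo; lia|split; [now apply Hst|exact tau_hi]]. }
assert (gaps : forall j, (j <= m)%nat -> R1 <= tau j /\ tau j <= sigma (S j) /\ sigma (S j) <= R2).
{ intros j Hj; split; [now apply tau_lo|split; [now apply Hts'|]].
  destruct (Nat.eq_dec j m) as [->|ne]; [lra|]; destruct (nodes (S j) ltac:(lia)); lra. }
assert (hlt : forall x y, R1 <= x -> x < y -> h x < h y) by (intros; apply hfun_lt; auto; lra).
assert (hle : forall x y, R1 <= x -> x <= y -> h x <= h y) by (intros; apply hfun_le; auto; lra).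
assert (hinv : forall x y, R1 <= x -> R1 <= y -> h x < h y -> x < y).
{ intros x y Hx Hy; apply hfun_lt_inv; auto; lra. }
assert (h0 : h R1 = 0) by (apply hfun_R1; lra).
assert (HL : 0 < L) by (rewrite <- h0; apply hlt; lra).
assert (honto : forall t, 0 <= t <= L -> exists r, R1 <= r <= R2 /\ h r = t) by (intros; now apply hfun_onto).
assert (hrange : forall r, R1 <= r <= R2 -> 0 <= h r <= L).
{ intros r Hr; split; [rewrite <- h0; apply hle; lra|apply hle; lra]. }
assert (powpos : forall r, R1 <= r -> 0 < r ^ (2 * (N - 1))) by (intros; apply pow_lt; lra).
set (a := fun i t => aweight N R1 (A i) (clamp 0 L t)).
set (b := fun j t => aweight N R1 (B j) (clamp 0 L t)).
assert (aE : forall i t, 0 <= t <= L -> a i t = aweight N R1 (A i) t).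
{ intros i t Ht; unfold a; rewrite clamp_id by exact Ht; reflexivity. }
assert (Wa : forall i, (1 <= i <= m)%nat -> (forall t, continuous (a i) t) /\ (exists K, forall t, 0 <= a i t <= K) /\
   (forall r, R1 <= r <= R2 -> a i (h r) = r ^ (2 * (N - 1)) * A i r)).
{ intros i Hi; destruct (HA i Hi); now apply clamped_aweight. }
assert (Wb : forall j, (j <= m)%nat -> (forall t, continuous (b j) t) /\ (exists K, forall t, 0 <= b j t <= K) /\
   (forall r, R1 <= r <= R2 -> b j (h r) = r ^ (2 * (N - 1)) * B j r)).
{ intros j Hj; destruct (HB j Hj); now apply clamped_aweight. }
assert (a0 : forall i t, (1 <= i <= m)%nat -> 0 <= a i t).
{ intros i t Hi; destruct (Wa i Hi) as [_ [[K HK] _]]; apply HK. }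
set (s := fun i => h (sigma i)); set (e := fun i => h (tau i)).
assert (Hse : forall i, (1 <= i <= m)%nat -> 0 <= s i /\ s i < e i /\ e i <= L).
{ intros i Hi; destruct (nodes i Hi) as [n1 [n2 n3]]; unfold s, e.
  split; [apply hrange; lra|split; [apply hlt; lra|apply hrange; lra]]. }
assert (aw : forall i, (1 <= i <= m)%nat -> weight (a i) (s i) (e i)).
{ intros i Hi; destruct (nodes i Hi) as [n1 [n2 n3]]; destruct (Wa i Hi) as [w1 [_ w3]].
  split; [apply Hse, Hi|split; [exact w1|split; [intros; now apply a0|]]].
  destruct (HAs i Hi) as [[r [Hr Hne]] _]; exists (h r); split; [split; apply hle; lra|].
  rewrite w3 by lra; apply Rmult_integral_contrapositive_currified; [|exact Hne].
  apply Rgt_not_eq, powpos; lra. }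
assert (a_out : forall i, (1 <= i <= m)%nat -> forall t, 0 <= t <= L -> t < s i \/ e i < t -> a i t = 0).
{ intros i Hi t Ht Hor; destruct (nodes i Hi) as [n1 [n2 n3]]; destruct (Wa i Hi) as [_ [_ w3]].
  destruct (honto t Ht) as [r [Hr <-]]; rewrite w3 by exact Hr.
  rewrite (proj2 (HAs i Hi) r Hr); [ring|].
  destruct Hor as [Ho|Ho]; [left|right]; apply hinv; auto; lra. }
assert (Eig1 : forall i, (1 <= i <= m)%nat -> exists phi dphi ddphi, pos_eig (a i) (s i) (e i) (lam1 i) phi dphi ddphi).
{ intros i Hi; apply first_eig_pos; [now apply aw|].
  apply (first_eig_ext (aweight N R1 (A i))); [|now apply Hlam1].
  intros t Ht; destruct (Hse i Hi) as [n1 [n2 n3]]; symmetry; apply aE; lra. }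
(* Domain monotonicity, as the total weight equals [a i] on [J_i]. It turns the condition at 0,
   stated with [lam0], into sublinearity below the eigenvalue of each [J_i]. *)
assert (lam_le : forall i, (1 <= i <= m)%nat -> lam0 <= lam1 i).
{ assert (ww : weight (fun t => sum_upto (fun i => a (S i) t) m) 0 L).
  { split; [exact HL|split; [|split]].
    - apply cont_sum; intros i Hi; apply Wa; lia.
    - intros t _; apply sum_nonneg; intros i Hi; apply a0; lia.
    - destruct (weight_interior _ _ _ (aw 1%nat ltac:(lia))) as [t [Ht Hp]].
      destruct (Hse 1%nat ltac:(lia)) as [n1 [n2 n3]]; exists t; split; [lra|].
      pose proof (sum_ge_term (fun i => a (S i) t) m 0 ltac:(lia) (fun i Hi => a0 (S i) t ltac:(lia))) as H.
      cbv beta in H; lra. }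
  destruct (first_eig_pos _ 0 L lam0 ww) as [w [dw [ddw Hw]]].
  { apply (first_eig_ext (fun t => sum_upto (fun i => aweight N R1 (A (S i)) t) m)); [|exact Hlam0].
    intros t Ht; apply sum_ext; intros i _; symmetry; apply aE; lra. }
  intros i Hi; destruct (Eig1 i Hi) as [phi [dphi [ddphi Hphi]]]; destruct (Hse i Hi) as [n1 [n2 n3]].
  apply (pos_eig_mono _ _ _ _ _ _ _ _ _ _ _ _ _ _ Hw Hphi n1 n2 n3).
  intros t Ht; split; [now apply a0|].
  rewrite (sum_single _ m (pred i)); [f_equal; lia|lia|].
  intros i' Hi' ne; apply a_out; [lia|lra|].
  assert (mono : forall x y, (x < y)%nat -> (1 <= x)%nat -> (y <= m)%nat -> tau x < sigma y).
  { intros x y Hxy Hx; induction Hxy as [|y Hxy IH]; intros Hy; [apply Hts; lia|].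
    specialize (IH ltac:(lia)); destruct (nodes y ltac:(lia)); specialize (Hts y ltac:(lia)); lra. }
  destruct (nodes i Hi); destruct (nodes (S i') ltac:(lia)).
  destruct (Nat.lt_total i (S i')) as [l|[l|l]]; [left|lia|right].
  - apply Rle_lt_trans with (e i); [lra|]; apply hlt; [lra|apply mono; lia].
  - apply Rlt_le_trans with (s i); [|lra]; apply hlt; [lra|apply mono; lia]. }
set (G := fun i x => alpha i * g i x).
assert (lam1_pos : forall i, (1 <= i <= m)%nat -> 0 < lam1 i) by (intros i Hi; apply (Hlam1 i Hi)).
assert (Hcs : forall i, exists c, (1 <= i <= m)%nat -> 0 <= c < lam1 i /\
   exists d, 0 < d /\ forall x, 0 <= x <= d -> G i x <= c * x).
{ intros i; destruct (classic (1 <= i <= m)%nat) as [Hi|]; [|exists 0; intros; contradiction].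
  destruct (Hlam i Hi) as [[c0 [Hc0 [d [Hd Hs]]]] _]; specialize (Hal i Hi).
  exists (Rmax 0 (alpha i * c0)); intros _.
  pose proof (Rmax_l 0 (alpha i * c0)); pose proof (Rmax_r 0 (alpha i * c0)).
  split; [split; [lra|]|].
  - apply Rmax_lub_lt; [now apply lam1_pos|]; apply Rlt_le_trans with lam0; [|now apply lam_le].
    apply Rlt_div_r in Hc0; [lra|exact Hal].
  - exists (d / 2); split; [lra|]; intros x Hx; unfold G.
    destruct (Req_dec x 0) as [->|nx]; [rewrite (proj1 (Hg2 i Hi)); lra|].
    specialize (Hs x ltac:(lra)); apply Rle_div_l in Hs; [|lra].
    apply Rle_trans with (alpha i * (c0 * x)); [apply Rmult_le_compat_l; lra|].
    rewrite <- Rmult_assoc; apply Rmult_le_compat_r; lra. }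
destruct (choice _ Hcs) as [cs Hcs']; clear Hcs.
destruct (finite_small (fun i => (1 <= i <= m)%nat) (fun i d => forall x, 0 <= x <= d -> G i x <= cs i * x) m)
  as [d0 [Hd0 Hsm]].
{ intros i _ Hi; destruct (Hcs' i Hi) as [_ [d [Hd Hx]]].
  exists d; split; [exact Hd|]; intros y Hy x Hx'; apply Hx; lra. }
assert (cont_G : forall i, (1 <= i <= m)%nat -> cont_on_R (fun x => 0 <= x) (G i)).
{ intros i Hi x Hx eps He; specialize (Hal i Hi).
  destruct (proj1 (Hg i Hi) x Hx (eps / alpha i)) as [d [Hd H]]; [now apply Rdiv_lt_0_compat|].
  exists d; split; [exact Hd|]; intros y Hy Hxy; unfold G.
  replace (_ - _) with (alpha i * (g i y - g i x)) by ring.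
  rewrite Rabs_mult, (Rabs_pos_eq (alpha i)) by lra.
  specialize (H y Hy Hxy); apply Rlt_div_r in H; [lra|exact Hal]. }
destruct (multiplicity_1d m L s e a b G k lam1 cs d0) as [r [bs [Hr [Hbs Hcore]]]].
{ exact HL. }
{ unfold e; rewrite t0; exact h0. }
{ unfold s; rewrite sm; reflexivity. }
{ intros i Hi; apply Hse, Hi. }
{ intros i Hi; apply hle; apply gaps; lia. }
{ intros i Hi; apply hlt; [apply tau_lo; lia|now apply Hts]. }
{ exact aw. }
{ intros i Hi; apply Wa, Hi. }
{ exact a_out. }
{ intros j Hj; apply Wb, Hj. }
{ intros j Hj; apply Wb, Hj. }
{ intros j Hj t Ht Hor; destruct (gaps j Hj) as [n1 [n2 n3]]; destruct (Wb j Hj) as [_ [_ w3]].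
  destruct (honto t Ht) as [x [Hx <-]]; rewrite w3 by exact Hx.
  rewrite (proj1 (HBs j Hj) x Hx); [ring|].
  destruct Hor as [Ho|Ho]; [left|right]; apply hinv; auto; lra. }
{ intros j Hj Hlt d Hd; destruct (gaps j Hj) as [n1 [n2 n3]]; destruct (Wb j Hj) as [_ [_ w3]].
  assert (Hlt' : tau j < sigma (S j)) by (apply hinv; auto; lra).
  destruct (proj1 (continuous_eps h (tau j)) (hfun_cont N R1 (tau j) HN H1 ltac:(lra)) d Hd) as [d' [Hd' Hc]].
  destruct (proj1 (proj2 (HBs j Hj) Hlt') d' Hd') as [x [Hx1 [Hx2 Hx3]]].
  specialize (Hc x ltac:(apply Rabs_def1; lra)); apply Rabs_def2 in Hc.
  exists (h x); split; [split; [apply hle; lra|unfold e; lra]|split; [apply hle; lra|]].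
  rewrite w3 by lra; apply Rmult_integral_contrapositive_currified; [|exact Hx3].
  apply Rgt_not_eq, powpos; lra. }
{ intros j Hj Hlt d Hd; destruct (gaps j Hj) as [n1 [n2 n3]]; destruct (Wb j Hj) as [_ [_ w3]].
  assert (Hlt' : tau j < sigma (S j)) by (apply hinv; auto; lra).
  destruct (proj1 (continuous_eps h (sigma (S j))) (hfun_cont N R1 (sigma (S j)) HN H1 ltac:(lra)) d Hd) as [d' [Hd' Hc]].
  destruct (proj2 (proj2 (HBs j Hj) Hlt') d' Hd') as [x [Hx1 [Hx2 Hx3]]].
  specialize (Hc x ltac:(apply Rabs_def1; lra)); apply Rabs_def2 in Hc.
  exists (h x); split; [split; [unfold s; lra|apply hle; lra]|split; [apply hle; lra|]].
  rewrite w3 by lra; apply Rmult_integral_contrapositive_currified; [|exact Hx3].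
  apply Rgt_not_eq, powpos; lra. }
{ exact cont_G. }
{ intros i Hi x Hx; apply Rmult_le_pos; [apply Rlt_le, Hal, Hi|now apply Hg]. }
{ intros j Hj; apply Hk, Hj. }
{ intros j Hj; apply Hk2, Hj. }
{ intros j Hj; apply Hk2, Hj. }
{ exact Hk3. }
{ exact lam1_pos. }
{ exact Eig1. }
{ exact Hd0. }
{ intros i Hi; split; [apply Hcs', Hi|]; apply (Hsm i (proj2 Hi) Hi); lra. }
(* The liminf gives [alpha i * c0 * x <= G i x] beyond [M]; for smaller [x] the constant
   [alpha i * c0 * M] makes the affine minorant nonpositive. *)
{ intros i Hi; destruct (Hlam i Hi) as [_ [c0 [Hc0 [M0 HM0]]]]; assert (Hai := Hal i Hi).
  assert (Hc : lam1 i < alpha i * c0) by (apply Rlt_div_l in Hc0; [lra|exact Hai]).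
  set (M := Rmax M0 1); assert (M0 <= M /\ 1 <= M) by (split; [apply Rmax_l|apply Rmax_r]).
  exists (alpha i * c0), (alpha i * c0 * M); split; [exact Hc|]; intros x Hx; unfold G.
  specialize (lam1_pos i Hi); destruct (Rlt_le_dec M x) as [l|l].
  - specialize (HM0 x ltac:(lra)); apply Rle_div_r in HM0; [|lra].
    assert (alpha i * (c0 * x) <= alpha i * g i x) by (apply Rmult_le_compat_l; lra).
    assert (0 <= alpha i * c0 * M) by (apply Rmult_le_pos; lra); lra.
  - assert (alpha i * c0 * x <= alpha i * c0 * M) by (apply Rmult_le_compat_l; lra).
    assert (0 <= alpha i * g i x) by (apply Rmult_le_pos; [lra|now apply Hg]); lra. }
exists bs; split; [exact Hbs|]; intros beta Hbeta.
(* The bits of [n + 1] encode the nonempty set of intervals on which the [n]-th solution is large. *)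
assert (sol : forall n, exists V : R -> R, (n < 2 ^ m - 1)%nat ->
   pos_radial_solution N R1 R2 (Fnl N m alpha beta A B g k) (fun x => V (h (enorm N x))) /\
   forall i, (i < m)%nat -> (Nat.testbit (S n) i = true -> r <= V ((s (S i) + e (S i)) / 2)) /\
      (Nat.testbit (S n) i = false -> V ((s (S i) + e (S i)) / 2) < r)).
{ intros n; destruct (lt_dec n (2 ^ m - 1)) as [Hn|]; [|exists (fun _ => 0); intros; contradiction].
  destruct (Hcore beta Hbeta (fun i => Nat.testbit (S n) (pred i))) as [V [dV [ddV [HC [V0 [VL [Hdd [Vp Hbits]]]]]]]].
  (* [S n] lies between 1 and [2 ^ m - 1], so its index set is nonempty; bit [i] stands for the
     interval numbered [S i]. *)
  { destruct (nonzero_has_low_bit m (S n)) as [i [Hi Hb]]; [lia|].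
    exists (S i); split; [lia|exact Hb]. }
  exists V; intros _; split.
  - apply (radial_lift N R1 R2 _ V dV ddV HN H1 H12 HC V0 VL Vp).
    intros x [_ Hx]; fold h; set (rho := enorm N x) in *.
    rewrite Hdd by (apply hrange; lra); unfold Fnl; fold rho.
    assert (Hp := powpos rho ltac:(lra)).
    replace (- (- _ / _)) with ((sum_upto (fun i => a (S i) (h rho) * G (S i) (V (h rho))) m -
       sum_upto (fun j => beta j * (b j (h rho) * k j (V (h rho)))) (S m)) * / rho ^ (2 * (N - 1))) by (field; lra).
    rewrite Rmult_minus_distr_r, <- !sum_scal_r; f_equal.
    + apply sum_ext; intros i Hi; destruct (Wa (S i) ltac:(lia)) as [_ [_ w3]].
      rewrite w3 by lra; unfold G; field; lra.
    + apply sum_ext; intros j Hj; destruct (Wb j ltac:(lia)) as [_ [_ w3]].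
      rewrite w3 by lra; field; lra.
  - intros i Hi; exact (Hbits (S i) ltac:(lia)). }
destruct (choice _ sol) as [V HV]; clear sol.
exists (fun n x => V n (h (enorm N x))); split; [intros n Hn; apply HV, Hn|].
intros n1 n2 Hn1 Hn2 ne.
(* The point on the first axis whose radius corresponds to the midpoint of the interval of this bit
   separates the two solutions: one value is at least [r], the other less. *)
destruct (low_bits_differ m (S n1) (S n2)) as [i [Hi Hb]]; [lia|lia|lia|].
destruct (Hse (S i) ltac:(lia)) as [q1 [q2 q3]].
destruct (honto ((s (S i) + e (S i)) / 2)) as [rho [Hrho Erho]]; [lra|].
exists (fun j => if Nat.eq_dec j 0 then rho else 0).
assert (En : enorm N (fun j => if Nat.eq_dec j 0 then rho else 0) = rho) by (apply enorm_axis; lia || lra).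
split.
- split; [|rewrite En; exact Hrho].
  intros j Hj; destruct (Nat.eq_dec j 0); [lia|reflexivity].
- rewrite En, Erho.
  destruct (proj2 (HV n1 Hn1) i Hi) as [T1 F1]; destruct (proj2 (HV n2 Hn2) i Hi) as [T2 F2].
  destruct (Nat.testbit (S n1) i), (Nat.testbit (S n2) i); try (exfalso; now apply Hb).
  + specialize (T1 eq_refl); specialize (F2 eq_refl); lra.
  + specialize (F1 eq_refl); specialize (T2 eq_refl); lra.
Qed.
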